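(* Let $E\in\{\mathscr D_a,\mathscr D,\mathscr S\}$ (with $a>0$), $U\in\mathcal N(E)$ and $\gamma\in C(0)$. Then $$F(E^{(\gamma,U)})=(F(E))^{(\gamma,F(U))},$$ where $F(E^{(\gamma,U)})=\{F(f):f\in E^{(\gamma,U)}\}$.
   Context: Test function spaces on $\mathbb R^n$ ($n\ge1$), all over $\mathbb C$: for $a>0$, $\mathscr D_a$ is the Fréchet space of infinitely differentiable $\xi:\mathbb R^n\to\mathbb C$ with $\xi(x)=0$ for $|x|>a$ (Euclidean norm), with norms $\|\xi\|_p=\sup_{|x|\le a}\max_{|q|\le p}|D^q\xi(x)|$, $p=0,1,2,\dots$; $\mathscr D=\bigcup_{m\ge1}\mathscr D_m$ is the strict inductive limit of the $\mathscr D_m$; $\mathscr S$ is the Fréchet space of infinitely differentiable rapidly decreasing functions with norms $\|\xi\|_p=\sup_{|k|,|q|\le p,\,x\in\mathbb R^n}|x^kD^q\xi(x)|$ ($k,q$ multi-indices). $\mathcal N(X)$ is the family of neighborhoods of $0$ in a topological vector space $X$. $C(0)$ is the set of functions $\gamma:\mathbb C\to\mathbb C$ with $\lim_{t\to0}\gamma(t)=\gamma(0)=0$ and $|\gamma(t)|\ge|t|$ for $|t|\le1$. For a complex topological vector space $X$, $\gamma\in C(0)$ and $U\in\mathcal N(X)$, $X^{(\gamma,U)}$ is the set of continuous $f:X\to\mathbb C$ with $f(0)=0$ such that for all $x\in X$, $u\in U$ and scalars $|t|\le1$ there are scalars $r,s$ with $|r-1|\le|\gamma(t)|$, $|s|\le|\gamma(t)|$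 and $f(x+tu)=rf(x)+sf(u)$ (demi-distributions, when $X=E$ is a test function space). Fourier transform of test functions: for $\xi\in\mathscr D_a$ or $\mathscr D$, $F(\xi)$ is the entire function $F(\xi)(\sigma+i\tau)=\int\xi(x)e^{i(x,\sigma)-(x,\tau)}\,dx$ on $\mathbb C^n$, with $(x,\sigma)=\sum_jx_j\sigma_j$, $(x,\tau)=\sum_jx_j\tau_j$; for $\xi\in\mathscr S$, $F(\xi)(\sigma)=\int\xi(x)e^{i(x,\sigma)}\,dx$, $\sigma\in\mathbb R^n$. The space $F(E)=\{F(\xi):\xi\in E\}$ carries its usual topology, for which $F:E\to F(E)$ is a linear homeomorphism (for $E=\mathscr S$, $F(\mathscr S)=\mathscr S$ with its usual topology); $F(U)=\{F(\xi):\xi\in U\}\in\mathcal N(F(E))$. Fourier transform of demi-distributions: for $f\in E^{(\gamma,U)}$, $F(f):F(E)\to\mathbb C$ is defined by $F(f)(\zeta)=(2\pi)^nf(F^{-1}(\zeta))$, i.e. $F(f)(F(\xi))=(2\pi)^nf(\xi)$ for $\xi\in E$. *)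

(* Defs.v *)
From HB Require Import structures.
From mathcomp Require Import all_boot all_order all_algebra complex.
From mathcomp Require Import all_classical all_reals all_analysis.
Import Order.TTheory GRing.Theory Num.Theory numFieldNormedType.Exports.
Set Implicit Arguments.
Unset Strict Implicit.
Unset Printing Implicit Defensive.
Local Open Scope classical_set_scope.
Local Open Scope ring_scope.
Local Open Scope complex_scope.

Section balanced_convex.
Context {K : numFieldType} {L : lmodType K}.

Definition balanced (W : set L) :=
  forall (t : K) x, `|t| <= 1 -> W x -> W (t *: x).

Definition abs_convex (W : set L) := balanced W /\
  forall (t : K) x y, 0 <= t <= 1 -> W x -> W y -> W (t *: x + (1 - t) *: y).

Definition absorbing (W : set L) := forall x,
  exists2 e : K, 0 < e & forall t : K, `|t| < e -> W (t *: x).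

End balanced_convex.

Lemma complex_norm_bound (R : realType) (r : R[i]) :
  exists n, `|r| + 1 <= (2 ^ n)%:R.
Proof.
exists (Num.truncn (complex.Re `|r| + 1)).+1.
have -> : `|r| = (complex.Re `|r|)%:C by case: r.
set x := complex.Re _.
rewrite -[1](rmorph1 (real_complex R)) -rmorphD -(rmorph_nat (real_complex R)).
rewrite lecR (le_trans (ltW (truncnS_gt _)))// ler_nat.
exact/ltnW/ltn_expl.
Qed.

(* A filter base of balanced absorbing sets, with halving, is a base of
   neighbourhoods of 0 for a unique vector space topology. *)
HB.factory Record Lmodule_hasNbhs0Base (R : realType) L
    & GRing.Lmodule R[i] L := {
  nbhs0_base : set (set L);
  nbhs0_base_ex : nbhs0_base !=set0;
  nbhs0_baseI : forall U V, nbhs0_base U -> nbhs0_base V ->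
    exists2 W, nbhs0_base W & W `<=` U `&` V;
  nbhs0_base_balanced : forall U, nbhs0_base U -> balanced U;
  nbhs0_base_absorbing : forall U, nbhs0_base U -> absorbing U;
  nbhs0_base_half : forall U, nbhs0_base U ->
    exists2 V, nbhs0_base V & forall x y, V x -> V y -> U (x + y)
}.

HB.builders Context R L & Lmodule_hasNbhs0Base R L.

Let base0 U : nbhs0_base U -> U 0.
Proof.
move=> BU; have [e e0 /(_ 0)] := nbhs0_base_absorbing BU 0.
by rewrite scale0r normr0 => /(_ e0).
Qed.

Definition base_nbhs (x : L) (A : set L) :=
  exists2 U, nbhs0_base U & forall u, U u -> A (x + u).

HB.instance Definition _ := hasNbhs.Build L base_nbhs.

Let base_nbhs_filter (x : L) : ProperFilter (nbhs x).
Proof.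
apply: Build_ProperFilter_ex.
  move=> A [U BU UA]. exists (x + 0); apply: UA; exact: base0 BU.
split; first by have [U BU] := nbhs0_base_ex; exists U.
- move=> A B [U BU UA] [V BV VB]; have [W BW WUV] := nbhs0_baseI BU BV.
  by exists W => // w /WUV[/UA ? /VB ?].
- by move=> A B AB [U BU UA]; exists U => // u /UA /AB.
Qed.

Let base_nbhs_singleton (x : L) (A : set L) : nbhs x A -> A x.
Proof. by move=> [U BU UA]; rewrite -[x]addr0; apply: UA; exact: base0 BU. Qed.

Let base_nbhs_nbhs (x : L) (A : set L) : nbhs x A -> nbhs x (nbhs^~ A).
Proof.
move=> [U BU UA]; have [V BV VU] := nbhs0_base_half BU.
by exists V => // v Vv; exists V => // w Vw; rewrite -addrA; apply: UA; exact: VU.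
Qed.

HB.instance Definition _ := Nbhs_isNbhsTopological.Build L
  base_nbhs_filter base_nbhs_singleton base_nbhs_nbhs.

Let base_add_continuous : continuous (fun x : L * L => x.1 + x.2).
Proof.
move=> [x y] A [U BU UA]; have [V BV VU] := nbhs0_base_half BU.
exists ((fun z => V (z - x)), (fun z => V (z - y))) => /=.
  by split; exists V => // v; rewrite addrC addKr.
- move=> [a b] [/= Va Vb].
  have -> : a + b = x + y + ((a - x) + (b - y)).
    by rewrite [RHS]addrC addrACA !subrK.
  by apply: UA; apply: VU.
Qed.

HB.instance Definition _ :=
  PreTopologicalNmodule_isTopologicalNmodule.Build L base_add_continuous.

Let base_natmul (n : nat) U : nbhs0_base U ->
  exists2 V, nbhs0_base V & forall v, V v -> U (v *+ 2 ^ n).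
Proof.
elim: n U => [|n IH] U BU; first by exists U.
have [V BV VU] := nbhs0_base_half BU; have [W BW WV] := IH _ BV.
by exists W => // w /WV ?; rewrite expnS mul2n -addnn mulrnDr; exact: VU.
Qed.


Let base_scale_continuous : continuous (fun z : R[i]^o * L => z.1 *: z.2).
Proof.
move=> [r x] A [U BU UA]; have [V BV VU] := nbhs0_base_half BU.
have [e e0 Ve] := nbhs0_base_absorbing BV x.
have [n rn] := complex_norm_bound r; have [W BW WV] := base_natmul n BV.
exists ((fun t => `|t - r| < e /\ `|t - r| < 1), (fun z => W (z - x))) => /=.
  split; last by exists W => // v; rewrite addrC addKr.
  have B (d : R[i]) : 0 < d -> nbhs (r : R[i]^o) [set t | `|t - r| < d].
    by move=> d0; exists d => // t /=; rewrite distrC.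
  by apply: filterI; exact: B.
move=> [t y] [/= [tr tr1] Wy].
have -> : t *: y = r *: x + ((t - r) *: x + t *: (y - x)).
  by rewrite addrA -scalerDl [r + _]addrC subrK -scalerDr [x + _]addrC subrK.
apply: UA; apply: VU; first exact: Ve.
have t_n : `|t| <= (2 ^ n)%:R.
  rewrite (le_trans _ rn)// -[t](subrK r) addrC (le_trans (ler_normD _ _))//.
  by rewrite lerD2l ltW.
have n0 : (2 ^ n)%:R != 0 :> R[i] by rewrite pnatr_eq0 expn_eq0.
rewrite -[t](mulfVK n0) -scalerA scaler_nat.
apply: (nbhs0_base_balanced BV); last exact: WV.
by rewrite normf_div normr_nat ler_pdivrMr ?mul1r// ltr0n expn_gt0.
Qed.

HB.instance Definition _ :=
  TopologicalNmodule_isTopologicalLmodule.Build R[i] L base_scale_continuous.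

HB.end.

Section modulus.
Context {R : realType}.

(* `|z| on R[i] is itself a (real) complex number; this is its value in R. *)
Definition modulus (z : R[i]) : R := complex.Re `|z|.

Lemma modulusE (z : R[i]) : (modulus z)%:C = `|z|.
Proof. by rewrite /modulus; case: z. Qed.

Lemma modulus_ge0 (z : R[i]) : 0 <= modulus z.
Proof. by rewrite -lecR modulusE; exact: normr_ge0. Qed.

Lemma modulus0 : modulus 0 = 0 :> R. Proof. by rewrite /modulus normr0. Qed.

Lemma modulusD (z w : R[i]) : modulus (z + w) <= modulus z + modulus w.
Proof. by rewrite -lecR rmorphD/= !modulusE ler_normD. Qed.

Lemma modulusM (z w : R[i]) : modulus (z * w) = modulus z * modulus w.
Proof.
by apply: (@complexI R); rewrite rmorphM/= !modulusE normrM.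
Qed.

Lemma modulus_le (z : R[i]) : modulus z <= `|complex.Re z| + `|complex.Im z|.
Proof.
case: z => a b /=; rewrite /modulus /=.
rewrite -(@ler_pXn2r _ 2)// ?nnegrE ?sqrtr_ge0 ?addr_ge0//.
rewrite sqr_sqrtr ?addr_ge0 ?sqr_ge0// sqrrD !real_normK ?num_real//.
by rewrite lerD2r lerDl mulrn_wge0// mulr_ge0.
Qed.

End modulus.

(* The locally convex topology defined by an increasing sequence of seminorms,
   with neighbourhood base the sets {x | norms p x < e}. *)
HB.factory Record Lmodule_hasNorms (R : realType) L & GRing.Lmodule R[i] L := {
  norms : nat -> L -> \bar R;
  norms_lty : forall p x, (norms p x < +oo)%E;
  normsD : forall p x y, (norms p (x + y)%R <= norms p x + norms p y)%E;
  normsZ : forall p t x, (norms p (t *: x)%R <= (modulus t)%:E * norms p x)%E;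
  norms_homo : forall p q x, (p <= q)%N -> (norms p x <= norms q x)%E
}.

HB.builders Context R L & Lmodule_hasNorms R L.

Definition norms_base : set (set L) :=
  [set U | exists p (e : R), 0 < e /\ U = [set x | (norms p x < e%:E)%E]].

Let base_ex : norms_base !=set0.
Proof. by exists [set x | (norms 0 x < 1%:E)%E], 0%N, 1. Qed.

Let baseI U V : norms_base U -> norms_base V ->
  exists2 W, norms_base W & W `<=` U `&` V.
Proof.
move=> [p [e [e0 ->]]] [q [d [d0 ->]]].
exists [set x | (norms (maxn p q) x < (Num.min e d)%:E)%E].
  by exists (maxn p q), (Num.min e d); rewrite lt_min e0 d0.
move=> x /= xed; split => /=; apply: (@le_lt_trans _ _ (norms (maxn p q) x)).
- by apply: norms_homo; rewrite leq_maxl.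
- by rewrite (lt_le_trans xed)// lee_fin ge_min lexx.
- by apply: norms_homo; rewrite leq_maxr.
- by rewrite (lt_le_trans xed)// lee_fin ge_min lexx orbT.
Qed.

Let norms_scale p t x M : 0 < M -> (norms p x < M%:E)%E ->
  (norms p (t *: x)%R <= (modulus t * M)%:E)%E.
Proof.
move=> M0 xM; rewrite (le_trans (normsZ _ _ _))// EFinM.
by rewrite lee_wpmul2l ?lee_fin ?modulus_ge0// ltW.
Qed.

Let base_balanced U : norms_base U -> balanced U.
Proof.
move=> [p [e [e0 ->]]] t x t1 /= xe.
have [t0|t0] := eqVneq t 0.
  apply: (@le_lt_trans _ _ ((modulus t * e)%:E)); first exact: norms_scale.
  by rewrite t0 modulus0 mul0r lte_fin.
rewrite (le_lt_trans (normsZ _ _ _))//.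
have t0' : 0 < modulus t by rewrite -ltcR modulusE normr_gt0.
apply: (@lt_le_trans _ _ ((modulus t)%:E * e%:E)%E).
  by rewrite lte_pmul2l// lte_fin.
by rewrite -EFinM lee_fin ler_piMl ?(ltW e0)// -lecR modulusE.
Qed.

Let base_absorbing U : norms_base U -> absorbing U.
Proof.
move=> [p [e [e0 ->]]] x.
have [M M0 xM] : exists2 M : R, 0 < M & (norms p x < M%:E)%E.
  have := norms_lty p x; case: (norms p x) => [r _|//|_].
    exists (`|r| + 1); first by rewrite ltr_pwDr.
    by rewrite lte_fin (le_lt_trans (ler_norm _))// ltrDl.
  by exists 1; rewrite ?ltNyr.
exists (e / M)%:C; first by rewrite ltcR divr_gt0.
move=> t; rewrite -modulusE ltcR ltr_pdivlMr// => tM /=.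
by rewrite (le_lt_trans (norms_scale _ M0 xM))// lte_fin.
Qed.

Let base_half U : norms_base U ->
  exists2 V, norms_base V & forall x y, V x -> V y -> U (x + y).
Proof.
move=> [p [e [e0 ->]]]; exists [set x | (norms p x < (e / 2)%:E)%E].
  by exists p, (e / 2); rewrite divr_gt0.
move=> x y /= xe ye; rewrite (le_lt_trans (normsD _ _ _))// (splitr e) EFinD.
exact: lteD.
Qed.

HB.instance Definition _ := Lmodule_hasNbhs0Base.Build R L
  base_ex baseI base_balanced base_absorbing base_half.

HB.end.

Lemma lin_continuous {R : realType} {T : topologicalType} (a b : R)
  (f g : T -> R) : continuous f -> continuous g ->
  continuous (fun x => a * f x + b * g x).
Proof.
by move=> cf cg x; apply: cvgD; apply: cvgMl_tmp; [exact: cf|exact: cg].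
Qed.

Section calculus.
Context {R : realType} {n : nat}.
Implicit Types (f g : 'rV[R]_n -> R) (xi : 'rV[R]_n -> R[i]).
Implicit Types (s : seq 'I_n) (q : {ffun 'I_n -> nat}).

Definition partial (i : 'I_n) f : 'rV[R]_n -> R :=
  fun x => 'D_(delta_mx 0 i) f x.

Definition partials s f := foldr partial f s.

(* C^oo: all iterated partial derivatives exist and are continuous. *)
Definition smooth f := forall s, continuous (partials s f) /\
  forall (x : 'rV[R]_n) i, derivable (partials s f) x (delta_mx 0 i).

(* Derivatives of complex-valued functions are taken on the real and imaginary
   parts; complex.Re and complex.Im are the R-valued projections of R[i], as
   opposed to the 'Re and 'Im of numClosedFieldType. *)
Definition csmooth xi := smooth (@complex.Re R \o xi) /\ smooth (@complex.Im R \o xi).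

Definition mdeg q : nat := \sum_i q i.

(* D^q = D_1^(q_1) ... D_n^(q_n); the order is immaterial on smooth functions. *)
Definition multi_seq q : seq 'I_n := flatten [seq nseq (q i) i | i <- enum 'I_n].

Definition mderiv q xi : 'rV[R]_n -> R[i] := fun x =>
  partials (multi_seq q) (@complex.Re R \o xi) x +i*
  partials (multi_seq q) (@complex.Im R \o xi) x.

Definition monom q (x : 'rV[R]_n) : R := \prod_i x 0 i ^+ q i.

Definition enorm (x : 'rV[R]_n) : R := Num.sqrt (\sum_i x 0 i ^+ 2).

Definition dot (x y : 'rV[R]_n) : R := \sum_i x 0 i * y 0 i.

Lemma partials_lin s (a b : R) f g : smooth f -> smooth g ->
  partials s (fun x => a * f x + b * g x) =
  (fun x => a * partials s f x + b * partials s g x).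
Proof.
move=> sf sg; elim: s => [//|i s IH] /=; rewrite IH; apply/funext => x.
rewrite /partial.
have df := (sf s).2 x i; have dg := (sg s).2 x i.
rewrite (@deriveD _ _ _ (a \*: partials s f) (b \*: partials s g)); first last.
- exact: derivableZ.
- exact: derivableZ.
- by rewrite !deriveZ.
Qed.

Lemma smooth_lin (a b : R) f g : smooth f -> smooth g ->
  smooth (fun x => a * f x + b * g x).
Proof.
move=> sf sg s; rewrite partials_lin//; split.
  by apply: lin_continuous; [exact: (sf s).1|exact: (sg s).1].
move=> x i; apply: (@derivableD _ _ _ (a \*: partials s f) (b \*: partials s g)).
  by apply: derivableZ; exact: (sf s).2.
by apply: derivableZ; exact: (sg s).2.
Qed.

Let lin2 (a b : R) f g : 'rV[R]_n -> R := fun x => a * f x + b * g x.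

Let linRe (c : R[i]) xi zeta : @complex.Re R \o (c *: xi + zeta) =
  lin2 1 1 (lin2 (complex.Re c) (- complex.Im c)
    (@complex.Re R \o xi) (@complex.Im R \o xi)) (@complex.Re R \o zeta).
Proof.
apply/funext => x; rewrite /lin2 /= !fctE/= !mul1r.
by case: c (xi x) (zeta x) => [a b] [u v] [w z] /=; rewrite mulNr.
Qed.

Let linIm (c : R[i]) xi zeta : @complex.Im R \o (c *: xi + zeta) =
  lin2 1 1 (lin2 (complex.Re c) (complex.Im c)
    (@complex.Im R \o xi) (@complex.Re R \o xi)) (@complex.Im R \o zeta).
Proof.
apply/funext => x; rewrite /lin2 /= !fctE/= !mul1r.
by case: c (xi x) (zeta x) => [a b] [u v] [w z] /=.
Qed.

Lemma csmooth_lin (c : R[i]) xi zeta : csmooth xi -> csmooth zeta ->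
  csmooth (c *: xi + zeta).
Proof.
move=> [xr xi'] [zr zi]; rewrite /csmooth linRe linIm; split.
- by apply: smooth_lin zr; exact: smooth_lin.
- by apply: smooth_lin zi; exact: smooth_lin.
Qed.

Lemma mderiv_lin q (c : R[i]) xi zeta x : csmooth xi -> csmooth zeta ->
  mderiv q (c *: xi + zeta) x = c * mderiv q xi x + mderiv q zeta x.
Proof.
move=> [xr xi'] [zr zi]; rewrite /mderiv linRe linIm.
rewrite [in X in X +i* _](partials_lin _ _ _ (smooth_lin _ _ xr xi') zr).
rewrite [in X in _ +i* X](partials_lin _ _ _ (smooth_lin _ _ xi' xr) zi).
rewrite (partials_lin _ _ _ xr xi') (partials_lin _ _ _ xi' xr).
by case: c => a b /=; rewrite !mul1r mulNr.
Qed.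

Lemma smooth0 : smooth (fun=> 0).
Proof.
have p0 s : partials s (fun=> 0) = (fun=> 0).
  by elim: s => [//|i s /= ->]; apply/funext => x; rewrite /partial derive_cst.
move=> s; rewrite p0; split; first exact: cst_continuous.
by move=> x i; exact: derivable_cst.
Qed.

Lemma csmooth0 : csmooth 0.
Proof. by split; exact: smooth0. Qed.

End calculus.

Section norms.
Context {R : realType} {n : nat}.
Implicit Types (xi zeta : 'rV[R]_n -> R[i]).

Definition Da_norm (a : R) (p : nat) xi : \bar R :=
  ereal_sup [set z | exists (x : 'rV[R]_n) (q : {ffun 'I_n -> nat}),
    [/\ enorm x <= a, (mdeg q <= p)%N & z = (modulus (mderiv q xi x))%:E]].

Definition S_norm (p : nat) xi : \bar R :=
  ereal_sup [set z | exists (x : 'rV[R]_n) (k q : {ffun 'I_n -> nat}),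
    [/\ (mdeg k <= p)%N, (mdeg q <= p)%N
      & z = (modulus ((monom k x)%:C * mderiv q xi x))%:E]].

Definition Da_pred (a : R) : {pred 'rV[R]_n -> R[i]} := fun xi =>
  `[< csmooth xi /\ forall x, a < enorm x -> xi x = 0 >].

Definition D_pred : {pred 'rV[R]_n -> R[i]} := fun xi =>
  `[< exists2 m : nat, (0 < m)%N & xi \in Da_pred m%:R >].

Definition S_pred : {pred 'rV[R]_n -> R[i]} := fun xi =>
  `[< csmooth xi /\ forall p, (S_norm p xi < +oo)%E >].

Lemma csmoothD xi zeta : csmooth xi -> csmooth zeta -> csmooth (xi + zeta).
Proof. by move=> sx sz; rewrite -[xi]scale1r; exact: csmooth_lin. Qed.

Lemma csmoothZ (c : R[i]) xi : csmooth xi -> csmooth (c *: xi).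
Proof. by move=> sx; rewrite -[_ *: _]addr0; apply: csmooth_lin csmooth0. Qed.

Lemma mderivD q xi zeta x : csmooth xi -> csmooth zeta ->
  mderiv q (xi + zeta) x = mderiv q xi x + mderiv q zeta x.
Proof. by move=> sx sz; rewrite -[xi in LHS]scale1r mderiv_lin// mul1r. Qed.

Lemma mderiv0 q (x : 'rV[R]_n) : mderiv q 0 x = 0 :> R[i].
Proof.
have := @mderivD q 0 0 x csmooth0 csmooth0.
by rewrite addr0 => /eqP; rewrite -subr_eq subrr => /eqP <-.
Qed.

Lemma mderivZ q (c : R[i]) xi x : csmooth xi ->
  mderiv q (c *: xi) x = c * mderiv q xi x.
Proof.
move=> sx; rewrite -[_ *: _]addr0 mderiv_lin//; last exact: csmooth0.
by rewrite mderiv0 addr0.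
Qed.

Lemma Da_normD a p xi zeta : csmooth xi -> csmooth zeta ->
  (Da_norm a p (xi + zeta)%R <= Da_norm a p xi + Da_norm a p zeta)%E.
Proof.
move=> sx sz; apply: ge_ereal_sup => _ [x [q [xa qp ->]]].
rewrite mderivD// (@le_trans _ _ ((modulus (mderiv q xi x))%:E +
  (modulus (mderiv q zeta x))%:E)%E)//.
  by rewrite -EFinD lee_fin modulusD.
by apply: leeD; apply: ereal_sup_ubound; exists x, q.
Qed.

Lemma Da_normZ a p (c : R[i]) xi : csmooth xi ->
  (Da_norm a p (c *: xi)%R <= (modulus c)%:E * Da_norm a p xi)%E.
Proof.
move=> sx; apply: ge_ereal_sup => _ [x [q [xa qp ->]]].
rewrite mderivZ// modulusM EFinM lee_wpmul2l ?lee_fin ?modulus_ge0//.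
by apply: ereal_sup_ubound; exists x, q.
Qed.

Lemma Da_norm_homo a p r xi : (p <= r)%N -> (Da_norm a p xi <= Da_norm a r xi)%E.
Proof.
move=> pr; apply: ge_ereal_sup => _ [x [q [xa qp ->]]].
by apply: ereal_sup_ubound; exists x, q; split => //; rewrite (leq_trans qp).
Qed.

Lemma S_normD p xi zeta : csmooth xi -> csmooth zeta ->
  (S_norm p (xi + zeta)%R <= S_norm p xi + S_norm p zeta)%E.
Proof.
move=> sx sz; apply: ge_ereal_sup => _ [x [k [q [kp qp ->]]]].
rewrite mderivD// mulrDr (@le_trans _ _
  ((modulus ((monom k x)%:C * mderiv q xi x))%:E +
   (modulus ((monom k x)%:C * mderiv q zeta x))%:E)%E)//.
  by rewrite -EFinD lee_fin modulusD.
by apply: leeD; apply: ereal_sup_ubound; exists x, k, q.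
Qed.

Lemma S_normZ p (c : R[i]) xi : csmooth xi ->
  (S_norm p (c *: xi)%R <= (modulus c)%:E * S_norm p xi)%E.
Proof.
move=> sx; apply: ge_ereal_sup => _ [x [k [q [kp qp ->]]]].
rewrite mderivZ// mulrCA modulusM EFinM lee_wpmul2l ?lee_fin ?modulus_ge0//.
by apply: ereal_sup_ubound; exists x, k, q.
Qed.

Lemma S_norm_homo p r xi : (p <= r)%N -> (S_norm p xi <= S_norm r xi)%E.
Proof.
move=> pr; apply: ge_ereal_sup => _ [x [k [q [kp qp ->]]]].
by apply: ereal_sup_ubound; exists x, k, q; split => //;
  [rewrite (leq_trans kp)|rewrite (leq_trans qp)].
Qed.

Lemma S_norm0 p : (S_norm p 0%R <= 0)%E.
Proof.
apply: ge_ereal_sup => _ [x [k [q [kp qp ->]]]].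
by rewrite mderiv0 mulr0 modulus0.
Qed.

Lemma normr_le_enorm (x : 'rV[R]_n) : `|x| <= enorm x.
Proof.
rewrite [leLHS]/Num.norm/= mx_normrE; apply/bigmax_leP; split => /=.
  exact: sqrtr_ge0.
move=> [i j] _ /=; rewrite ord1 -sqrtr_sqr ler_wsqrtr// (bigD1 j)//= lerDl.
by rewrite sumr_ge0// => k _; exact: sqr_ge0.
Qed.

Lemma Da_norm_lty a p xi : csmooth xi -> (Da_norm a p xi < +oo)%E.
Proof.
move=> [xr xi'].
have bnd (f : 'rV[R]_n -> R) : continuous f ->
    exists M, forall x : 'rV[R]_n, enorm x <= a -> `|f x| <= M.
  move=> cf; pose K := [set x : 'rV[R]_n | `|x| <= a].
  have cK : compact K.
    apply: bounded_closed_compact.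
      exists a; split; first exact: num_real.
      by move=> M aM x /= xa; rewrite (le_trans xa)// ltW.
    have -> : K = Num.norm @^-1` [set y | y <= a] by [].
    by apply: closed_comp => [x _|]; [exact: norm_continuous|exact: closed_le].
  have [M [_ fM]] : bounded_set (f @` K).
    by apply/compact_bounded/continuous_compact => //; exact: continuous_subspaceT.
  exists (M + 1) => x xa; apply: (fM (M + 1)); first by rewrite ltrDl.
  by exists x => //; rewrite /K/= (le_trans (normr_le_enorm x)).
have /choice[M HM] : forall q : {ffun 'I_n -> 'I_p.+1}, exists M : R,
    forall x : 'rV[R]_n, enorm x <= a ->
    modulus (mderiv [ffun i => q i : nat] xi x) <= M.
  move=> q; have [M1 H1] := bnd _ (xr (multi_seq [ffun i => q i : nat])).1.
  have [M2 H2] := bnd _ (xi' (multi_seq [ffun i => q i : nat])).1.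
  exists (M1 + M2) => x xa; rewrite (le_trans (modulus_le _))//=.
  by apply: lerD; [exact: H1|exact: H2].
apply: (@le_lt_trans _ _ (\sum_q `|M q|)%:E); last exact: ltry.
apply: ge_ereal_sup => _ [x [q [xa qp ->]]]; rewrite lee_fin.
have -> : q = [ffun i => (([ffun i => inord (q i)] : {ffun 'I_n -> 'I_p.+1}) i) : nat].
  apply/ffunP => i; rewrite !ffunE inordK// ltnS (leq_trans _ qp)//.
  by rewrite /mdeg (bigD1 i)//= leq_addr.
move: [ffun i => inord (q i)] => q'.
rewrite (le_trans (HM q' x xa))// (le_trans (ler_norm _))//.
by rewrite (bigD1 q')//= lerDl sumr_ge0.
Qed.

End norms.

Section subspaces.
Context {R : realType} {n : nat}.
Implicit Types (xi zeta : 'rV[R]_n -> R[i]).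

Lemma Da_pred_submod (a : R) : submod_closed (Da_pred a : {pred 'rV[R]_n -> R[i]}).
Proof.
split; first by apply/asboolP; split; first exact: csmooth0.
move=> c xi zeta /asboolP[sx x0] /asboolP[sz z0]; apply/asboolP; split.
  exact: csmooth_lin.
by move=> x ax; rewrite -[LHS]/(c * xi x + zeta x) x0// z0// mulr0 addr0.
Qed.

Lemma Da_predS (a b : R) xi : a <= b -> xi \in Da_pred a -> xi \in Da_pred b.
Proof.
move=> ab /asboolP[sx x0]; apply/asboolP; split=> // x bx.
by apply: x0; exact: le_lt_trans bx.
Qed.

Lemma D_pred_submod : submod_closed (D_pred : {pred 'rV[R]_n -> R[i]}).
Proof.
split.
  by apply/asboolP; exists 1%N => //; have [] := Da_pred_submod 1%N%:R.
move=> c xi zeta /asboolP[m m0 xm] /asboolP[k k0 zk]; apply/asboolP.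
exists (maxn m k); first by rewrite leq_max m0.
have [_ ->//] := Da_pred_submod (maxn m k)%:R.
  by apply: Da_predS xm; rewrite ler_nat leq_maxl.
by apply: Da_predS zk; rewrite ler_nat leq_maxr.
Qed.

Lemma S_pred_submod : submod_closed (S_pred : {pred 'rV[R]_n -> R[i]}).
Proof.
split.
  apply/asboolP; split; first exact: csmooth0.
  by move=> p; rewrite (le_lt_trans (S_norm0 p))// ltry.
move=> c xi zeta /asboolP[sx xp] /asboolP[sz zp]; apply/asboolP; split.
  exact: csmooth_lin.
move=> p; have sc := csmoothZ c sx.
rewrite (le_lt_trans (S_normD p sc sz))// lte_add_pinfty//.
rewrite (le_lt_trans (S_normZ p c sx))//.
have := xp p; case: (S_norm p xi) => [r _|//|_]; first by rewrite -EFinM ltry.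
have [->|c0] := eqVneq (modulus c) 0; first by rewrite mul0e ltry.
by rewrite gt0_muleNy ?ltNyr// lte_fin lt_neqAle eq_sym c0 modulus_ge0.
Qed.

HB.instance Definition _ (a : R) := GRing.isSubmodClosed.Build R[i]
  ('rV[R]_n -> R[i]) (Da_pred a) (Da_pred_submod a).
HB.instance Definition _ := GRing.isSubmodClosed.Build R[i]
  ('rV[R]_n -> R[i]) D_pred D_pred_submod.
HB.instance Definition _ := GRing.isSubmodClosed.Build R[i]
  ('rV[R]_n -> R[i]) S_pred S_pred_submod.

End subspaces.

Record Da (R : realType) (n : nat) (a : R) :=
  MkDa { Da_fun :> 'rV[R]_n -> R[i]; _ : Da_fun \in Da_pred a }.

HB.instance Definition _ (R : realType) n (a : R) := [isSub for @Da_fun R n a].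
HB.instance Definition _ (R : realType) n (a : R) := [Choice of @Da R n a by <:].
HB.instance Definition _ (R : realType) n (a : R) :=
  [SubChoice_isSubLmodule of @Da R n a by <:].

(* Union of the D_m, m >= 1. *)
Record Dtest (R : realType) (n : nat) :=
  MkDtest { Dtest_fun :> 'rV[R]_n -> R[i]; _ : Dtest_fun \in D_pred }.

HB.instance Definition _ (R : realType) n := [isSub for @Dtest_fun R n].
HB.instance Definition _ (R : realType) n := [Choice of @Dtest R n by <:].
HB.instance Definition _ (R : realType) n :=
  [SubChoice_isSubLmodule of @Dtest R n by <:].

Record schwartz (R : realType) (n : nat) :=
  MkSchwartz { S_fun :> 'rV[R]_n -> R[i]; _ : S_fun \in S_pred }.

HB.instance Definition _ (R : realType) n := [isSub for @S_fun R n].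
HB.instance Definition _ (R : realType) n := [Choice of @schwartz R n by <:].
HB.instance Definition _ (R : realType) n :=
  [SubChoice_isSubLmodule of @schwartz R n by <:].

Section norms_instances.
Context {R : realType} {n : nat}.

Lemma Da_csmooth a (xi : @Da R n a) : csmooth xi.
Proof. by case: xi => xi /= /asboolP[]. Qed.

Lemma S_csmooth (xi : @schwartz R n) : csmooth xi.
Proof. by case: xi => xi /= /asboolP[]. Qed.

HB.instance Definition _ (a : R) := @Lmodule_hasNorms.Build R (@Da R n a)
  (fun p xi => Da_norm a p xi)
  (fun p xi => Da_norm_lty a p (Da_csmooth xi))
  (fun p xi zeta => Da_normD a p (Da_csmooth xi) (Da_csmooth zeta))
  (fun p t xi => Da_normZ a p t (Da_csmooth xi))
  (fun p q xi => @Da_norm_homo R n a p q xi).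

Lemma S_norm_lty p (xi : @schwartz R n) : (S_norm p xi < +oo)%E.
Proof. by case: xi => xi /= /asboolP[_]; exact. Qed.

HB.instance Definition _ := @Lmodule_hasNorms.Build R (@schwartz R n)
  (fun p xi => S_norm p xi) S_norm_lty
  (fun p xi zeta => S_normD p (S_csmooth xi) (S_csmooth zeta))
  (fun p t xi => S_normZ p t (S_csmooth xi))
  (fun p q xi => @S_norm_homo R n p q xi).

End norms_instances.

Section tvs_nbhs0.
Context {R : realType} {E : topologicalLmodType R[i]}.

Lemma nbhs0_scale (c : R[i]) (W : set E) :
  nbhs (0 : E) W -> nbhs (0 : E) [set x | W (c *: x)].
Proof.
move=> W0; have /(_ W) := @scale_continuous _ E (c, 0).
rewrite /= scaler0 => /(_ W0) [[P Q] /= [Pc Q0] PQ].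
apply: filterS Q0 => x Qx; apply: (PQ (c, x)); split => //=.
exact: nbhs_singleton Pc.
Qed.

Lemma nbhs0_absorbing (W : set E) : nbhs (0 : E) W -> absorbing W.
Proof.
move=> W0 x; have /(_ W) := @scale_continuous _ E (0, x).
rewrite /= scale0r => /(_ W0) [[P Q] /= [[e e0 Pe] Q0] PQ].
exists e => // t te; apply: (PQ (t, x)); split => /=; last exact: nbhs_singleton Q0.
by apply: Pe; rewrite /= sub0r normrN.
Qed.

Lemma nbhs0_balanced (W : set E) : nbhs (0 : E) W ->
  exists2 V, nbhs (0 : E) V /\ balanced V & V `<=` W.
Proof.
move=> W0; have /(_ W) := @scale_continuous _ E (0, 0).
rewrite /= scale0r => /(_ W0) [[P Q] /= [[e e0 Pe] Q0] PQ].
exists [set x | exists t y, [/\ `|t| < e, Q y & x = t *: y]]; last first.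
  move=> _ [t [y [te Qy ->]]]; apply: (PQ (t, y)); split => //=.
  by apply: Pe; rewrite /= sub0r normrN.
split.
  have e20 : 0 < e / 2 by rewrite divr_gt0.
  apply: filterS (@nbhs0_scale (e / 2)^-1 Q Q0) => x Qx.
  exists (e / 2), ((e / 2)^-1 *: x); split => //.
    by rewrite gtr0_norm// ltr_pdivrMr// ltr_pMr// ltr1n.
  by rewrite scalerA divff ?scale1r// gt_eqF.
move=> t _ t1 [s [y [se Qy ->]]]; exists (t * s), y; split => //.
  by rewrite normrM (le_lt_trans _ se)// ler_piMl.
by rewrite scalerA.
Qed.

Lemma nbhs0_half (W : set E) : nbhs (0 : E) W ->
  exists2 V, nbhs (0 : E) V & forall x y, V x -> V y -> W (x + y).
Proof.
move=> W0; have /(_ W) := @add_continuous E (0, 0).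
rewrite /= addr0 => /(_ W0) [[P Q] /= [P0 Q0] PQ].
exists (P `&` Q); first exact: filterI.
by move=> x y [Px _] [_ Qy]; apply: (PQ (x, y)).
Qed.

End tvs_nbhs0.

Section D_topology.
Context {R : realType} {n : nat}.

Lemma Da_in_D (m : nat) (xi : @Da R n m.+1%:R) : Da_fun xi \in D_pred.
Proof. by case: xi => xi xD; apply/asboolP; exists m.+1. Qed.

Definition Da_incl (m : nat) (xi : @Da R n m.+1%:R) : @Dtest R n := MkDtest (Da_in_D xi).

(* Strict inductive limit topology: the finest locally convex topology for which
   all the inclusions D_m -> D, m >= 1, are continuous. *)
Definition D_base : set (set (@Dtest R n)) := [set W | abs_convex W /\
  forall m : nat, nbhs (0 : @Da R n m.+1%:R) (@Da_incl m @^-1` W)].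

Let incl0 m : @Da_incl m 0 = 0. Proof. exact: val_inj. Qed.

Let inclZ m (t : R[i]) xi : @Da_incl m (t *: xi) = t *: @Da_incl m xi.
Proof. exact: val_inj. Qed.

Let incl_ex (xi : @Dtest R n) : exists m zeta, xi = @Da_incl m zeta.
Proof.
case: xi => xi xD; have /asboolP[[//|m] _ xm] := xD.
by exists m, (MkDa xm); exact: val_inj.
Qed.

Let base_ex : D_base !=set0.
Proof. by exists setT; split => // m; exact: filterT. Qed.

Let baseI U V : D_base U -> D_base V -> exists2 W, D_base W & W `<=` U `&` V.
Proof.
move=> [[bU cU] nU] [[bV cV] nV]; exists (U `&` V) => //; split; last first.
  by move=> m; exact: filterI.
split; first by move=> t x t1 [Ux Vx]; split; [exact: bU|exact: bV].
by move=> t x y t1 [Ux Vx] [Uy Vy]; split; [exact: cU|exact: cV].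
Qed.

Let base_balanced U : D_base U -> balanced U. Proof. by move=> [[]]. Qed.

Let base_absorbing U : D_base U -> absorbing U.
Proof.
move=> [_ nU] x; have [m [zeta ->]] := incl_ex x.
have [e e0 He] := nbhs0_absorbing (nU m) zeta.
by exists e => // t /He /=; rewrite inclZ.
Qed.

Let base_half U : D_base U ->
  exists2 V, D_base V & forall x y, V x -> V y -> U (x + y).
Proof.
move=> [[bU cU] nU]; exists [set x | U ((2 : R[i]) *: x)]; last first.
  move=> x y /= Ux Uy; have -> : x + y =
      (2^-1 : R[i]) *: ((2 : R[i]) *: x) + (1 - 2^-1 : R[i]) *: ((2 : R[i]) *: y).
    have h : 1 - 2^-1 = 2^-1 :> R[i] by rewrite {1}(splitr 1) div1r addrK.
    by rewrite h !scalerA mulVf ?pnatr_eq0// !scale1r.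
  by apply: cU => //; rewrite invr_ge0 ler0n invf_le1 ?ltr0n// ler1n.
split; last first.
  by move=> m; have := nbhs0_scale 2 (nU m); apply: filterS => x /=; rewrite inclZ.
split => [t x t1 /= Ux|t x y t1 /= Ux Uy].
  by rewrite scalerA mulrC -scalerA; exact: bU.
rewrite scalerDr !scalerA mulrC [2 * _]mulrC -!scalerA; exact: cU.
Qed.

HB.instance Definition _ := Lmodule_hasNbhs0Base.Build R (@Dtest R n)
  base_ex baseI base_balanced base_absorbing base_half.

End D_topology.

Section lrange.
Context {R : realType} {E : topologicalLmodType R[i]} {W : lmodType R[i]}.
Variable L : {linear E -> W}.

Definition lrange_pred : {pred W} := fun w => `[< exists x, L x = w >].

Lemma lrange_pred_submod : submod_closed lrange_pred.
Proof.
split; first by apply/asboolP; exists 0; rewrite linear0.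
move=> c v w /asboolP[x <-] /asboolP[y <-]; apply/asboolP.
by exists (c *: x + y); rewrite linearP.
Qed.

HB.instance Definition _ :=
  GRing.isSubmodClosed.Build R[i] W lrange_pred lrange_pred_submod.

(* The range of L with the topology transported along L: the images of the
   neighbourhoods of 0 are the neighbourhoods of 0 (it suffices to take the
   balanced ones). When L is injective this is the only topology which makes
   L : E -> lrange a homeomorphism. *)
Record lrange := MkLrange { lrange_val :> W; _ : lrange_val \in lrange_pred }.

HB.instance Definition _ := [isSub for lrange_val].
HB.instance Definition _ := [Choice of lrange by <:].
HB.instance Definition _ := [SubChoice_isSubLmodule of lrange by <:].

Definition lrange_base : set (set lrange) := [set V | exists2 U,
  nbhs (0 : E) U /\ balanced U & V = [set w | exists2 x, U x & L x = val w]].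

Let base_ex : lrange_base !=set0.
Proof. by eexists; exists setT => //; split => //; exact: filterT. Qed.

Let baseI U V : lrange_base U -> lrange_base V ->
  exists2 W, lrange_base W & W `<=` U `&` V.
Proof.
move=> [A [nA bA] ->] [B [nB bB] ->].
exists [set w : lrange | exists2 x, (A `&` B) x & L x = val w].
  exists (A `&` B) => //; split; first exact: filterI.
  by move=> t x t1 [Ax Bx]; split; [exact: bA|exact: bB].
by move=> w [x [Ax Bx] Lx]; split; exists x.
Qed.

Let base_balanced U : lrange_base U -> balanced U.
Proof.
move=> [A [nA bA] ->] t w t1 [x Ax Lx]; exists (t *: x); first exact: bA.
by rewrite linearZ/= Lx.
Qed.

Let base_absorbing U : lrange_base U -> absorbing U.
Proof.
move=> [A [nA bA] ->] w; have /asboolP[x Lx] : val w \in lrange_pred by exact: valP.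
have [e e0 He] := nbhs0_absorbing nA x; exists e => // t te.
by exists (t *: x); [exact: He|rewrite linearZ/= Lx].
Qed.

Let base_half U : lrange_base U ->
  exists2 V, lrange_base V & forall x y, V x -> V y -> U (x + y).
Proof.
move=> [A [nA bA] ->]; have [B nB BA] := nbhs0_half nA.
have [B' [nB' bB'] B'B] := nbhs0_balanced nB.
exists [set w : lrange | exists2 x, B' x & L x = val w]; first by exists B'.
move=> v w [x /B'B Bx Lx] [y /B'B By Ly]; exists (x + y); first exact: BA.
by rewrite linearD/= Lx Ly.
Qed.

HB.instance Definition _ := Lmodule_hasNbhs0Base.Build R lrange
  base_ex baseI base_balanced base_absorbing base_half.

End lrange.

Lemma mx_continuous {R : realType} {T : topologicalType} m n
    (h : T -> 'M[R]_(m, n)) :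
  (forall i j, continuous (fun t => h t i j)) -> continuous h.
Proof.
move=> ch t A [P Pt PA].
have : \forall s \near t, forall i j, P i j (h s i j).
  apply: filter_forall => i; apply: filter_forall => j.
  exact: (ch i j t _ (Pt i j)).
by apply: filterS => s Ps; exact: PA.
Qed.

Lemma pair_continuous {T U V : topologicalType} (f : T -> U) (g : T -> V) :
  continuous f -> continuous g -> continuous (fun t => (f t, g t)).
Proof. by move=> cf cg t; apply: (cvg_pair (cf t) (cg t)). Qed.

Lemma comp_continuous {T U V : topologicalType} (f : T -> U) (g : U -> V) :
  continuous f -> continuous g -> continuous (fun t => g (f t)).
Proof. by move=> cf cg t; exact: (continuous_comp (cf t) (cg (f t))). Qed.

Lemma idT_continuous {T : topologicalType} : continuous (fun t : T => t).
Proof. by move=> t; exact: cvg_id. Qed.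

Lemma fst_continuous {T U : topologicalType} : continuous (@fst T U).
Proof. by move=> t; exact: cvg_fst. Qed.

Lemma snd_continuous {T U : topologicalType} : continuous (@snd T U).
Proof. by move=> t; exact: cvg_snd. Qed.

Section iterated_integral.
Context {R : realType}.

(* Lebesgue integral on R^n as an n-fold iterated integral, which agrees with the
   integral for the product measure on integrable functions by Fubini. *)
Fixpoint iint (n : nat) : ('rV[R]_n -> R) -> R :=
  match n return ('rV[R]_n -> R) -> R with
  | 0 => fun f => f 0
  | n'.+1 => fun f =>
      (\int[lebesgue_measure]_x iint (fun y => f (row_mx x%:M y)))%R
  end.

Lemma continuous_support_integrable (a : R) (g : R -> R) : continuous g ->
  (forall x, a < `|x| -> g x = 0) ->
  (@lebesgue_measure R).-integrable setT (EFin \o g).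
Proof.
move=> cg g0; have : (@lebesgue_measure R).-integrable `[- a, a] (EFin \o g).
  apply: continuous_compact_integrable; first exact: segment_compact.
  exact: continuous_subspaceT.
rewrite integrable_mkcond//; congr (_.-integrable _ _); apply/funext => x /=.
rewrite patchE; case: ifPn => //; rewrite notin_setE/= in_itv/= -ler_norml.
by move=> /negP; rewrite -ltNge => /g0 ->.
Qed.

Lemma Rintegral_support (a : R) (g : R -> R) : (forall x, a < `|x| -> g x = 0) ->
  (\int[lebesgue_measure]_x g x = \int[lebesgue_measure]_(x in `[- a, a]) g x)%R.
Proof.
move=> g0; rewrite [RHS]Rintegral_mkcond; congr Rintegral; apply/funext => x.
rewrite patchE; case: ifPn => //; rewrite notin_setE/= in_itv/= -ler_norml.
by move=> /negP; rewrite -ltNge => /g0 ->.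
Qed.

Lemma Rintegral_continuous (T : topologicalType) (a : R) (G : T * R -> R) :
  continuous G -> (forall t x, a < `|x| -> G (t, x) = 0) ->
  continuous (fun t => \int[lebesgue_measure]_x G (t, x))%R.
Proof.
move=> cG G0 t0; have cGt t : continuous (fun x => G (t, x)).
  apply: comp_continuous cG; apply: pair_continuous.
    exact: cst_continuous.
  exact: idT_continuous.
apply/cvgrPdist_le => e e0.
pose d := e / (`|a| * 2 + 1).
have d0 : 0 < d by rewrite divr_gt0// ltr_pwDr// mulr_ge0.
have near_d : \forall t \near t0, forall x, `[- a, a]%classic x ->
    `|G (t0, x) - G (t, x)| <= d.
  have /compact_near_coveringP := @segment_compact R (- a) a.
  move=> /(_ T (nbhs t0) (fun t x => `|G (t0, x) - G (t, x)| <= d)); apply.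
  move=> x _.
  have d20 : 0 < d / 2 by rewrite divr_gt0.
  have /cvgrPdist_lt/(_ _ d20) H1 := cG (t0, x).
  have /cvgrPdist_lt/(_ _ d20) H2 := cGt t0 x.
  have H1' : \forall x' \near x & t \near t0, `|G (t0, x) - G (t, x')| < d / 2.
    case: H1 => -[P Q] /= [Pt Qx] PQ; exists (Q, P) => // -[y s] [/= Qy Ps].
    exact: (PQ (s, y)).
  have H2' : \forall x' \near x & t \near t0, `|G (t0, x) - G (t0, x')| < d / 2.
    by exists ([set x' | `|G (t0, x) - G (t0, x')| < d / 2], setT);
      [split => //; exact: filterT|move=> -[y s] []].
  apply: filterS2 H1' H2' => -[y s] /= h1 h2; rewrite (splitr d).
  have -> : G (t0, y) - G (s, y) =
      (G (t0, x) - G (s, y)) - (G (t0, x) - G (t0, y)).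
    by rewrite opprB [RHS]addrC addrA subrK.
  by rewrite (le_trans (ler_normB _ _))// lerD// ltW.
apply: filterS near_d => t Ht.
have iG s : (@lebesgue_measure R).-integrable `[- a, a] (EFin \o (fun x => G (s, x))).
  apply: continuous_compact_integrable; first exact: segment_compact.
  exact: continuous_subspaceT.
rewrite !(@Rintegral_support a)//; try by move=> ?; exact: G0.
rewrite -RintegralB//; try exact: iG.
have iB : (@lebesgue_measure R).-integrable `[- a, a]
    (EFin \o (fun x => G (t0, x) - G (t, x))).
  apply: continuous_compact_integrable; first exact: segment_compact.
  apply: continuous_subspaceT => x; apply: cvgB; exact: cGt.
rewrite (le_trans (le_normr_Rintegral _ iB))//.
rewrite (@le_trans _ _ (\int[lebesgue_measure]_(x in `[- a, a]) d)%R)//.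
  apply: le_Rintegral => //.
  - exact: integrable_norm iB.
  - apply: continuous_compact_integrable; first exact: segment_compact.
    by apply: continuous_subspaceT; exact: cst_continuous.
rewrite Rintegral_cst//= lebesgue_measure_itv/=.
case: ifPn => _; last by rewrite mulr0 ltW.
rewrite -EFinB /= opprK /d -mulrA ler_piMr ?(ltW e0)//.
rewrite ler_pdivrMl ?ltr_pwDr ?mulr_ge0// mulr1.
by rewrite mulr_natr mulr2n (le_trans (lerD (ler_norm _) (ler_norm _)))// lerDl.
Qed.

Lemma iint0 n : iint (fun _ : 'rV[R]_n => 0) = 0.
Proof.
elim: n => [//|n IH] /=; rewrite (_ : (fun=> _) = cst 0); last first.
  by apply/funext => x; rewrite IH.
by rewrite /Rintegral integral0.
Qed.

Let normr_row_r n (x : R) (y : 'rV[R]_n) : `|y| <= `|row_mx x%:M y : 'rV[R]_n.+1|.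
Proof.
rewrite [leLHS]/Num.norm/= mx_normrE; apply/bigmax_leP; split => //= -[i j] _ /=.
rewrite ord1 -(row_mxEr (x%:M : 'M[R]_1) y 0 j).
rewrite [leRHS]/Num.norm/= mx_normrE; apply/bigmax_geP; right => /=.
by exists (0, rshift 1 j).
Qed.

Let normr_row_l n (x : R) (y : 'rV[R]_n) : `|x| <= `|row_mx x%:M y : 'rV[R]_n.+1|.
Proof.
rewrite [leRHS]/Num.norm/= mx_normrE; apply/bigmax_geP; right => /=.
by exists (0, @lshift 1 n 0) => //; rewrite (@row_mxEl R 1 1 n) mxE eqxx mulr1n.
Qed.

Let row_continuous n (T : topologicalType) (g : T -> R) (h : T -> 'rV[R]_n) :
  continuous g -> continuous h ->
  continuous (fun t => row_mx (g t)%:M (h t) : 'rV[R]_(1 + n)).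
Proof.
move=> cg ch; apply: mx_continuous => i j.
case: (split_ordP j) => k ->.
  rewrite (_ : (fun _ => _) = g)//; apply/funext => t.
  by rewrite row_mxEl mxE !ord1.
rewrite (_ : (fun _ => _) = (fun t => h t i k)); last first.
  by apply/funext => t; rewrite row_mxEr.
exact: (comp_continuous ch (@coord_continuous R 1 n i k)).
Qed.

Lemma iint_continuous n (T : topologicalType) (a : R) (f : T * 'rV[R]_n -> R) :
  continuous f -> (forall t y, a < `|y| -> f (t, y) = 0) ->
  continuous (fun t => iint (fun y => f (t, y))).
Proof.
elim: n T f => [|n IH] T f cf f0 /=.
  apply: comp_continuous cf; apply: pair_continuous; first exact: idT_continuous.
  exact: cst_continuous.
apply: (@Rintegral_continuous T a
    (fun p : T * R => iint (fun y => f (p.1, row_mx p.2%:M y)))).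
  apply: (IH _ (fun q : T * R * 'rV[R]_n => f (q.1.1, row_mx q.1.2%:M q.2))).
    apply: comp_continuous cf; apply: pair_continuous.
      exact: comp_continuous fst_continuous fst_continuous.
    apply: row_continuous snd_continuous.
    exact: comp_continuous fst_continuous snd_continuous.
  move=> [t x] y ay /=; apply: f0; exact: lt_le_trans (normr_row_r _ _).
move=> t x ax /=; rewrite -[RHS](iint0 n); congr iint; apply/funext => y.
by apply: f0; exact: lt_le_trans (normr_row_l _ _).
Qed.

Lemma iint_lin n (a c d : R) (f g : 'rV[R]_n -> R) :
  continuous f -> (forall y, a < `|y| -> f y = 0) ->
  continuous g -> (forall y, a < `|y| -> g y = 0) ->
  iint (fun y => c * f y + d * g y) = c * iint f + d * iint g.
Proof.
elim: n f g => [//|n IH] f g cf f0 cg g0 /=.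
have slice (h : 'rV[R]_n.+1 -> R) : continuous h ->
    (forall y, a < `|y| -> h y = 0) ->
    (forall x, continuous (fun y : 'rV[R]_n => h (row_mx x%:M y))) /\
    (@lebesgue_measure R).-integrable setT
      (EFin \o (fun x => iint (fun y : 'rV[R]_n => h (row_mx x%:M y)))).
  move=> ch h0; split.
    move=> x; apply: comp_continuous ch; apply: row_continuous idT_continuous.
    exact: cst_continuous.
  apply: (@continuous_support_integrable a).
    apply: (@iint_continuous n _ a (fun p : R * 'rV[R]_n => h (row_mx p.1%:M p.2))).
      apply: comp_continuous ch.
      exact: row_continuous fst_continuous snd_continuous.
    by move=> x y ay; apply: h0; exact: lt_le_trans (normr_row_r _ _).
  move=> x ax; rewrite -[RHS](iint0 n); congr iint; apply/funext => y.
  by apply: h0; exact: lt_le_trans (normr_row_l _ _).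
have [cf' If] := slice f cf f0; have [cg' Ig] := slice g cg g0.
rewrite -!RintegralZl// -RintegralD//; last 2 first.
- exact: integrableZl If.
- exact: integrableZl Ig.
congr Rintegral; apply/funext => x; rewrite IH//.
- by move=> y ay; apply: f0; exact: lt_le_trans (normr_row_r _ _).
- by move=> y ay; apply: g0; exact: lt_le_trans (normr_row_r _ _).
Qed.

End iterated_integral.

Section fourier.
Context {R : realType} {n : nat}.
Implicit Types (xi zeta : 'rV[R]_n -> R[i]).

Definition cint (f : 'rV[R]_n -> R[i]) : R[i] :=
  iint (@complex.Re R \o f) +i* iint (@complex.Im R \o f).

(* exp(w) for w complex *)
Definition cexp (w : R[i]) : R[i] :=
  (expR (complex.Re w))%:C * (cos (complex.Im w) +i* sin (complex.Im w)).

(* F(xi)(sigma + i tau) = \int xi(x) e^(i (x, sigma) - (x, tau)) dx *)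
Definition fourier_laplace xi (z : 'rV[R[i]]_n) : R[i] :=
  let sigma := map_mx (@complex.Re R) z in let tau := map_mx (@complex.Im R) z in
  cint (fun x => xi x * cexp ('i * (dot x sigma)%:C - (dot x tau)%:C)).

Definition fourier xi (sigma : 'rV[R]_n) : R[i] :=
  cint (fun x => xi x * cexp ('i * (dot x sigma)%:C)).

Let cadm (a : R) (f : 'rV[R]_n -> R[i]) :=
  [/\ continuous (@complex.Re R \o f), continuous (@complex.Im R \o f)
    & forall x : 'rV[R]_n, a < `|x| -> f x = 0].

Lemma cint_lin (a : R) (c : R[i]) f g : cadm a f -> cadm a g ->
  cint (fun x => c * f x + g x) = c * cint f + cint g.
Proof.
move=> [fr fi f0] [gr gi g0].
have f0r x : a < `|x| -> (@complex.Re R \o f) x = 0 by move=> /f0 /= ->.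
have f0i x : a < `|x| -> (@complex.Im R \o f) x = 0 by move=> /f0 /= ->.
have g0r x : a < `|x| -> (@complex.Re R \o g) x = 0 by move=> /g0 /= ->.
have g0i x : a < `|x| -> (@complex.Im R \o g) x = 0 by move=> /g0 /= ->.
case: c => c d; rewrite /cint.
pose p (u v : R) (h k : 'rV[R]_n -> R) x := u * h x + v * k x.
have pc u v h k : continuous h -> continuous k -> continuous (p u v h k).
  exact: lin_continuous.
have p0 u v h k : (forall x, a < `|x| -> h x = 0) ->
    (forall x, a < `|x| -> k x = 0) -> forall x, a < `|x| -> p u v h k x = 0.
  by move=> h0 k0 x ax; rewrite /p h0// k0// !mulr0 addr0.
have -> : @complex.Re R \o (fun x => (c +i* d) * f x + g x) =
    p 1 1 (p c (- d) (@complex.Re R \o f) (@complex.Im R \o f)) (@complex.Re R \o g).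
  apply/funext => x; rewrite /p /= !mul1r.
  by case: (f x) (g x) => [u v] [w z] /=; rewrite mulNr.
have -> : @complex.Im R \o (fun x => (c +i* d) * f x + g x) =
    p 1 1 (p c d (@complex.Im R \o f) (@complex.Re R \o f)) (@complex.Im R \o g).
  apply/funext => x; rewrite /p /= !mul1r.
  by case: (f x) (g x) => [u v] [w z] /=.
have L u v h k := @iint_lin R n a u v h k.
rewrite (L 1 1 _ _ (pc _ _ _ _ fr fi) (p0 _ _ _ _ f0r f0i) gr g0r).
rewrite (L 1 1 _ _ (pc _ _ _ _ fi fr) (p0 _ _ _ _ f0i f0r) gi g0i).
rewrite (L c (- d) _ _ fr f0r fi f0i) (L c d _ _ fi f0i fr f0r).
by rewrite !mul1r mulNr.
Qed.

Let dot_continuous (y : 'rV[R]_n) : continuous (fun x => dot x y).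
Proof.
apply: (continuous_big (op := +%R) (P := xpredT)) => [|i _].
  by move=> x; exact: add_continuous.
apply: (comp_continuous (@coord_continuous R 1 n 0 i)
  (g := fun u : R => u * y 0 i)) => u.
by apply: cvgMr_tmp; exact: cvg_id.
Qed.

Let integrand_cadm (a : R) xi (s t : 'rV[R]_n) : xi \in Da_pred a ->
  cadm a (fun x => xi x * cexp ('i * (dot x s)%:C - (dot x t)%:C)).
Proof.
move=> /asboolP[[sr si] x0].
set u : 'rV[R]_n -> R := fun x => expR (- dot x t) * cos (dot x s).
set v : 'rV[R]_n -> R := fun x => expR (- dot x t) * sin (dot x s).
have -> : (fun x => xi x * cexp ('i * (dot x s)%:C - (dot x t)%:C)) =
    (fun x => xi x * (u x +i* v x)).
  apply/funext => x; congr (_ * _); rewrite /cexp /=.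
  rewrite !(mul0r, mul1r, mulr0, subr0, add0r, addr0, sub0r, oppr0).
  by apply/eqP; rewrite eq_complex /= !mul0r subr0 addr0 /u /v !eqxx.
have M (h k : 'rV[R]_n -> R) : continuous h -> continuous k ->
    continuous (fun x => h x * k x).
  by move=> ch ck x; exact: (cvgM (ch x) (ck x)).
have cN : continuous (fun x => expR (- dot x t)).
  apply: (comp_continuous (f := fun x => - dot x t)); last exact: continuous_expR.
  exact: (comp_continuous (@dot_continuous t) (@opp_continuous R)).
have cu : continuous u.
  apply: M => //; exact: (comp_continuous (@dot_continuous s) (@continuous_cos R)).
have cv : continuous v.
  apply: M => //; exact: (comp_continuous (@dot_continuous s) (@continuous_sin R)).
have cr := (sr [::]).1; have ci := (si [::]).1.
have lin := @lin_continuous R 'rV[R]_n.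
split.
- have -> : @complex.Re R \o (fun x => xi x * (u x +i* v x)) =
      (fun x => 1 * (complex.Re (xi x) * u x) + -1 * (complex.Im (xi x) * v x)).
    apply/funext => x /=; rewrite mul1r mulN1r.
    by case: (xi x) => [p q] /=.
  by apply: lin; exact: M.
- have -> : @complex.Im R \o (fun x => xi x * (u x +i* v x)) =
      (fun x => 1 * (complex.Re (xi x) * v x) + 1 * (complex.Im (xi x) * u x)).
    by apply/funext => x /=; rewrite !mul1r; case: (xi x) => [p q] /=.
  by apply: lin; exact: M.
- by move=> x ax; rewrite x0 ?mul0r//; exact: lt_le_trans (normr_le_enorm x).
Qed.

Lemma fourier_laplace_lin (c : R[i]) xi zeta : xi \in D_pred -> zeta \in D_pred ->
  fourier_laplace (c *: xi + zeta) = c *: fourier_laplace xi + fourier_laplace zeta.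
Proof.
move=> /asboolP[k k0 xk] /asboolP[m m0 zm]; apply/funext => z.
rewrite /fourier_laplace /= -[RHS]/(c * _ + _).
have xM : xi \in Da_pred (maxn k m)%:R by apply: Da_predS xk; rewrite ler_nat leq_maxl.
have zM : zeta \in Da_pred (maxn k m)%:R by apply: Da_predS zm; rewrite ler_nat leq_maxr.
rewrite -(cint_lin _ (integrand_cadm _ _ xM) (integrand_cadm _ _ zM)).
by congr cint; apply/funext => x; rewrite -[_ x]/(c * xi x + zeta x) mulrDl mulrA.
Qed.

End fourier.

Section fourier_instances.
Context {R : realType} {n : nat}.

Definition fourier_Da (a : R) (xi : @Da R n a) : 'rV[R[i]]_n -> R[i] :=
  fourier_laplace xi.

Definition fourier_D (xi : @Dtest R n) : 'rV[R[i]]_n -> R[i] :=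
  fourier_laplace xi.

Definition fourier_S (xi : @schwartz R n) : 'rV[R]_n -> R[i] := fourier xi.

Lemma Da_in_D_pred (a : R) (xi : @Da R n a) : Da_fun xi \in D_pred.
Proof.
case: xi => xi /= xa; apply/asboolP; exists (Num.truncn a).+1 => //.
by apply: Da_predS xa; exact/ltW/truncnS_gt.
Qed.

Lemma fourier_Da_linear (a : R) : linear (@fourier_Da a).
Proof.
by move=> c xi zeta; exact: fourier_laplace_lin (Da_in_D_pred _) (Da_in_D_pred _).
Qed.

Lemma fourier_D_linear : linear fourier_D.
Proof.
by move=> c [xi xD] [zeta zD]; exact: fourier_laplace_lin.
Qed.

HB.instance Definition _ (a : R) := GRing.isLinear.Build R[i] (@Da R n a)
  ('rV[R[i]]_n -> R[i]) _ (@fourier_Da a) (@fourier_Da_linear a).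
HB.instance Definition _ := GRing.isLinear.Build R[i] (@Dtest R n)
  ('rV[R[i]]_n -> R[i]) _ fourier_D fourier_D_linear.

End fourier_instances.

(* F(D_a) and F(D) as topological vector spaces of functions on C^n. *)
Definition FDa (R : realType) (n : nat) (a : R) := lrange (@fourier_Da R n a).
Definition FD (R : realType) (n : nat) := lrange (@fourier_D R n).

HB.instance Definition _ (R : realType) (n : nat) (a : R) :=
  TopologicalLmodule.copy (FDa n a) (lrange (@fourier_Da R n a)).
HB.instance Definition _ (R : realType) (n : nat) :=
  TopologicalLmodule.copy (FD R n) (lrange (@fourier_D R n)).

Definition FDa_fun (R : realType) (n : nat) (a : R) (z : FDa n a) :
  'rV[R[i]]_n -> R[i] := lrange_val z.
Definition FD_fun (R : realType) (n : nat) (z : FD R n) :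
  'rV[R[i]]_n -> R[i] := lrange_val z.

Section demi_distributions.
Context {R : realType}.

Definition C0 (gamma : R[i] -> R[i]) :=
  [/\ (gamma : R[i]^o -> R[i]^o) t @[t --> (0 : R[i]^o)^'] --> (0 : R[i]^o),
      gamma 0 = 0 & forall t, `|t| <= 1 -> `|t| <= `|gamma t|].

(* X^(gamma, U) *)
Definition demi (X : topologicalLmodType R[i]) (gamma : R[i] -> R[i])
    (U : set X) : set (X -> R[i]) :=
  [set f | [/\ continuous (f : X -> R[i]^o), f 0 = 0
    & forall x u t, U u -> `|t| <= 1 -> exists r s,
      [/\ `|r - 1| <= `|gamma t|, `|s| <= `|gamma t|
        & f (x + t *: u) = r * f x + s * f u]]].

End demi_distributions.

(* FE is the space F(E), with v : FE -> W the function underlying an element.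
   For E = S one takes FE = S, with its own topology, as F(S) = S. *)
Section fourier_demi.
Context {R : realType} {E : lmodType R[i]} {W FE : Type}.
Variables (n : nat) (F : E -> W) (v : FE -> W).

(* F is injective: xget selects the only preimage. *)
Definition fourier_inv (z : FE) : E := xget 0 [set xi | F xi = v z].

Definition fourier_demi (f : E -> R[i]) : FE -> R[i] :=
  fun z => ((2 * pi) ^+ n)%:C * f (fourier_inv z).

Definition fourier_set (U : set E) : set FE :=
  [set z | exists2 xi, U xi & F xi = v z].

End fourier_demi.

(* Main.v *)
(* Composition with a linear homeomorphism of [E] onto [F(E)] transports
   demi-distributions in both directions, so everything rests on [F] being one.
   For [D_a] and [D] the topology of [F(E)] is transported, so only injectivity
   is needed, and it follows from the case of [S] by restriction to real
   frequencies. For [S] this is the Fourier inversion theorem. As the integral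
   on R^n is iterated, [F] is a composition of one-variable transforms acting
   on Schwartz functions of n variables; in real form these are cosine
   transforms with a phase, [K_th f = \int f(x with x_i := t) cos(t x_i + th)
   dt] ([ptr i th f] below), and differentiation and integration by parts read
   [D_i K_th = K_(th + pi/2) x_i] and [x_i K_th = K_(th + pi/2) D_i]. Hence a
   word in the operators [x_j], [D_j] passes through [K_th] with [x_i] and
   [D_i] exchanged, which gives invariance of S and all the seminorm estimates.
   Inversion reduces to [\int ds \int f(t) cos(ts) dt = 2 pi f(0)] on the
   line. *)
Require Import Defs.
From mathcomp Require Import all_boot all_order all_algebra complex.
From mathcomp Require Import all_classical all_reals all_analysis.
From mathcomp Require Import measurable_realfun ring lra.
Import Order.TTheory GRing.Theory Num.Theory numFieldNormedType.Exports.
Set Implicit Arguments.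
Unset Strict Implicit.
Unset Printing Implicit Defensive.
Local Open Scope classical_set_scope.
Local Open Scope ring_scope.

(** * Functions of size O(1/(1+t^2)) on the real line *)
Section real_line.
Context {R : realType}.
Implicit Types (f g F : R -> R) (C t x s th : R).
Let mu := @lebesgue_measure R.

(** The common currency is the pointwise bound [C / (1 + t^2)]: it gives integrability with integral
    at most [C * pi], so every constant stays linear in the bound, and an estimate for a transform
    can be read as continuity for the seminorms. Exchanging [x_i] and [D_i] turns an ordered
    monomial [x^k D^q] into a word in another order; hence bounds are stated for arbitrary words,
    and these are compared with the ordered monomials of [S_norm] once, through the commutation
    relations. The phase [th] stays a parameter because every letter in the variable [i] shifts it
    by [pi / 2], so smoothness has to be proved for all phases at once. For the formula on the line,
    a multiple of a Gaussian is subtracted from twice the even part of [f] so as to make it vanish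
    at [0]; an even function vanishing at [0] can be divided by [t^2], and the constant [2 pi] is
    the square of the Gaussian integral. *)

Definition decays C f := continuous f /\ forall t, `|f t| <= C / oneDsqr t.

Lemma oneDsqrE x : oneDsqr x = 1 + x ^+ 2. Proof. by []. Qed.

Lemma continuous_inv_oneDsqr : continuous (fun t : R => (oneDsqr t)^-1).
Proof. exact: continuous_oneDsqrV. Qed.

Lemma integrable_oneDsqrV C : mu.-integrable setT (EFin \o (fun t => C / oneDsqr t)).
Proof.
suff : mu.-integrable setT (EFin \o (fun t : R => (oneDsqr t)^-1)).
  by move=> /(integrableZl measurableT C).
apply/integrableP; split.
  apply/measurable_EFinP; apply: continuous_measurable_fun.
  exact: continuous_inv_oneDsqr.
under eq_integral do rewrite /= ger0_norm ?invr_ge0//.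
rewrite ge0_symfun_integralT/=.
- rewrite (_ : [set x | _] = `[0, +oo[%classic); last first.
    by apply/seteqP; split => x/=; rewrite in_itv/= andbT.
  by rewrite integral0y_oneDsqr ltry.
- by move=> x; rewrite invr_ge0.
- exact: continuous_inv_oneDsqr.
- by move=> x /=; rewrite /oneDsqr sqrrN.
Qed.

Lemma int_oneDsqrV C : (\int[mu]_t (C / oneDsqr t) = C * pi)%R.
Proof.
have := integrable_oneDsqrV 1; under eq_fun do rewrite div1r; move=> i1.
rewrite RintegralZl//; congr (_ * _).
rewrite /Rintegral ge0_symfun_integralT/=.
- rewrite (_ : [set x | _] = `[0, +oo[%classic); last first.
    by apply/seteqP; split => x/=; rewrite in_itv/= andbT.
  by rewrite integral0y_oneDsqr -EFinM/= mulrC mulfVK.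
- by move=> x; rewrite invr_ge0.
- exact: continuous_inv_oneDsqr.
- by move=> x /=; rewrite /oneDsqr sqrrN.
Qed.

(** Measurability is asked instead of continuity because of integrands such as [f t / t ^+ 2], whose
    value at the origin is [0] by the convention on division, so that they may be discontinuous
    there. *)
Lemma bound_integrable C f : measurable_fun setT f ->
  (forall t, `|f t| <= C / oneDsqr t) -> mu.-integrable setT (EFin \o f).
Proof.
move=> mf bf; apply: le_integrable (integrable_oneDsqrV C) => //.
  exact/measurable_EFinP.
by move=> t _ /=; rewrite lee_fin (le_trans (bf t))// ler_norm.
Qed.

Lemma decays_integrable C f : decays C f -> mu.-integrable setT (EFin \o f).
Proof. by move=> [cf bf]; apply: bound_integrable bf; exact: continuous_measurable_fun. Qed.

Lemma bound_int_le C f : measurable_fun setT f ->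
  (forall t, `|f t| <= C / oneDsqr t) -> `|\int[mu]_t f t|%R <= C * pi.
Proof.
move=> mf bf; have If := bound_integrable mf bf.
rewrite (le_trans (le_normr_Rintegral _ If))// -int_oneDsqrV.
apply: le_Rintegral => //; [exact: (integrable_norm If)|exact: integrable_oneDsqrV].
Qed.

Lemma decays_int_le C f : decays C f -> `|\int[mu]_t f t|%R <= C * pi.
Proof. by move=> [cf bf]; apply: bound_int_le bf; exact: continuous_measurable_fun. Qed.

Lemma decays_ge0 C f : decays C f -> 0 <= C.
Proof.
by move=> [_ /(_ 0)]; rewrite /oneDsqr expr0n/= addr0 divr1; apply: le_trans.
Qed.

Lemma decays_cvg0 C f : decays C f -> f n%:R @[n --> \oo] --> 0.
Proof.
move=> [_ bf]; apply/norm_cvg0P.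
apply: (@squeeze_cvgr _ _ _ _ (cst 0) (fun n => C * (n.+1%:R)^-1 *+ 2)).
- apply: nearW => n; rewrite normr_ge0/= (le_trans (bf _))//.
  have C0 : 0 <= C by have := bf 0; rewrite /oneDsqr expr0n/= addr0 divr1; apply: le_trans.
  rewrite -mulrnAr ler_wpM2l// -[_ *+ 2]mulr_natl ler_pdivlMr// mulrC ler_pdivrMr ?oneDsqr_gt0//.
  rewrite /oneDsqr -natr1; have := sqr_ge0 (n%:R - 1 : R); rewrite sqrrB1; nra.
- exact: cvg_cst.
- rewrite [X in _ --> X](_ : 0 = (C * 0) *+ 2); last by rewrite mulr0 mul0rn.
  by apply: cvgMn; apply: cvgMl_tmp; exact: cvg_harmonic.
Qed.

Lemma decays_opp C f : decays C f -> decays C (fun t => f (- t)).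
Proof.
move=> [cf bf]; split; first exact: comp_continuous (@opp_continuous R) cf.
by move=> t; rewrite (le_trans (bf _))// /oneDsqr sqrrN.
Qed.

Lemma is_derive_cont f f' : (forall x, is_derive x 1 f (f' x)) -> continuous f.
Proof.
by move=> df x; apply/differentiable_continuous/derivable1_diffP; have [] := df x.
Qed.

(** The fundamental theorem of calculus on [[-n, n]], followed by dominated convergence with
    majorant [C / oneDsqr t]. *)
Lemma int_lim C f F : decays C f -> (forall x, is_derive x 1 F (f x)) ->
  F n%:R - F (- n%:R) @[n --> \oo] --> (\int[mu]_t f t)%R.
Proof.
move=> df dF; have If := decays_integrable df; have [cf bf] := df.
have mf : measurable_fun setT f by exact: continuous_measurable_fun.
pose A (n : nat) : set R := `[- n%:R, n%:R]%classic.
(* The shift to [n.+1] makes the interval nondegenerate, as the fundamental theorem requires. *)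
have E n : (F n.+1%:R - F (- n.+1%:R))%:E = (\int[mu]_t ((f \_ (A n.+1)) t)%:E)%E.
  have nn : - n.+1%:R < n.+1%:R :> R by rewrite (@lt_trans _ _ 0)// oppr_lt0.
  have h := @continuous_FTC2 R f F _ _ nn.
  rewrite (_ : (fun t => _) = (EFin \o f) \_ (A n.+1)); last by rewrite restrict_EFin.
  rewrite -integral_mkcond h//.
  - by apply: continuous_subspaceT.
  - split=> [x _||]; first by have [] := dF x.
    + by apply: cvg_at_right_filter; exact: (is_derive_cont dF).
    + by apply: cvg_at_left_filter; exact: (is_derive_cont dF).
  - by move=> x _; rewrite derive1E; have [_ ->] := dF x.
have mfn (n : nat) : measurable_fun setT (fun t => ((f \_ (A n.+1)) t)%:E).
  apply/measurable_EFinP; apply/(measurable_restrictT f) => //.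
    exact: measurable_itv.
  exact: measurable_funTS.
have fnf : {ae mu, forall t, setT t ->
    (fun n => ((f \_ (A n.+1)) t)%:E) @ \oo --> (f t)%:E}.
  apply: aeW => t _; apply: cvg_near_cst; near=> n; rewrite patchE ifT//=.
  rewrite inE /A/= in_itv/= -ler_norml (@le_trans _ _ n%:R) ?ler_nat//.
  by near: n; exact: nbhs_infty_ger.
have bfn : {ae mu, forall t n, setT t ->
    (`|((f \_ (A n.+1)) t)%:E| <= (C / oneDsqr t)%:E)%E}.
  apply: aeW => t n _; rewrite lee_fin patchE; case: ifP => _ //.
  by rewrite normr0 (le_trans _ (bf t)).
have [_ _ lim] := @dominated_convergence _ _ _ mu setT measurableT
  (fun n t => ((f \_ (A n.+1)) t)%:E) (EFin \o f) (EFin \o (fun t => C / oneDsqr t))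
  mfn (proj2 (measurable_EFinP setT f) mf) fnf (integrable_oneDsqrV C) bfn.
rewrite -(cvg_shiftS (fun n => F n%:R - F (- n%:R)))/= /Rintegral.
move: lim; rewrite -[X in _ --> X -> _]fineK; last exact: integrable_fin_num.
move=> /fine_cvg; apply: cvg_trans; apply: near_eq_cvg; near=> n.
by rewrite /= -E.
Unshelve. all: end_near. Qed.

Lemma decays_antiderivative C f : decays C f ->
  exists F, forall x, is_derive x 1 F (f x).
Proof.
move=> df; exists (fun x => \int[mu]_(t in `]-oo, x]) f t)%R => x.
have [] := @continuous_FTC1 R f -oo%O x (x + 1).
- by rewrite ltrDl.
- apply: integrableS (decays_integrable df) => //; exact: measurable_itv.
- by rewrite ltNyr.
- exact: df.1.
- by rewrite derive1E => d e; apply: DeriveDef.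
Qed.

(** If [F] is an antiderivative of [f], then [- F (- x)] is one of [f (- x)], and both have the same
    increment over [[-n, n]]. *)
Lemma int_opp C f : decays C f ->
  (\int[mu]_t f (- t) = \int[mu]_t f t)%R.
Proof.
move=> df; have [F dF] := decays_antiderivative df.
have dF' x : is_derive x 1 (fun x => - F (- x)) (f (- x)).
  have h := is_derive1_comp (dF (- x)) (is_deriveNid x 1).
  by have := is_deriveN h; rewrite mulrN mulr1 opprK.
have := int_lim (decays_opp df) dF'; under eq_fun do rewrite !opprK addrC.
by move=> /(cvg_lim (@Rhausdorff R)) <-; exact: (cvg_lim (@Rhausdorff R) (int_lim df dF)).
Qed.

(** By [int_lim] the integral is the limit of [f n - f (- n)]: this is the vanishing boundary term
    of integration by parts. *)
Lemma int_derive0 C C' f f' : decays C f -> decays C' f' ->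
  (forall x, is_derive x 1 f (f' x)) -> (\int[mu]_t f' t = 0)%R.
Proof.
move=> cf df dF; rewrite -(cvg_lim (@Rhausdorff R) (int_lim df dF)).
apply: (cvg_lim (@Rhausdorff R)).
rewrite -[X in _ --> X](subrr 0); apply: cvgB; first exact: decays_cvg0 cf.
exact: (decays_cvg0 (decays_opp cf)).
Qed.

Lemma decaysS C C' f : C <= C' -> decays C f -> decays C' f.
Proof.
move=> CC' [cf bf]; split=> // t; rewrite (le_trans (bf t))//.
by rewrite ler_wpM2r// invr_ge0.
Qed.

Lemma decaysD C C' f g : decays C f -> decays C' g ->
  decays (C + C') (fun t => f t + g t).
Proof.
move=> [cf bf] [cg bg]; split=> [t|t]; first by apply: cvgD; [exact: cf|exact: cg].
by rewrite mulrDl (le_trans (ler_normD _ _))// lerD.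
Qed.

Lemma decaysM C f g : decays C f -> continuous g -> (forall t, `|g t| <= 1) ->
  decays C (fun t => f t * g t).
Proof.
move=> [cf bf] cg bg; split=> [t|t]; first by apply: cvgM; [exact: cf|exact: cg].
by rewrite normrM (le_trans _ (bf t))// ler_piMr.
Qed.

Lemma decaysZ C f (k : R) : decays C f -> decays (`|k| * C) (fun t => k * f t).
Proof.
move=> [cf bf]; split=> [t|t]; first by apply: cvgMl_tmp; exact: cf.
by rewrite normrM -mulrA ler_wpM2l.
Qed.

(** The constant comes from [(2 + 2 h^2) (1 + (t + h)^2) - (1 + t^2) = 1 + (t + 2 h)^2 + 2 (h (t +
    h))^2]. *)
Lemma decays_shift C f h : decays C f ->
  decays ((2 + 2 * h ^+ 2) * C) (fun t => f (t + h)).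
Proof.
move=> df; have C0 := decays_ge0 df; have [cf bf] := df; split.
  by apply: comp_continuous cf => t; apply: cvgD; [exact: cvg_id|exact: cvg_cst].
move=> t; rewrite (le_trans (bf _))// ler_pdivrMr ?oneDsqr_gt0// mulrAC.
rewrite ler_pdivlMr ?oneDsqr_gt0// [leRHS]mulrAC mulrC ler_wpM2r// !oneDsqrE.
have := sqr_ge0 (t + 2 * h); have := sqr_ge0 (h * (t + h)); have := sqr_ge0 h.
nra.
Qed.

Lemma int_shift_ge0 C f h : decays C f -> (forall t, 0 <= f t) ->
  (\int[mu]_t f (t + h) = \int[mu]_t f t)%R.
Proof.
move=> df f0; rewrite /Rintegral; congr fine.
have d1 : derive1 (fun x : R => x + h) = cst 1.
  apply/funext => x; rewrite derive1E.
  have := is_deriveD (is_derive_id x 1) (is_derive_cst h x 1).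
  by rewrite addr0 => -[].
rewrite [RHS](@increasing_ge0_integration_by_substitutionT R (fun x => x + h) f).
- by apply: eq_integral => x _; rewrite d1 fctE mulr1.
- by move=> x y xy; rewrite ltrD2r.
- by rewrite d1; exact: cst_continuous.
- by rewrite d1; exact: is_cvg_cst.
- by rewrite d1; exact: is_cvg_cst.
- move=> x; exact: derivableD.
- apply/cvgrNyPle => A; near=> x; rewrite -lerBrDr; near: x.
  apply: nbhs_ninfty_le; exact: num_real.
- apply/cvgryPge => A; near=> x; rewrite -lerBlDr; near: x.
  apply: nbhs_pinfty_ge; exact: num_real.
- exact: df.1.
- exact: f0.
Unshelve. all: end_near. Qed.

Lemma oneDsqrV_decays C : 0 <= C -> decays C (fun t => C / oneDsqr t).
Proof.
move=> C0; split; first by move=> x; apply: cvgMl_tmp; exact: continuous_inv_oneDsqr.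
by move=> t; rewrite ger0_norm// divr_ge0.
Qed.

(** Substitution for nonnegative functions applies to the majorant [C / oneDsqr t] and to its sum
    with [f]; the difference gives [f] of any sign. *)
Lemma int_shift C f h : decays C f -> (\int[mu]_t f (t + h) = \int[mu]_t f t)%R.
Proof.
move=> df; have dw := oneDsqrV_decays (decays_ge0 df).
have dfw := decaysD df dw.
have w0 t : 0 <= C / oneDsqr t by rewrite divr_ge0// (decays_ge0 df).
have fw0 t : 0 <= f t + C / oneDsqr t.
  by rewrite -lerBlDr sub0r; have [_ /(_ t)] := df; rewrite ler_norml => /andP[].
have /= := int_shift_ge0 h dfw fw0; have /= := int_shift_ge0 h dw w0; move=> ew.
rewrite RintegralD//; [|exact: decays_integrable (decays_shift h df)|
  exact: decays_integrable (decays_shift h dw)].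
rewrite [in RHS]RintegralD//; [|exact: decays_integrable df|exact: decays_integrable dw].
by rewrite ew; apply: addIr.
Qed.

End real_line.

(** * The cosine transform and its inversion on the line *)
Section cosine_transform.
Context {R : realType}.
Implicit Types (f g F : R -> R) (C t x s th : R).
Let mu := @lebesgue_measure R.

Lemma MVT_any_order f f' (a b : R) : (forall x, is_derive x 1 f (f' x)) ->
  exists c, [/\ a <= b -> a <= c <= b, b <= a -> b <= c <= a &
    f b - f a = f' c * (b - a)].
Proof.
move=> df; have cf A : {within A, continuous f}.
  by apply: continuous_subspaceT; exact: is_derive_cont df.
have [ab|ba|->] := ltgtP a b; last by exists b; rewrite !subrr mulr0 lexx.
  have [c /[!in_itv]/= /andP[ac cb] e] := MVT ab (fun x _ => df x) (cf _); exists c.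
  by split=> // _; rewrite (ltW ac) (ltW cb).
have [c /[!in_itv]/= /andP[ac cb] e] := MVT ba (fun x _ => df x) (cf _); exists c.
split=> // [_|]; last by rewrite -opprB e -mulrN opprB.
by rewrite (ltW ac) (ltW cb).
Qed.

Lemma int_is_derive (F F' : R -> R -> R) (G : R -> R) x :
  (forall y, mu.-integrable setT (EFin \o F y)) ->
  mu.-integrable setT (EFin \o G) ->
  (forall y t : R, is_derive y 1 (F^~ t) (F' y t)) ->
  (forall y t, `|F' y t| <= G t) ->
  is_derive x 1 (fun y => \int[mu]_t F y t)%R (\int[mu]_t F' x t)%R.
Proof.
move=> iF iG dF bF.
have F'E y t : partial1of2 F y t = F' y t.
  by rewrite partial1of2E; have [_ ->] := dF y t.
(* Any interval around [x] would do, as the majorant [G] is uniform in [y]. *)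
have I0 : `]x - 1, x + 1[%classic x.
  by rewrite /= in_itv/= ltrDl ltrBlDr ltrDl ltr01.
have G0 t : 0 <= G t by exact: le_trans (bF x t).
have dF1 y t : `]x - 1, x + 1[%classic y -> [set: R] t -> derivable (F^~ t) y 1.
  by move=> _ _; have [] := dF y t.
have bF1 y t : `]x - 1, x + 1[%classic y -> [set: R] t -> `|partial1of2 F y t| <= G t.
  by move=> _ _; rewrite F'E.
have h := @derivable_under_integral R _ _ mu F setT measurableT x (x - 1) (x + 1)
  I0 (fun y _ => iF y) dF1 G G0 iG bF1.
apply: DeriveDef => //; rewrite -derive1E.
rewrite (@differentiation_under_integral R _ _ mu F setT measurableT x (x - 1) (x + 1)
  I0 (fun y _ => iF y) dF1 G G0 iG bF1).
by apply: eq_Rintegral => t _; rewrite F'E.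
Qed.

Definition costr th f s : R := (\int[mu]_t (f t * cos (t * s + th)))%R.

Lemma cosDpihalf x : cos (x + pi / 2) = - sin x.
Proof. by rewrite cosD cos_pihalf sin_pihalf mulr0 mulr1 add0r. Qed.

Lemma sinDpihalf x : sin (x + pi / 2) = cos x.
Proof. by rewrite sinD cos_pihalf sin_pihalf mulr0 mulr1 add0r. Qed.

Lemma cos_le1N x : `|cos x| <= 1.
Proof. by rewrite ler_norml cos_geN1 cos_le1. Qed.

Lemma sin_le1N x : `|sin x| <= 1.
Proof. by rewrite ler_norml sin_geN1 sin_le1. Qed.

Lemma is_derive_affine (a b x : R) : is_derive x 1 (fun y => a * y + b) a.
Proof.
have h := is_deriveD (is_deriveZ a (is_derive_id x 1)) (is_derive_cst b x 1).
by have := h; rewrite addr0 [_ *: _]mulr1.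
Qed.

Lemma is_derive_cos_affine (a b x : R) :
  is_derive x 1 (fun y => cos (a * y + b)) (a * cos (a * x + b + pi / 2)).
Proof.
rewrite cosDpihalf [a * - _]mulrC.
exact: (@is_derive1_comp _ cos _ x _ _ (is_derive_cos _) (is_derive_affine a b x)).
Qed.

Lemma is_derive_sin_affine (a b x : R) :
  is_derive x 1 (fun y => sin (a * y + b)) (a * cos (a * x + b)).
Proof.
rewrite [a * cos _]mulrC.
exact: (@is_derive1_comp _ sin _ x _ _ (is_derive_sin _) (is_derive_affine a b x)).
Qed.

Lemma continuous_cos_affine (a b : R) : continuous (fun y => cos (a * y + b)).
Proof. exact: is_derive_cont (is_derive_cos_affine a b). Qed.

Lemma continuous_sin_affine (a b : R) : continuous (fun y => sin (a * y + b)).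
Proof. exact: is_derive_cont (is_derive_sin_affine a b). Qed.

Lemma costr_decays C f s th : decays C f -> decays C (fun t => f t * cos (t * s + th)).
Proof.
move=> df; apply: decaysM => //; last by move=> t; exact: cos_le1N.
under eq_fun do rewrite mulrC; exact: continuous_cos_affine.
Qed.

Lemma costr_le C f s th : decays C f -> `|costr th f s| <= C * pi.
Proof. by move=> df; exact: decays_int_le (costr_decays _ _ df). Qed.

Lemma costr_derive C C' f th s : decays C f -> decays C' (fun t => t * f t) ->
  is_derive s 1 (costr th f) (costr (th + pi / 2) (fun t => t * f t) s).
Proof.
move=> df dtf.
apply: (@int_is_derive (fun s t => f t * cos (t * s + th))
  (fun s t => (t * f t) * cos (t * s + (th + pi / 2))) (fun t => C' / oneDsqr t)).
- by move=> y; exact: decays_integrable (costr_decays _ _ df).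
- exact: integrable_oneDsqrV.
- move=> y t; have := is_deriveZ (f t) (is_derive_cos_affine t th y).
  by rewrite [_ *: _]mulrA [f t * t]mulrC addrA.
- by move=> y t; have [_] := costr_decays y (th + pi / 2) dtf; apply.
Qed.

Lemma costr_ibp C f f' th s : decays C f -> decays C f' ->
  (forall x, is_derive x 1 f (f' x)) -> s * costr th f s = costr (th + pi / 2) f' s.
Proof.
move=> df df' ff'.
have dc := costr_decays s th df; have dc' := costr_decays s (th + pi / 2) df'.
(* Since [sin u = - cos (u + pi / 2)], the derivative of [phi] is the difference of the two
   integrands, and its integral is [0] by [int_derive0]. *)
pose phi t := f t * sin (s * t + th).
have dphi x : is_derive x 1 phi (s * (f x * cos (x * s + th)) + - (f' x * cos (x * s + (th + pi / 2)))).
  have h : is_derive x 1 phi _ := is_deriveM (ff' x) (is_derive_sin_affine s th x).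
  apply: is_derive_eq h _; rewrite addrA cosDpihalf (mulrC x s) mulrN opprK /GRing.scale/=.
  by ring.
have Dphi : decays C phi.
  by apply: decaysM => // [|t]; [exact: continuous_sin_affine|exact: sin_le1N].
have dN := decaysZ (-1) dc'; have dZ := decaysZ s dc.
have := decaysD dZ dN; under [X in decays _ X]eq_fun do rewrite mulN1r; move=> dD.
have := int_derive0 Dphi dD dphi.
rewrite RintegralB//; [|exact: decays_integrable dZ|exact: decays_integrable dc'].
rewrite RintegralZl//; last exact: decays_integrable dc.
by move/eqP; rewrite subr_eq0 => /eqP.
Qed.

(* [t * f t] is required only for [costr th f] to be differentiable. *)
Definition nice C f f1 f2 := [/\ decays C f, decays C (fun t => t * f t),
  decays C f1, decays C f2 &
  (forall x, is_derive x 1 f (f1 x)) /\ (forall x, is_derive x 1 f1 (f2 x))].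

Lemma nice_cont C f f1 f2 th : nice C f f1 f2 -> continuous (costr th f).
Proof. by move=> [df dtf _ _ _]; exact: is_derive_cont (fun s => costr_derive th s df dtf). Qed.

(** In [(1 + s^2) * costr th f s] each summand is at most [C * pi]: the first by the decay of [f],
    the second because two integrations by parts turn [s^2] into the second derivative of [f]. *)
Lemma nice_costr C f f1 f2 th : nice C f f1 f2 -> decays (C * pi *+ 2) (costr th f).
Proof.
move=> nf; have [df dtf d1 d2 [D1 D2]] := nf; split; first exact: nice_cont nf.
move=> s; rewrite ler_pdivlMr ?oneDsqr_gt0// oneDsqrE mulrDr mulr1 mulr2n.
apply: lerD; first exact: costr_le.
have -> : `|costr th f s| * s ^+ 2 = `|s * (s * costr th f s)|.
  by rewrite !normrM mulrA mulrC -expr2 real_normK ?num_real.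
by rewrite (costr_ibp th s df d1 D1) (costr_ibp _ s d1 d2 D2) costr_le.
Qed.

Lemma costrD C C' th f g s : decays C f -> decays C' g ->
  costr th (fun t => f t + g t) s = costr th f s + costr th g s.
Proof.
move=> df dg; rewrite /costr -RintegralD//.
- by apply: eq_Rintegral => t _; rewrite mulrDl.
- exact: decays_integrable (costr_decays _ _ df).
- exact: decays_integrable (costr_decays _ _ dg).
Qed.

Lemma costrZ C th f (k : R) s : decays C f -> costr th (fun t => k * f t) s = k * costr th f s.
Proof.
move=> df; rewrite /costr -RintegralZl//; last exact: decays_integrable (costr_decays _ _ df).
by apply: eq_Rintegral => t _; rewrite mulrA.
Qed.

Lemma niceD C C' f f1 f2 g g1 g2 : nice C f f1 f2 -> nice C' g g1 g2 ->
  nice (C + C') (fun t => f t + g t) (fun t => f1 t + g1 t) (fun t => f2 t + g2 t).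
Proof.
move=> [df dtf d1 d2 [D1 D2]] [eg etg e1 e2 [E1 E2]]; split.
- exact: decaysD.
- by under eq_fun do rewrite mulrDr; exact: decaysD.
- exact: decaysD.
- exact: decaysD.
- by split=> x; apply: is_deriveD.
Qed.

Lemma niceZ C (k : R) f f1 f2 : nice C f f1 f2 ->
  nice (`|k| * C) (fun t => k * f t) (fun t => k * f1 t) (fun t => k * f2 t).
Proof.
move=> [df dtf d1 d2 [D1 D2]]; split.
- exact: decaysZ.
- by under eq_fun do rewrite mulrCA; exact: decaysZ.
- exact: decaysZ.
- exact: decaysZ.
- by split=> x; apply: is_deriveZ.
Qed.

Lemma is_derive_opp f a x : is_derive (- x) 1 f a -> is_derive x 1 (fun y => f (- y)) (- a).
Proof.
move=> h; have := is_derive1_comp h (is_deriveNid x 1).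
by rewrite mulrN1.
Qed.

Lemma nice_opp C f f1 f2 : nice C f f1 f2 ->
  nice C (fun t => f (- t)) (fun t => - f1 (- t)) (fun t => f2 (- t)).
Proof.
move=> [df dtf d1 d2 [D1 D2]]; split.
- exact: decays_opp.
- have := decaysZ (-1) (decays_opp dtf); rewrite normrN1 mul1r.
  by under eq_fun do rewrite mulN1r mulNr opprK.
- have := decaysZ (-1) (decays_opp d1); rewrite normrN1 mul1r.
  by under eq_fun do rewrite mulN1r.
- exact: decays_opp.
- split=> x; first exact: is_derive_opp.
  by have := is_deriveN (is_derive_opp (D2 (- x))); rewrite opprK.
Qed.

Lemma is_derive_shift1 f a x h : is_derive (x + h) 1 f a ->
  is_derive x 1 (fun y => f (y + h)) a.
Proof.
move=> d; have e : is_derive x 1 (fun y : R => y + h) 1.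
  by have := is_derive_affine 1 h x; under eq_fun do rewrite mul1r.
by have := @is_derive1_comp _ f (fun y => y + h) x _ _ d e; rewrite mulr1.
Qed.

Lemma nice_shift C f f1 f2 h : nice C f f1 f2 -> exists C',
  nice C' (fun t => f (t + h)) (fun t => f1 (t + h)) (fun t => f2 (t + h)).
Proof.
move=> [df dtf d1 d2 [D1 D2]].
have e := decays_shift h df; have e1 := decays_shift h d1.
have e2 := decays_shift h d2.
(* [t * f (t + h)] is [(t + h) * f (t + h)] plus [- h * f (t + h)]. *)
have := decaysD (decays_shift h dtf) (decaysZ (- h) e).
under [X in decays _ X]eq_fun do rewrite -mulrDl addrK.
set A := (_ * C) in e e1 e2 *; move=> et; exists (A + `|- h| * A).
have C0 := decays_ge0 e.
have AS : A <= A + `|- h| * A by rewrite lerDl mulr_ge0.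
split=> //; try exact: decaysS AS _.
by split=> x; exact: is_derive_shift1.
Qed.

End cosine_transform.

(** * The integral of a cosine transform, and inversion in one variable *)

Section inversion.
Context {R : realType}.
Implicit Types (f g F : R -> R) (C t x s th : R).
Let mu := @lebesgue_measure R.

Lemma cosBpihalf x : cos (x - pi / 2) = sin x.
Proof. by rewrite -sinDpihalf subrK. Qed.

(** Pointwise limit of the continuous functions [f t / (t^2 + 1 / (n + 1))]; at [t = 0] all of them
    vanish, in agreement with the convention on division. *)
Lemma measurable_divsqr f : continuous f -> f 0 = 0 ->
  measurable_fun setT (fun t => f t / t ^+ 2).
Proof.
move=> cf f0.
apply: (@measurable_fun_cvg _ _ _ _ (fun n t => f t / (t ^+ 2 + n.+1%:R^-1))).
  move=> m; apply: continuous_measurable_fun => t; apply: cvgM; first exact: cf.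
  apply: cvgV; first by rewrite gt_eqF// ltr_wpDl// sqr_ge0.
  by apply: cvgD; [exact: exprn_continuous|exact: cvg_cst].
move=> t _; have [->|t0] := eqVneq t 0.
  by rewrite f0 mul0r; under eq_fun do rewrite mul0r; exact: cvg_cst.
apply: cvgMl_tmp; apply: cvgV; first by rewrite expf_eq0.
rewrite -[X in _ --> X]addr0; apply: cvgD; first exact: cvg_cst.
exact: cvg_harmonic.
Qed.

(* With [Phi s := \int f(t) / t^2 (1 - cos (ts)) dt], which is bounded, [Phi''] is
   the transform of [f]; being integrable, it forces [Phi'] to have limits at
   infinity, which are [0] since [Phi] is bounded. *)
Lemma int_costr_even0 C f f1 f2 : nice C f f1 f2 -> (forall t, f (- t) = f t) ->
  f 0 = 0 -> (\int[mu]_s costr 0 f s = 0)%R.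
Proof.
move=> nf fE f0; have [df dtf d1 d2 [D1 D2]] := nf.
have C0 := decays_ge0 df.
have le1 D g t : decays D g -> `|g t| <= D.
  move=> dg; rewrite (le_trans (dg.2 t))// ler_piMr ?(decays_ge0 dg)//.
  by rewrite invf_le1.
(* Evenness makes the derivative vanish at [0]; with [f 0 = 0], two mean values then give
   [|f t| <= C t^2], so that [f t / t^2] is bounded. *)
have f10 : f1 0 = 0.
  have [_ e1] := is_derive_opp (f := f) (D1 (- 0)).
  have [_ e2] := D1 0; move: e1; under eq_fun do rewrite fE.
  by rewrite e2 oppr0 => e; lra.
have f1t t : `|f1 t| <= C * `|t|.
  have [c [_ _]] := MVT_any_order 0 t D2; rewrite f10 !subr0 => ->.
  by rewrite normrM ler_wpM2r// (le1 _ _ _ d2).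
have ft t : `|f t| <= C * t ^+ 2.
  have [c [h1 h2]] := MVT_any_order 0 t D1; rewrite f0 !subr0 => ->.
  rewrite normrM -real_normK ?num_real// expr2 mulrA ler_wpM2r//.
  rewrite (le_trans (f1t c))// ler_wpM2l//.
  have [t0|t0] := leP 0 t.
    by have /andP[c0 ct] := h1 t0; rewrite !ger0_norm.
  by have /andP[tc c0] := h2 (ltW t0); rewrite !ler0_norm ?lerN2// ltW.
pose psi t := f t / t ^+ 2; pose psi1 t := f t / t.
have psit t : psi t * t = psi1 t.
  have [->|t0] := eqVneq t 0; first by rewrite /psi1 invr0 !mulr0.
  by rewrite /psi /psi1 expr2 invfM mulrA mulfVK.
have psi1t t : psi1 t * t = f t.
  have [->|t0] := eqVneq t 0; first by rewrite f0 mulr0.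
  by rewrite /psi1 mulfVK.
have psiM t : psi t * t ^+ 2 = f t by rewrite expr2 mulrA psit psi1t.
(* One [C] comes from [|f t| <= C t^2], the other from [|psi t| * t^2 = |f t| <= C]. *)
have psib t : `|psi t| <= (C *+ 2) / oneDsqr t.
  rewrite ler_pdivlMr ?oneDsqr_gt0// oneDsqrE mulrDr mulr1 mulr2n.
  apply: lerD; last first.
    have -> : `|psi t| * t ^+ 2 = `|f t|.
      by rewrite -(psiM t) [RHS]normrM [`|t ^+ 2|]ger0_norm ?sqr_ge0.
    exact: le1.
  have [->|t0] := eqVneq t 0; first by rewrite /psi f0 mul0r normr0.
  rewrite /psi normrM normfV [`|t ^+ 2|]ger0_norm ?sqr_ge0// ler_pdivrMr//.
  by rewrite exprn_even_gt0.
have psi1b t : `|psi1 t| <= (C *+ 2) / oneDsqr t.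
  have := psib t; have := df.2 t; set w := oneDsqr t.
  have -> : `|f t| = `|psi t| * `|t| ^+ 2 by rewrite -(psiM t) [LHS]normrM normrX.
  have -> : `|psi1 t| = `|psi t| * `|t| by rewrite -psit [LHS]normrM.
  have := normr_ge0 t; have := normr_ge0 (psi t).
  have : 0 <= C / w by rewrite divr_ge0// /w ltW// oneDsqr_gt0.
  rewrite mulrnAl; set a := C / w; set p := `|psi t|; set q := `|t|.
  (* From [2 q <= 1 + q^2]: [2 p q <= p + p q^2 <= 2 a + a]. *)
  rewrite mulr2n => a0 p0 q0 pa pa2; have := mulr_ge0 p0 (sqr_ge0 (q - 1)). nra.
have mpsi : measurable_fun setT psi by apply: measurable_divsqr => //; exact: df.1.
have mpsi1 : measurable_fun setT psi1.
  by rewrite (_ : psi1 = (fun t => psi t * t)); [exact: measurable_funM|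
    apply/funext => t; rewrite psit].
have mc s th : measurable_fun setT (fun t : R => cos (t * s + th)).
  apply: continuous_measurable_fun; under eq_fun do rewrite mulrC.
  exact: continuous_cos_affine.
(* [H] will be the derivative of [Phi], and the transform [G] of [f] the derivative of [H]. *)
pose H s := (\int[mu]_t (psi1 t * cos (t * s - pi / 2)))%R.
pose Phi s := (\int[mu]_t (psi t * (1 - cos (t * s))))%R.
have bPhi0 s t : `|psi t * (1 - cos (t * s))| <= (C *+ 4) / oneDsqr t.
  rewrite normrM (le_trans (ler_pM _ _ (psib t) (_ : _ <= 2))) ?normr_ge0//.
    by rewrite (le_trans (ler_normB _ _))// normr1 -[2]/(1 + 1) lerD2l cos_le1N.
  by rewrite mulrAC ler_wpM2r ?invr_ge0// -(mulr_natr C 4) -(mulr_natr C 2); lra.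
have mPhi s : measurable_fun setT (fun t => psi t * (1 - cos (t * s))).
  apply: measurable_funM => //; apply: measurable_funB => //.
  by have := mc s 0; under eq_fun do rewrite addr0.
have bPhi s : `|Phi s| <= (C *+ 4) * pi by apply: bound_int_le.
have dPhi s : is_derive s 1 Phi (H s).
  apply: (@int_is_derive _ (fun s t => psi t * (1 - cos (t * s)))
    (fun s t => psi1 t * cos (t * s - pi / 2)) (fun t => (C *+ 2) / oneDsqr t)).
  - by move=> y; apply: bound_integrable => //.
  - exact: integrable_oneDsqrV.
  - move=> y t.
    have h0 : is_derive y 1 (fun y => 1 - cos (t * y)) (t * cos (t * y - pi / 2)).
      have := is_deriveB (is_derive_cst (1 : R) y 1) (is_derive_cos_affine t 0 y).
      under eq_fun do rewrite addr0.
      by rewrite sub0r addr0 cosDpihalf mulrN opprK cosBpihalf.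
    by have := is_deriveZ (psi t) h0; rewrite [_ *: _]mulrA psit.
  - by move=> y t; rewrite normrM (le_trans _ (psi1b t))// ler_piMr// cos_le1N.
have bH s t : `|psi1 t * cos (t * s - pi / 2)| <= (C *+ 2) / oneDsqr t.
  by rewrite normrM (le_trans _ (psi1b t))// ler_piMr// cos_le1N.
have mH s : measurable_fun setT (fun t => psi1 t * cos (t * s - pi / 2)).
  exact: measurable_funM.
pose G := costr 0 f.
have dH s : is_derive s 1 H (G s).
  apply: (@int_is_derive _ (fun s t => psi1 t * cos (t * s - pi / 2))
    (fun s t => f t * cos (t * s + 0)) (fun t => C / oneDsqr t)).
  - by move=> y; apply: bound_integrable => //.
  - exact: integrable_oneDsqrV.
  - move=> y t; have := is_deriveZ (psi1 t) (is_derive_cos_affine t (- (pi / 2)) y).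
    by rewrite [_ *: _]mulrA psi1t subrK addr0.
  - by move=> y t; have [_] := costr_decays y 0 df; apply.
have HN s : H (- s) = - H s.
  rewrite /H -[RHS]mulN1r -RintegralZl//; last by apply: bound_integrable => //.
  by apply: eq_Rintegral => t _; rewrite !cosBpihalf mulrN sinN mulrN mulN1r.
have dG := nice_costr 0 nf; set D := C * pi *+ 2 in dG.
have D0 : 0 <= D by exact: decays_ge0 dG.
pose M := (C *+ 4) * pi.
(* [H] tends to [0] at rate [1 / x]: for some [c] between [x] and [2 x],
   [H c * x = Phi (2 x) - Phi x] is at most [2 M] in absolute value, and [H x] differs from [H c] by
   [G d * (c - x)] with [d >= x], where [|G d| * x^2 <= D] by the decay of [G]. *)
have bHn (n : nat) : `|H n.+1%:R| <= (M *+ 2 + D) * n.+1%:R^-1.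
  set x : R := n.+1%:R; have x0 : 0 < x by rewrite ltr0n.
  rewrite ler_pdivlMr//.
  have [c [+ _ e]] := MVT_any_order x (x + x) dPhi.
  rewrite lerDl (ltW x0) => /(_ isT) /andP[xc cx].
  have [d [+ _ e']] := MVT_any_order x c dH; move=> /(_ xc) /andP[xd dc].
  have Gd : `|G d| * x * x <= D.
    rewrite -mulrA -expr2 (@le_trans _ _ (`|G d| * oneDsqr d))//.
      rewrite ler_wpM2l// oneDsqrE -[leLHS]add0r lerD// ler_pXn2r// nnegrE ltW//.
      exact: lt_le_trans xd.
    by rewrite -ler_pdivlMr ?oneDsqr_gt0//; have [_] := dG; apply.
  have -> : H x = H c - G d * (c - x) by rewrite -e' opprB addrC subrK.
  rewrite (le_trans (ler_wpM2r (ltW x0) (ler_normB _ _)))// mulrDl; apply: lerD.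
    rewrite -[X in _ * X]ger0_norm ?(ltW x0)// -normrM.
    by move: e; rewrite addrK => <-; rewrite mulr2n (le_trans (ler_normB _ _))// lerD.
  rewrite (le_trans _ Gd)// ler_wpM2r ?(ltW x0)// normrM ler_wpM2l//.
  by rewrite ger0_norm ?subr_ge0// lerBlDr.
have H0 : H n%:R @[n --> \oo] --> 0.
  rewrite -(cvg_shiftS (fun n => H n%:R))/=; apply/norm_cvg0P.
  apply: (@squeeze_cvgr _ _ _ _ (cst 0) (fun n => (M *+ 2 + D) * n.+1%:R^-1)).
  - by apply: nearW => n; rewrite normr_ge0/= bHn.
  - exact: cvg_cst.
  - rewrite [X in _ --> X](_ : 0 = (M *+ 2 + D) * 0); last by rewrite mulr0.
    by apply: cvgMl_tmp; exact: cvg_harmonic.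
rewrite -(cvg_lim (@Rhausdorff R) (int_lim dG dH)).
apply: (cvg_lim (@Rhausdorff R)).
(* As [H] is odd, [H n - H (- n)] is [H n + H n]. *)
under eq_fun do rewrite HN opprK.
have h : H n%:R + H n%:R @[n --> \oo] --> 0 + 0 by exact: cvgD.
by rewrite addr0 in h.
Qed.

Definition gauss t : R := expR (- (t ^+ 2 / 2)).

(** The functions to bound are all [h * gauss] with [|h t| <= 1 + t^2], and [(1 + t^2)^2 <= 16 (1 +
    t^2 / 4)^2 <= 16 exp (t^2 / 2)]. *)
Lemma nice_gauss : nice 16 gauss (fun t => - (t * gauss t))
  (fun t => (t ^+ 2 - 1) * gauss t).
Proof.
have dg t : is_derive t 1 gauss (- (t * gauss t)).
  have h : is_derive t 1 (fun t : R => - (t ^+ 2 / 2)) (- t).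
    have := is_deriveN (is_deriveZ (2^-1 : R) (is_deriveX 2 (is_derive_id t 1))).
    move=> h; have e : (fun t : R => - (t ^+ 2 / 2)) = (- (2^-1 \*: (id : R -> R) ^+ 2)).
      by apply/funext => x /=; rewrite mulrC.
    rewrite e; apply: is_derive_eq h _; rewrite /= expr1 /GRing.scale/= mulr1.
    by lra.
  have := @is_derive1_comp _ expR _ t _ _ (is_derive_expR _) h.
  by rewrite mulrN mulrC.
have ddg t : is_derive t 1 (fun t => - (t * gauss t)) ((t ^+ 2 - 1) * gauss t).
  have h := is_deriveN (is_deriveM (is_derive_id t 1) (dg t)).
  by apply: is_derive_eq h _; rewrite /GRing.scale/=; ring.
have cg := is_derive_cont dg; have cX := is_derive_cont ddg.
have M (h : R -> R) : continuous h -> (forall t, `|h t| <= oneDsqr t) ->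
    decays 16 (fun t => h t * gauss t).
  move=> ch bh; split=> [t|t]; first by apply: cvgM; [exact: ch|exact: cg].
  rewrite normrM [`|gauss t|]ger0_norm ?expR_ge0//.
  rewrite ler_pdivlMr ?oneDsqr_gt0//.
  rewrite mulrAC /gauss expRN ler_pdivrMr ?expR_gt0//.
  rewrite (@le_trans _ _ (oneDsqr t * oneDsqr t)) ?ler_wpM2r//.
  have -> : t ^+ 2 / 2 = t ^+ 2 / 4 + t ^+ 2 / 4 by lra.
  rewrite expRD; have := expR_ge1Dx (t ^+ 2 / 4); rewrite oneDsqrE.
  have := sqr_ge0 t; set e := expR _; set q := t ^+ 2 => q0 le.
  have le0 : 0 <= 1 + q / 4 by lra.
  have := ler_pM le0 le0 le le; nra.
split=> //.
- rewrite (_ : gauss = (fun t => cst 1 t * gauss t)); last first.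
    by apply/funext => t; rewrite mul1r.
  by apply: M => [|t]; [exact: cst_continuous|rewrite normr1 oneDsqr_ge1].
- apply: (M id); first exact: idT_continuous.
  move=> t; rewrite oneDsqrE -real_normK ?num_real//=.
  by have := sqr_ge0 (`|t| - 1); have := normr_ge0 t; nra.
- rewrite (_ : (fun t => _) = (fun t => - t * gauss t)); last first.
    by apply/funext => t; rewrite mulNr.
  apply: M => [|t]; first exact: opp_continuous.
   rewrite normrN oneDsqrE -real_normK ?num_real//=.
  by have := sqr_ge0 (`|t| - 1); have := normr_ge0 t; nra.
- apply: M => [t|t]; first by apply: cvgB; [exact: exprn_continuous|exact: cvg_cst].
  by rewrite ler_norml oneDsqrE; have := sqr_ge0 t; lra.
Qed.

(** The standard normal density [gauss / sqrt (2 pi)] has integral [1]. *)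
Lemma int_gauss_sqr : (\int[mu]_t gauss t)%R ^+ 2 = 2 * pi.
Proof.
have one0 : (1 : R) != 0 by exact: oner_neq0.
have p0 : 0 <= (1 : R) ^+ 2 * pi *+ 2 by rewrite mulrn_wge0// mulr_ge0 ?pi_ge0.
have := integral_normal_pdf (0 : R) (1 : R); rewrite normal_pdfE//.
have [dg _ _ _ _] := nice_gauss; have Ig := decays_integrable dg.
under eq_integral => t _.
  rewrite /normal_fun subr0 mulNr -[in _ *+ 2]mulr_natr expr1n mul1r -/(gauss t) EFinM.
  over.
rewrite integralZl//= -[X in (_ * X)%E]fineK; last exact: integrable_fin_num Ig.
rewrite -EFinM => -[]; rewrite -/(Rintegral _ _ _) => e.
have <- : Num.sqrt ((1 : R) ^+ 2 * pi *+ 2) = (\int[mu]_t gauss t)%R.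
  have np := normal_peak_gt0 one0.
  by apply: (mulfI (lt0r_neq0 np)); rewrite e /normal_peak mulVf// sqrtr_eq0 -ltNge
    mulrn_wgt0// mulr_gt0 ?pi_gt0// expr1n.
by rewrite sqr_sqrtr// expr1n mul1r mulr_natl.
Qed.

(** Integration by parts shows that the transform [K] satisfies [K' = - s K], so its product [P]
    with [exp (s^2 / 2)] is constant. *)
Lemma costr_gauss s : costr 0 gauss s = (\int[mu]_t gauss t)%R * gauss s.
Proof.
have ng := nice_gauss; have [dg dtg d1 d2 [D1 D2]] := ng.
pose P s := costr 0 gauss s * expR (s ^+ 2 / 2).
have dE t : is_derive t 1 (fun t : R => expR (t ^+ 2 / 2)) (t * expR (t ^+ 2 / 2)).
  have h : is_derive t 1 (fun t : R => t ^+ 2 / 2) t.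
    have := is_deriveZ (2^-1 : R) (is_deriveX 2 (is_derive_id t 1)).
    move=> h; have e : (fun t : R => t ^+ 2 / 2) = (2^-1 \*: (id : R -> R) ^+ 2).
      by apply/funext => x /=; rewrite mulrC.
    rewrite e; apply: is_derive_eq h _; rewrite /= expr1 /GRing.scale/= mulr1.
    by lra.
  have := @is_derive1_comp _ expR _ t _ _ (is_derive_expR _) h.
  by rewrite mulrC.
have dP t : is_derive t 1 P 0.
  have h : is_derive t 1 P _ := is_deriveM (costr_derive 0 t dg dtg) (dE t).
  apply: is_derive_eq h _.
  have := costr_ibp 0 t dg d1 D1.
  have -> : (fun t => - (t * gauss t)) = (fun t => -1 * (t * gauss t)).
    by apply/funext => x; rewrite mulN1r.
  rewrite (costrZ _ _ _ dtg) /GRing.scale/= mulN1r => e.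
  by rewrite -[costr (0 + _) _ _]opprK -e; ring.
have [c [_ _]] := MVT_any_order 0 s dP.
rewrite mul0r => /eqP; rewrite subr_eq0 => /eqP.
rewrite /P expr0n/= mul0r expR0 mulr1 => e.
have -> : (\int[mu]_t gauss t)%R = costr 0 gauss 0.
  by apply: eq_Rintegral => t _; rewrite mulr0 addr0 cos0 mulr1.
by rewrite -e /gauss -mulrA -expRD subrr expR0 mulr1.
Qed.

(** The even function [f t + f (- t) - 2 f 0 gauss t] vanishes at [0], so its transform integrates
    to [0]. The first two terms have the same transform, and the Gaussian contributes [2 f 0] times
    the square of its integral. *)
Lemma int_costr C f f1 f2 : nice C f f1 f2 -> (\int[mu]_s costr 0 f s = 2 * pi * f 0)%R.
Proof.
move=> nf; have no := nice_opp nf; have ng := nice_gauss.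
have nh := niceD (niceD nf no) (niceZ (- (f 0 *+ 2)) ng).
have g0 : gauss 0 = 1 by rewrite /gauss expr0n/= mul0r oppr0 expR0.
have := int_costr_even0 nh.
rewrite /= oppr0 g0 mulr1 -mulr2n subrr => /(_ _ erefl).
have h t : f (- t) + f (- - t) + - (f 0 *+ 2) * gauss (- t) =
           f t + f (- t) + - (f 0 *+ 2) * gauss t.
  by rewrite opprK [f (- t) + _]addrC /gauss sqrrN.
move=> /(_ h).
have [df _ _ _ _] := nf; have [do_ _ _ _ _] := no; have [dg _ _ _ _] := ng.
have e s : costr 0 (fun t => f t + f (- t) + - (f 0 *+ 2) * gauss t) s =
    2 * costr 0 f s + - (f 0 *+ 2) * costr 0 gauss s.
  rewrite (costrD _ _ (decaysD df do_) (decaysZ _ dg)) (costrD _ _ df do_) (costrZ _ _ _ dg).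
  congr (_ + _); rewrite mulr_natl mulr2n; congr (_ + _).
  rewrite /costr -[RHS](int_opp (costr_decays s 0 df)).
  by apply: eq_Rintegral => t _; rewrite !addr0 mulNr cosN.
under eq_Rintegral do rewrite e costr_gauss.
have dk := nice_costr 0 nf.
rewrite RintegralD//; last 2 first.
- exact: decays_integrable (decaysZ 2 dk).
- exact: decays_integrable (decaysZ _ (decaysZ _ dg)).
rewrite RintegralZl//; last exact: decays_integrable dk.
rewrite RintegralZl//; last exact: decays_integrable (decaysZ _ dg).
rewrite RintegralZl//; last exact: decays_integrable dg.
by rewrite -expr2 int_gauss_sqr; lra.
Qed.

(** By the addition formula the integrand is [\int f(t) cos((t - x) s) dt], which is the transform
    of [f] translated by [x]; [int_costr] evaluates its integral. *)
Lemma int_costr_inversion C f f1 f2 x : nice C f f1 f2 ->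
  (\int[mu]_s (cos (x * s) * costr 0 f s + cos (x * s - pi / 2) * costr (- (pi / 2)) f s) =
   2 * pi * f x)%R.
Proof.
move=> nf; have [df _ _ _ _] := nf; have [C' ns] := nice_shift x nf.
have := int_costr ns; rewrite add0r => <-; apply: eq_Rintegral => s _.
rewrite !cosBpihalf.
have dc := costr_decays s 0 df; have ds := costr_decays s (- (pi / 2)) df.
rewrite /costr -!RintegralZl//; try exact: (decays_integrable dc);
  try exact: (decays_integrable ds).
rewrite -RintegralD//; [|exact: decays_integrable (decaysZ _ dc)|
  exact: decays_integrable (decaysZ _ ds)].
have dcos : decays C (fun t => f t * cos (t * s + - (x * s))) by exact: costr_decays.
transitivity (\int[mu]_t (f t * cos (t * s + - (x * s))))%R.
  apply: eq_Rintegral => t _.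
  by rewrite addr0 cosBpihalf cosB (mulrC t s) (mulrC x s); ring.
apply: (etrans (esym (int_shift x dcos))); apply: eq_Rintegral => t _.
by congr (_ * cos _); ring.
Qed.

Lemma int_odd C f : decays C f -> (forall t, f (- t) = - f t) ->
  (\int[mu]_t f t = 0)%R.
Proof.
move=> df fN; have := int_opp df.
under eq_Rintegral do rewrite fN -mulN1r.
by rewrite RintegralZl//; [lra|exact: decays_integrable df].
Qed.

Lemma costr0_even f s : costr 0 f (- s) = costr 0 f s.
Proof. by apply: eq_Rintegral => t _; rewrite !addr0 mulrN cosN. Qed.

Lemma costr_odd C f s : decays C f -> costr (- (pi / 2)) f (- s) = - costr (- (pi / 2)) f s.
Proof.
move=> df; rewrite -[RHS]mulN1r -RintegralZl//; last first.
  exact: decays_integrable (costr_decays _ _ df).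
by apply: eq_Rintegral => t _; rewrite !cosBpihalf mulrN sinN mulrN mulN1r.
Qed.

(** The integrand is odd in [s], a sine times an even transform. With [int_costr_cos] this removes
    the cross terms from the complex inversion. *)
Lemma int_costr_sin C f f1 f2 x : nice C f f1 f2 ->
  (\int[mu]_s (cos (x * s - pi / 2) * costr 0 f s) = 0)%R.
Proof.
move=> nf; have dk := nice_costr 0 nf.
have := decaysM dk (@continuous_cos_affine _ x (- (pi / 2))) (fun t => cos_le1N _).
under [X in decays _ X]eq_fun do rewrite mulrC; move=> /int_odd; apply=> t.
by rewrite !cosBpihalf mulrN sinN mulNr costr0_even.
Qed.

Lemma int_costr_cos C f f1 f2 x : nice C f f1 f2 ->
  (\int[mu]_s (cos (x * s) * costr (- (pi / 2)) f s) = 0)%R.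
Proof.
move=> nf; have dk := nice_costr (- (pi / 2)) nf; have [df _ _ _ _] := nf.
have cc : continuous (fun s => cos (x * s)).
  by have := @continuous_cos_affine _ x 0; under eq_fun do rewrite addr0.
have := decaysM dk cc (fun t => cos_le1N _).
under [X in decays _ X]eq_fun do rewrite mulrC; move=> /int_odd; apply=> t.
by rewrite mulrN cosN (costr_odd _ df) mulrN.
Qed.

End inversion.

(** * Smooth and rapidly decreasing functions of several variables *)
Section calculus_nd.
Context {R : realType} {n : nat}.
Implicit Types (f g : 'rV[R]_n -> R) (i j : 'I_n) (x y : 'rV[R]_n) (s t : seq 'I_n).
Local Notation ev i := (delta_mx 0 i : 'rV[R]_n).

(** The two difference quotients are the same function of [h]; this brings one-variable calculus to
    directional derivatives. *)
Lemma is_derive_line f (v x : 'rV[R]_n) (r a : R) :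
  is_derive (x + r *: v) v f a <-> is_derive r 1 (fun r : R => f (x + r *: v)) a.
Proof.
have e : (fun h : R => h^-1 *: ((f \o shift (x + r *: v)) (h *: v) - f (x + r *: v)))
  = (fun h : R => h^-1 *: (((fun r : R => f (x + r *: v)) \o shift r) (h *: (1 : R))
       - f (x + r *: v))).
  by apply/funext => h /=; rewrite [h *: (1 : R)]mulr1 scalerDl addrCA.
split=> -[d <-]; apply: DeriveDef.
- by rewrite /derivable -e.
- by rewrite /derive -e.
- by rewrite /derivable e.
- by rewrite /derive e.
Qed.

Lemma partial_is_derive f i x : derivable f x (ev i) -> is_derive x (ev i) f (partial i f x).
Proof. by move=> d; apply: DeriveDef. Qed.

Lemma smooth_is_derive f s i x : smooth f ->
  is_derive x (ev i) (partials s f) (partial i (partials s f) x).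
Proof. by move=> sf; apply: partial_is_derive; exact: (sf s).2. Qed.

Lemma partial_val f i x a : is_derive x (ev i) f a -> partial i f x = a.
Proof. by move=> [_ <-]. Qed.

Lemma partials_cat s t f : partials (s ++ t) f = partials s (partials t f).
Proof. by rewrite /partials foldr_cat. Qed.

Lemma smooth_partials s f : smooth f -> smooth (partials s f).
Proof. by move=> sf t; rewrite -partials_cat; exact: sf. Qed.

(** A coinduction principle: it suits families such as the partial transforms, whose partial
    derivatives stay in the family with other parameters. *)
Lemma smooth_coind (A : set ('rV[R]_n -> R)) :
  (forall f, A f -> continuous f /\
     forall i, (forall x, derivable f x (ev i)) /\ A (partial i f)) ->
  A `<=` smooth.
Proof.
move=> HA f Af s.
have : A (partials s f) by elim: s => [//|i s IH] /=; exact: ((HA _ IH).2 i).2.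
by move=> /HA[cs ds]; split=> // x i; exact: (ds i).1.
Qed.

Lemma is_derive_coord i j x : is_derive x (ev j) (fun x => x 0 i) (i == j)%:R.
Proof.
rewrite -[X in is_derive X](addr0 x) -[X in _ + X](scale0r (ev j)).
apply/is_derive_line; have := is_derive_affine ((i == j)%:R : R) (x 0 i) 0.
congr (is_derive _ _ _ _); apply/funext => r.
by rewrite !mxE eqxx /= [in RHS]addrC mulrC.
Qed.

Lemma continuous_coord i : continuous (fun x : 'rV[R]_n => x 0 i : R).
Proof. exact: coord_continuous. Qed.

Lemma is_derive_mul_coord i j f x a : is_derive x (ev j) f a ->
  is_derive x (ev j) (fun x => x 0 i * f x) (x 0 i * a + (i == j)%:R * f x).
Proof.
move=> df; have h := is_deriveM (is_derive_coord i j x) df.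
by apply: is_derive_eq h _; rewrite /GRing.scale/= [f x * _]mulrC.
Qed.

Lemma partial_mul_coord i j f : smooth f ->
  partial j (fun x => x 0 i * f x) =
  (fun x => x 0 i * partial j f x + (i == j)%:R * f x).
Proof.
move=> sf; apply/funext => x; apply: partial_val; apply: is_derive_mul_coord.
exact: (smooth_is_derive [::] j x sf).
Qed.

Lemma smooth_mul_coord i f : smooth f -> smooth (fun x => x 0 i * f x).
Proof.
(* The summand [k] absorbs the term that the product rule produces, which makes the class stable
   under [partial]. *)
move=> sf; pose A := [set h | exists g k, [/\ smooth g, smooth k &
  h = (fun x : 'rV[R]_n => x 0 i * g x + k x)]].
apply: (@smooth_coind A); last first.
  exists f, (fun=> 0); split; [exact: sf|exact: smooth0|].
  by apply/funext => x; rewrite addr0.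
move=> _ [g [k [sg sk ->]]]; split.
  have cg : continuous (fun x => x 0 i * g x).
    have cg0 : continuous g := (sg [::]).1.
    by move=> x; exact: (cvgM (@continuous_coord i x) (cg0 x)).
  by move=> x; exact: (cvgD (cg x) ((sk [::]).1 x)).
move=> j; have h x : is_derive x (ev j) (fun x => x 0 i * g x + k x)
    (x 0 i * partial j g x + (i == j)%:R * g x + partial j k x).
  have := is_deriveD (is_derive_mul_coord i (smooth_is_derive [::] j x sg))
    (smooth_is_derive [::] j x sk).
  by [].
split=> [x|]; first by have [] := h x.
exists (partial j g), (fun x => (i == j)%:R * g x + 1 * partial j k x); split.
- exact: (smooth_partials [:: j] sg).
- exact: smooth_lin sg (smooth_partials [:: j] sk).
- by apply/funext => x; rewrite (partial_val (h x)) mul1r addrA.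
Qed.

Lemma is_derive_along f i x (r : R) : (forall y, derivable f y (ev i)) ->
  is_derive r 1 (fun r : R => f (x + r *: ev i)) (partial i f (x + r *: ev i)).
Proof. by move=> df; apply/is_derive_line; exact: partial_is_derive. Qed.

Lemma norm_ev (r : R) i : `|r *: ev i| <= `|r|.
Proof.
rewrite normrZ ler_piMr// [leLHS]/Num.norm/= mx_normrE; apply/bigmax_leP.
by split => //= -[k l] _ /=; rewrite mxE; case: (_ && _); rewrite ?normr1 ?normr0.
Qed.

(** The mean value theorem in direction [i] for the increment [phi] of [f] in direction [j], then in
    direction [j]. The left-hand side is symmetric in [i] and [j]. *)
Lemma second_difference f i j x (h : R) : smooth f -> 0 < h ->
  exists2 y, `|x - y| <= h + h &
    f (x + h *: ev i + h *: ev j) - f (x + h *: ev i) - f (x + h *: ev j) + f x =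
    partial j (partial i f) y * h ^+ 2.
Proof.
move=> sf h0; pose phi r := f (x + h *: ev j + r *: ev i) - f (x + r *: ev i).
have dphi (r : R) : is_derive r 1 phi
    (partial i f (x + h *: ev j + r *: ev i) - partial i f (x + r *: ev i)).
  by apply: is_deriveB; apply: is_derive_along => y; exact: (sf [::]).2.
have [c [+ _ ec]] := MVT_any_order 0 h dphi; move=> /(_ (ltW h0)) ch.
have dpsi (r : R) := is_derive_along (x + c *: ev i) r (fun y => (sf [:: i]).2 y j).
have [d [+ _ ed]] := MVT_any_order 0 h dpsi; move=> /(_ (ltW h0)) dh.
exists (x + c *: ev i + d *: ev j).
  rewrite -addrA opprD addrA subrr add0r normrN (le_trans (ler_normD _ _))//.
  move: ch dh => /andP[c0 ch] /andP[d0 dh]; apply: lerD.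
  - by rewrite (le_trans (norm_ev _ _))// ger0_norm.
  - by rewrite (le_trans (norm_ev _ _))// ger0_norm.
rewrite subr0 in ec ed; rewrite expr2 mulrA -ed scale0r addr0.
rewrite /phi !scale0r !addr0 in ec.
by rewrite [x + c *: _ + _]addrAC -ec [x + h *: _ + _ in LHS]addrAC; ring.
Qed.

Lemma half_dist_le (a b w e : R) : `|a - w| < e / 2 -> `|b - w| < e / 2 -> `|b - a| <= e.
Proof.
move=> aw bw; rewrite -(subrK w b) -addrA ltW// (splitr e).
by rewrite (le_lt_trans (ler_normD _ _))// ltrD// distrC.
Qed.

(** Both orders of [second_difference] yield points within [2 h] of [x] at which the two mixed
    derivatives agree; their continuity at [x] concludes as [h] is small. *)
Lemma partialC f i j : smooth f -> partial i (partial j f) = partial j (partial i f).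
Proof.
move=> sf; apply/funext => x; apply/eqP; rewrite -subr_eq0 -normr_le0.
apply/ler_addgt0Pr => e e0; rewrite add0r.
have e20 : 0 < e / 2 by rewrite divr_gt0.
have /cvgrPdist_lt/(_ _ e20) := (sf [:: i; j]).1 x.
have /cvgrPdist_lt/(_ _ e20) := (sf [:: j; i]).1 x.
move=> /nbhs_ballP[d1 /= d10 b1] /nbhs_ballP[d2 /= d20 b2].
pose h := Num.min d1 d2 / 4.
have m0 : 0 < Num.min d1 d2 by rewrite lt_min d10.
have h0 : 0 < h by rewrite divr_gt0.
have hh : h + h < Num.min d1 d2 by rewrite /h; lra.
have [y xy E1] := second_difference i j x sf h0.
have [z xz E2] := second_difference j i x sf h0.
have E : partial j (partial i f) y = partial i (partial j f) z.
  have h20 : h ^+ 2 != 0 by rewrite expf_neq0// gt_eqF.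
  apply: (mulIf h20); refine (etrans (esym E1) (etrans _ E2)).
  by rewrite [x + h *: ev j + _]addrAC; congr (_ + _); exact: addrAC.
have l1 : Num.min d1 d2 <= d1 by rewrite ge_min lexx.
have l2 : Num.min d1 d2 <= d2 by rewrite ge_min lexx orbT.
have B1 : `|partial j (partial i f) x - partial j (partial i f) y| < e / 2.
  by apply: b1; rewrite -ball_normE; exact: lt_le_trans (le_lt_trans xy hh) l1.
have B2 : `|partial i (partial j f) x - partial i (partial j f) z| < e / 2.
  by apply: b2; rewrite -ball_normE; exact: lt_le_trans (le_lt_trans xz hh) l2.
by move: B1; rewrite E => B1; exact: half_dist_le B1 B2.
Qed.

Lemma mem_partials i s f : smooth f -> i \in s ->
  partials s f = partial i (partials (rem i s) f).
Proof.
move=> sf; elim: s => [//|j s IH] /=; rewrite inE eq_sym.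
case: eqVneq => [->//|ji] /= /IH ->.
by rewrite partialC; last exact: smooth_partials.
Qed.

Lemma perm_partials s t f : smooth f -> perm_eq s t -> partials s f = partials t f.
Proof.
move=> sf; elim: s t => [|i s IH] t pst.
  by move: pst; rewrite perm_sym => /perm_nilP ->.
have it : i \in t by rewrite -(perm_mem pst) mem_head.
rewrite (mem_partials sf it) /=; congr partial; apply: IH.
by rewrite -(perm_cons i) (perm_trans pst)// perm_to_rem.
Qed.

(** Existence of partial derivatives does not give continuity, but bounded ones make [f] Lipschitz:
    the coordinates are changed one at a time. *)
Lemma is_derive_bounded_continuous f (f' : 'I_n -> 'rV[R]_n -> R) (c : R) :
  (forall i x, is_derive x (ev i) f (f' i x)) -> (forall i x, `|f' i x| <= c) ->
  continuous f.
Proof.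
move=> df bf x.
have lip y : `|f y - f x| <= n%:R * (c * `|y - x|).
  (* [z k] has its first [k] coordinates from [y] and the others from [x], so consecutive points
     differ in a single coordinate. *)
  pose z (k : nat) : 'rV[R]_n := \row_(j < n) if (j < k)%N then y 0 j else x 0 j.
  have zS (k : 'I_n) : z k.+1 = z k + (y 0 k - x 0 k) *: ev k.
    apply/rowP => j; rewrite !mxE eqxx /= ltnS leq_eqVlt.
    have [->|jk] := eqVneq j k; first by rewrite ltnn eqxx/= mulr1 addrC subrK.
    by rewrite (negbTE jk : (j == k :> nat) = false)/= mulr0 addr0.
  have H k : (k <= n)%N -> `|f (z k) - f x| <= k%:R * (c * `|y - x|).
    elim: k => [_|k IH kn].
      rewrite (_ : z 0%N = x) ?subrr ?normr0 ?mul0r//.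
      by apply/rowP => j; rewrite mxE ltn0.
    have {}IH := IH (ltnW kn).
    rewrite -(subrK (f (z k)) (f (z k.+1))) -addrA (le_trans (ler_normD _ _))//.
    rewrite -natr1 mulrDl mul1r [leRHS]addrC lerD//.
    have := zS (Ordinal kn); rewrite /= => ->; set i := Ordinal kn.
    have dl (r : R) : is_derive r 1 (fun r => f (z k + r *: ev i)) (f' i (z k + r *: ev i)).
      by apply/is_derive_line.
    have [d [_ _]] := MVT_any_order 0 (y 0 i - x 0 i) dl; rewrite scale0r addr0 subr0 => ->.
    rewrite normrM; apply: ler_pM; [exact: normr_ge0|exact: normr_ge0|exact: bf|].
    rewrite (_ : y 0 i - x 0 i = (y - x) 0 i); last by rewrite !mxE.
    rewrite [leRHS]/Num.norm/= mx_normrE; apply/bigmax_geP; right.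
    by exists (0, i).
  have := H n (leqnn n); rewrite (_ : z n = y)//.
  by apply/rowP => j; rewrite mxE ltn_ord.
apply/(@cvgrPdist_lt _ _ _ _ (nbhs_filter (x : 'rV[R]_n))) => e e0; pose K := `|n%:R * c| + 1.
have K0 : 0 < K by rewrite ltr_wpDl.
apply/nbhs_ballP; exists (e / K) => [|y]; first by rewrite /= divr_gt0.
rewrite -ball_normE /= ltr_pdivlMr// distrC => xy.
rewrite distrC (le_lt_trans (lip y))// (le_lt_trans _ xy)// mulrA mulrC ler_wpM2l//.
by rewrite (le_trans (ler_norm _))// lerDl.
Qed.

End calculus_nd.

(** * Words in the operators [x_j] and [D_j], and their comparison with ordered monomials *)

Section words.
Context {R : realType} {n : nat}.
Implicit Types (f g : 'rV[R]_n -> R) (i j : 'I_n) (x y : 'rV[R]_n) (s t : seq 'I_n).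
Implicit Types (l : bool * 'I_n) (w : seq (bool * 'I_n)).

(* The letters are the operators [x_i *] and [D_i]. *)
Definition act l f : 'rV[R]_n -> R :=
  if l.1 then fun x => x 0 l.2 * f x else partial l.2 f.

Definition wd w f := foldr act f w.

Lemma wd_cat w w' f : wd (w ++ w') f = wd w (wd w' f).
Proof. by rewrite /wd foldr_cat. Qed.

Lemma smooth_act l f : smooth f -> smooth (act l f).
Proof.
case: l => [[] i] sf; first exact: smooth_mul_coord.
exact: (smooth_partials [:: i] sf).
Qed.

Lemma smooth_wd w f : smooth f -> smooth (wd w f).
Proof. by move=> sf; elim: w => [//|l w IH]; exact: smooth_act. Qed.

Lemma act_lin l (a b : R) f g : smooth f -> smooth g ->
  act l (fun x => a * f x + b * g x) = (fun x => a * act l f x + b * act l g x).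
Proof.
case: l => [[] i] sf sg; rewrite /act /=; last exact: (partials_lin [:: i] a b sf sg).
by apply/funext => x; ring.
Qed.

Lemma wd_lin w (a b : R) f g : smooth f -> smooth g ->
  wd w (fun x => a * f x + b * g x) = (fun x => a * wd w f x + b * wd w g x).
Proof.
move=> sf sg; elim: w => [//|l w IH] /=; rewrite IH.
by rewrite act_lin; [|exact: smooth_wd|exact: smooth_wd].
Qed.

Definition wbound (m : nat) (c : R) f :=
  forall w, (size w <= m)%N -> forall x, `|wd w f x| <= c.

(** The real-valued Schwartz class, defined through words because these are stable under the
    exchange of [x_i] and [D_i]; [S_predP] identifies it with the class given by [S_norm]. *)
Definition schw f := smooth f /\ forall w, exists c, forall x, `|wd w f x| <= c.

Lemma wbound_leq m m' c f : (m <= m')%N -> wbound m' c f -> wbound m c f.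
Proof. by move=> mm' H w wm; apply: H; exact: leq_trans mm'. Qed.

Lemma wbound_le m c c' f : c <= c' -> wbound m c f -> wbound m c' f.
Proof. by move=> cc' H w wm x; rewrite (le_trans (H w wm x)). Qed.

Lemma wbound_wd m w c f : wbound (m + size w) c f -> wbound m c (wd w f).
Proof.
by move=> H w' wm x; rewrite -wd_cat; apply: H; rewrite size_cat leq_add2r.
Qed.

Lemma wbound_lin m (a b c d : R) f g : smooth f -> smooth g ->
  wbound m c f -> wbound m d g ->
  wbound m (`|a| * c + `|b| * d) (fun x => a * f x + b * g x).
Proof.
move=> sf sg Bf Bg w wm x; rewrite wd_lin// (le_trans (ler_normD _ _))// !normrM.
by apply: lerD; rewrite ler_wpM2l//; [exact: Bf|exact: Bg].
Qed.

Lemma schw_act l f : schw f -> schw (act l f).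
Proof.
move=> [sf bf]; split; first exact: smooth_act.
by move=> w; have [c bc] := bf (rcons w l); exists c => x; rewrite -[act l f]/(wd [:: l] f)
  -wd_cat cats1.
Qed.

(** There are finitely many letters, so bounds for the functions [act l f] can be summed; the
    induction splits off the last letter of the word, the one that acts first. *)
Lemma schw_wbound m f : schw f -> exists c, wbound m c f.
Proof.
elim: m f => [|m IH] f gf.
  have [c Hc] := gf.2 [::]; exists c => w; rewrite leqn0 size_eq0 => /eqP ->.
  exact: Hc.
have /choice[c Hc] : forall l, exists c, wbound m c (act l f).
  by move=> l; apply: IH; exact: schw_act.
have [c0 Hc0] := gf.2 [::].
have c0_ge0 : 0 <= `|c0| + \sum_l `|c l| by rewrite addr_ge0// sumr_ge0.
exists (`|c0| + \sum_l `|c l|) => w wm x.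
case/lastP: w wm => [_|w l].
  by rewrite (le_trans (Hc0 x))// (le_trans (ler_norm _))// lerDl sumr_ge0.
rewrite size_rcons ltnS => wm; rewrite -cats1 wd_cat.
rewrite (le_trans (Hc l w wm x))// (le_trans (ler_norm _))//.
by rewrite (bigD1 l)//= addrCA lerDl addr_ge0// sumr_ge0.
Qed.

Lemma wbound_schw f : smooth f -> (forall m, exists c, wbound m c f) -> schw f.
Proof.
by move=> sf H; split=> // w; have [c Hc] := H (size w); exists c; exact: Hc.
Qed.

Lemma schw_lin (a b : R) f g : schw f -> schw g -> schw (fun x => a * f x + b * g x).
Proof.
move=> gf gg; apply: wbound_schw; first by apply: smooth_lin; [exact: gf.1|exact: gg.1].
move=> m; have [c bc] := schw_wbound m gf; have [d bd] := schw_wbound m gg.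
by exists (`|a| * c + `|b| * d); exact: wbound_lin gf.1 gg.1 bc bd.
Qed.

Lemma wbound_ge0 m c f : wbound m c f -> 0 <= c.
Proof. by move=> /(_ [::] isT 0); apply: le_trans. Qed.

(* Operators obtained as linear combinations of the [x^k D^q]. *)
Inductive nform : nat -> (('rV[R]_n -> R) -> 'rV[R]_n -> R) -> Prop :=
| nform_base p s t : (size s + size t <= p)%N ->
    nform p (fun f x => (\prod_(i <- s) x 0 i) * partials t f x)
| nform_lin p T S (a b : R) : nform p T -> nform p S ->
    nform p (fun f x => a * T f x + b * S f x).

Lemma smooth_prod s t f : smooth f ->
  smooth (fun x => (\prod_(i <- s) x 0 i) * partials t f x).
Proof.
move=> sf; elim: s => [|i s IH].
  under eq_fun do rewrite big_nil mul1r; exact: smooth_partials.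
by under eq_fun do rewrite big_cons -mulrA; exact: smooth_mul_coord.
Qed.

Lemma nform_smooth p T f : nform p T -> smooth f -> smooth (T f).
Proof.
by elim=> [{}p s t _|{}p {}T S a b _ IT _ IS] sf; [exact: smooth_prod|
  exact: smooth_lin (IT sf) (IS sf)].
Qed.

Lemma nform_mul i p T : nform p T -> exists2 T', nform p.+1 T' &
  forall f, act (true, i) (T f) = T' f.
Proof.
elim=> [{}p s t pst|{}p {}T S a b _ [T' nT eT] _ [S' nS eS]].
  exists (fun f x => (\prod_(k <- i :: s) x 0 k) * partials t f x).
    exact: nform_base.
  by move=> f; apply/funext => x; rewrite /act /= big_cons mulrA.
exists (fun f x => a * T' f x + b * S' f x); first exact: nform_lin.
by move=> f; rewrite -eT -eS; apply/funext => x; rewrite /act /=; ring.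
Qed.

(** The relation [D_i x_k = x_k D_i + [i = k]] moves [D_i] past the coordinates one by one; the
    extra term is shorter, so the order grows by one only. *)
Lemma nform_partial i p T : nform p T -> exists2 T', nform p.+1 T' &
  forall f, smooth f -> partial i (T f) = T' f.
Proof.
elim=> [{}p s t|{}p {}T S a b nT0 [T' nT eT] nS0 [S' nS eS]]; last first.
  exists (fun f x => a * T' f x + b * S' f x); first exact: nform_lin.
  move=> f sf; rewrite -eT// -eS//.
  exact: (partials_lin [:: i] a b (nform_smooth nT0 sf) (nform_smooth nS0 sf)).
elim: s p => [p pt|k s IH [//|p] /= pst].
  exists (fun f x => (\prod_(j <- [::]) x 0 j) * partials (i :: t) f x).
    exact: nform_base.
  move=> f sf; under [in LHS]eq_fun do rewrite big_nil mul1r.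
  by apply/funext => x; rewrite big_nil mul1r.
have [T1 n1 e1] := IH p pst; have [T2 n2 e2] := nform_mul k n1.
exists (fun f x => 1 * T2 f x + (k == i)%:R * ((\prod_(j <- s) x 0 j) * partials t f x)).
  by apply: nform_lin => //; apply: nform_base; exact: leqW (leqW _).
move=> f sf; rewrite -e2 -e1//.
under [in LHS]eq_fun do rewrite big_cons -mulrA.
rewrite partial_mul_coord; last exact: smooth_prod.
by apply/funext => x; rewrite mul1r.
Qed.

(** This normal ordering allows arbitrary words to be bounded by seminorms that only see ordered
    monomials. *)
Lemma wd_nform w : exists2 T, nform (size w) T & forall f, smooth f -> wd w f = T f.
Proof.
elim: w => [|[[] i] w [T nT eT]] /=.
- exists (fun f x => (\prod_(j <- [::]) x 0 j) * partials [::] f x).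
    exact: nform_base.
  by move=> f sf; apply/funext => x; rewrite big_nil mul1r.
- have [T' nT' eT'] := nform_mul i nT; exists T' => // f sf.
  by rewrite eT.
- have [T' nT' eT'] := nform_partial i nT; exists T' => // f sf.
  by rewrite eT// -eT'.
Qed.

Lemma count_multi_seq (q : {ffun 'I_n -> nat}) i : count_mem i (multi_seq q) = q i.
Proof.
rewrite /multi_seq count_flatten sumnE !big_map -enumT big_enum/= (bigD1 i)//=.
rewrite count_nseq /= eqxx mul1n big1 ?addn0// => j ji.
by rewrite count_nseq /= (negbTE ji).
Qed.

Lemma size_multi_seq (q : {ffun 'I_n -> nat}) : size (multi_seq q) = mdeg q.
Proof.
rewrite /multi_seq size_flatten /shape sumnE !big_map -enumT big_enum /mdeg.
by apply: eq_bigr => i _; rewrite size_nseq.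
Qed.

Lemma perm_multi_seq s : perm_eq s (multi_seq [ffun i => count_mem i s]).
Proof. by apply/allP => i _ /=; rewrite count_multi_seq ffunE. Qed.

Lemma monom_prod (q : {ffun 'I_n -> nat}) x : monom q x = \prod_(i <- multi_seq q) x 0 i.
Proof.
rewrite /multi_seq big_flatten big_map big_enum /monom; apply: eq_bigr => i _.
by rewrite big_nseq iter_mulr_1.
Qed.

Lemma wd_monom s t f x : wd ([seq (true, i) | i <- s] ++ [seq (false, i) | i <- t]) f x =
  (\prod_(i <- s) x 0 i) * partials t f x.
Proof.
elim: s => [|i s IH] /=; last by rewrite /act /= IH big_cons mulrA.
rewrite big_nil mul1r; congr (_ x); elim: t => [//|i t /= ->//].
Qed.

Definition mbound (p : nat) (c : R) f := forall k q : {ffun 'I_n -> nat},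
  (mdeg k <= p)%N -> (mdeg q <= p)%N ->
  forall x, `|monom k x * partials (multi_seq q) f x| <= c.

Lemma wbound_mbound p c f : wbound (p + p) c f -> mbound p c f.
Proof.
move=> H k q kp qp x; rewrite monom_prod -wd_monom; apply: H.
by rewrite size_cat !size_map !size_multi_seq leq_add.
Qed.

(** [A] depends on the operator alone, and this uniformity later becomes continuity. The symmetry of
    mixed derivatives brings [t] to the canonical order of [multi_seq]. *)
Lemma nform_bound p T : nform p T -> exists2 A, 0 <= A &
  forall f c, smooth f -> mbound p c f -> forall x, `|T f x| <= A * c.
Proof.
elim=> [{}p s t pst|{}p {}T S a b _ [A A0 HA] _ [B B0 HB]].
  exists 1 => // f c sf H x; rewrite mul1r.
  rewrite (perm_partials sf (perm_multi_seq t)) (perm_big _ (perm_multi_seq s))/=.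
  rewrite -monom_prod; apply: H; rewrite -size_multi_seq -(perm_size (perm_multi_seq _)).
    exact: leq_trans (leq_addr _ _) pst.
  exact: leq_trans (leq_addl _ _) pst.
exists (`|a| * A + `|b| * B); first by rewrite addr_ge0// mulr_ge0.
move=> f c sf H x; rewrite (le_trans (ler_normD _ _))// !normrM mulrDl -!mulrA.
by apply: lerD; rewrite ler_wpM2l//; [exact: HA|exact: HB].
Qed.

Lemma mbound_leq p p' c f : (p <= p')%N -> mbound p' c f -> mbound p c f.
Proof. by move=> pp' H k q kp qp; apply: H; [exact: leq_trans pp'|exact: leq_trans pp']. Qed.

Lemma mbound_wd m : exists2 A, 0 <= A & forall f c, smooth f -> 0 <= c ->
  mbound m c f -> forall w, size w = m -> forall x, `|wd w f x| <= A * c.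
Proof.
have /choice[A HA] : forall w : m.-tuple (bool * 'I_n), exists A, 0 <= A /\
    forall f c, smooth f -> mbound m c f -> forall x, `|wd w f x| <= A * c.
  move=> w; have [T nT eT] := wd_nform w; rewrite size_tuple in nT.
  have [A A0 H] := nform_bound nT; exists A; split=> // f c sf mf x.
  by rewrite eT//; exact: H.
exists (\sum_w A w); first by rewrite sumr_ge0// => w _; have [] := HA w.
move=> f c sf c0 mf w /eqP wm x.
rewrite (le_trans ((HA (Tuple wm)).2 f c sf mf x))// ler_wpM2r//.
by rewrite (bigD1 (Tuple wm))//= lerDl sumr_ge0// => w' _; have [] := HA w'.
Qed.

Lemma mbound_wbound m : exists2 A, 0 <= A &
  forall f c, smooth f -> 0 <= c -> mbound m c f -> wbound m (A * c) f.
Proof.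
have /choice[A HA] : forall k, exists A, 0 <= A /\ forall f c, smooth f -> 0 <= c ->
    mbound k c f -> forall w, size w = k -> forall x, `|wd w f x| <= A * c.
  by move=> k; have [A A0 H] := mbound_wd k; exists A.
exists (\sum_(k < m.+1) A k); first by rewrite sumr_ge0// => k _; have [] := HA k.
move=> f c sf c0 mf w wm x; rewrite -ltnS in wm.
rewrite (le_trans ((HA (size w)).2 f c sf c0 (mbound_leq _ mf) w erefl x))//.
rewrite ler_wpM2r// (bigD1 (Ordinal wm))//= lerDl sumr_ge0// => k _.
by have [] := HA k.
Qed.

End words.

(** * Transforms in one of several variables *)
Section partial_transform.
Context {R : realType} {n : nat}.
Implicit Types (f g : 'rV[R]_n -> R) (i j : 'I_n) (x y : 'rV[R]_n) (t th : R).
Implicit Types (l : bool * 'I_n) (w : seq (bool * 'I_n)).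
Local Notation ev i := (delta_mx 0 i : 'rV[R]_n).
Let mu := @lebesgue_measure R.

(** Replacing the coordinate [i] is written as a translation along [ev i], so that the lemmas on
    derivatives along lines apply. *)
Definition upd i x t : 'rV[R]_n := x + (t - x 0 i) *: ev i.

Lemma upd_line i x t : upd i x t = upd i x 0 + t *: ev i.
Proof. by rewrite /upd -addrA -scalerDl sub0r addrC [- _ + _]addrC addrC. Qed.

Lemma upd_i i x t : upd i x t 0 i = t.
Proof. by rewrite !mxE !eqxx /= mulr1 addrC subrK. Qed.

Lemma upd_j i j x t : j != i -> upd i x t 0 j = x 0 j.
Proof. by move=> ji; rewrite !mxE (negbTE ji) andbF mulr0 addr0. Qed.

Lemma upd_id i x : upd i x (x 0 i) = x.
Proof. by rewrite /upd subrr scale0r addr0. Qed.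

Lemma upd_add_i i x (r : R) t : upd i (x + r *: ev i) t = upd i x t.
Proof.
by apply/rowP => j; rewrite !mxE !eqxx /=; case: eqVneq => [->|_] /=; ring.
Qed.

Lemma upd_add_j i j x (r : R) t : j != i -> upd i (x + r *: ev j) t = upd i x t + r *: ev j.
Proof.
move=> ji; apply/rowP => k; rewrite !mxE !eqxx (eq_sym i j) (negbTE ji) /=.
by ring.
Qed.

Lemma upd_upd i x t t' : upd i (upd i x t) t' = upd i x t'.
Proof. by rewrite {2}/upd upd_add_i. Qed.

Lemma upd_add_eq i x (r : R) : (x + r *: ev i) 0 i = x 0 i + r.
Proof. by rewrite !mxE !eqxx /= mulr1. Qed.

Lemma upd_add_neq i j x (r : R) : j != i -> (x + r *: ev j) 0 i = x 0 i.
Proof. by move=> ji; rewrite !mxE eqxx (eq_sym i j) (negbTE ji) mulr0 addr0. Qed.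

Definition slice i x f t := f (upd i x t).

Lemma slice_upd i x t f : slice i (upd i x t) f = slice i x f.
Proof. by apply/funext => s; rewrite /slice upd_upd. Qed.

Lemma slice_is_derive i x f t : smooth f ->
  is_derive t 1 (slice i x f) (slice i x (partial i f) t).
Proof.
move=> sf; rewrite /slice upd_line; under eq_fun do rewrite upd_line.
by apply: is_derive_along => y; exact: (sf [::]).2.
Qed.

(** The empty word bounds [f] and the word [x_i x_i] bounds [t^2 f]; together they bound
    [(1 + t^2) f]. *)
Lemma slice_decays i x f c : smooth f -> wbound 2 c f -> decays (c *+ 2) (slice i x f).
Proof.
move=> sf Bf; split; first exact: is_derive_cont (fun t => slice_is_derive i x t sf).
move=> t; rewrite ler_pdivlMr ?oneDsqr_gt0// oneDsqrE mulrDr mulr1 mulr2n.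
apply: lerD; first exact: (Bf [::]).
have := Bf [:: (true, i); (true, i)] isT (upd i x t).
by rewrite /= /act /= upd_i !normrM -[t ^+ 2]real_normK ?num_real// expr2 mulrA [leLHS]mulrC.
Qed.

Lemma slice_mul i x f t : slice i x (act (true, i) f) t = t * slice i x f t.
Proof. by rewrite /slice /act /= upd_i. Qed.

Lemma wbound_act m l c f : wbound m.+1 c f -> wbound m c (act l f).
Proof. by move=> Bf; apply: (@wbound_wd _ _ m [:: l]); rewrite addn1. Qed.

(** Length 4 is two letters for the second derivative and two for its decay. *)
Lemma slice_nice i x f c : smooth f -> wbound 4 c f ->
  nice (c *+ 2) (slice i x f) (slice i x (partial i f))
    (slice i x (partial i (partial i f))).
Proof.
move=> sf Bf; have sp := smooth_partials [:: i] sf.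
have spp := smooth_partials [:: i; i] sf.
have B3 l : wbound 3 c (act l f) := wbound_act l Bf.
have B2 : wbound 2 c (act (false, i) (act (false, i) f)) := wbound_act _ (B3 _).
split.
- by apply: slice_decays sf _; exact: wbound_leq Bf.
- rewrite (_ : (fun t => _) = slice i x (act (true, i) f)); last first.
    by apply/funext => t; rewrite slice_mul.
  by apply: slice_decays; [exact: smooth_act|exact: wbound_leq (B3 (true, i))].
- by apply: slice_decays sp _; exact: wbound_leq (B3 (false, i)).
- exact: slice_decays spp B2.
- split=> t; [exact: slice_is_derive sf|exact: slice_is_derive sp].
Qed.

Lemma schw_nice i x f : schw f -> exists c,
  nice c (slice i x f) (slice i x (partial i f)) (slice i x (partial i (partial i f))).
Proof.
by move=> gf; have [c Bf] := schw_wbound 4 gf; exists (c *+ 2); exact: slice_nice gf.1 Bf.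
Qed.

Definition ptr i th f x : R := costr th (slice i x f) (x 0 i).

Lemma ptr_le i th f x c : smooth f -> wbound 2 c f -> `|ptr i th f x| <= c *+ 2 * pi.
Proof. by move=> sf Bf; apply: costr_le; exact: slice_decays sf Bf. Qed.

Lemma ptr_mul_eq i th f x : schw f ->
  x 0 i * ptr i th f x = ptr i (th + pi / 2) (partial i f) x.
Proof.
move=> gf; have [c [df _ d1 _ [D1 _]]] := schw_nice i x gf.
exact: (costr_ibp _ _ df d1 D1).
Qed.

Lemma ptr_mul_neq i j th f x : j != i -> schw f ->
  x 0 j * ptr i th f x = ptr i th (act (true, j) f) x.
Proof.
move=> ji gf; have [c [df _ _ _ _]] := schw_nice i x gf.
rewrite /ptr -(costrZ _ _ _ df); congr costr; apply/funext => t.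
by rewrite /slice /act /= upd_j.
Qed.

Lemma ptr_derive_eq i th f x : schw f ->
  is_derive x (ev i) (ptr i th f) (ptr i (th + pi / 2) (act (true, i) f) x).
Proof.
move=> gf; have [c [df dtf _ _ _]] := schw_nice i x gf.
rewrite -[X in is_derive X](addr0 x) -[X in _ + X](scale0r (ev i)).
apply/is_derive_line.
(* The slice does not depend on [x_i], which enters only as the frequency. *)
have e : (fun r => ptr i th f (x + r *: ev i)) = (fun r => costr th (slice i x f) (r + x 0 i)).
  apply/funext => r; rewrite /ptr upd_add_eq [x 0 i + r]addrC; congr costr.
  by apply/funext => t; rewrite /slice upd_add_i.
rewrite e; apply: is_derive_shift1; rewrite add0r.
apply: is_derive_eq (costr_derive th (x 0 i) df dtf) _.
by rewrite /ptr; congr costr; apply/funext => t; rewrite slice_mul.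
Qed.

(** Differentiation under the integral sign; the majorant uses words of length 3, one letter for
    [D_j] and two for the decay in [t]. *)
Lemma ptr_derive_neq i j th f x : j != i -> schw f ->
  is_derive x (ev j) (ptr i th f) (ptr i th (partial j f) x).
Proof.
move=> ji gf; have sf := gf.1; have [c Bf] := schw_wbound 3 gf.
rewrite -[X in is_derive X](addr0 x) -[X in _ + X](scale0r (ev j)).
apply/is_derive_line.
have e : (fun r => ptr i th f (x + r *: ev j)) =
    (fun r => \int[mu]_t (f (upd i x t + r *: ev j) * cos (t * x 0 i + th)))%R.
  apply/funext => r; rewrite /ptr (upd_add_neq x r ji).
  by apply: eq_Rintegral => t _; rewrite /slice upd_add_j.
rewrite e.
have -> : ptr i th (partial j f) x =
    (\int[mu]_t (partial j f (upd i x t + 0 *: ev j) * cos (t * x 0 i + th)))%R.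
  by apply: eq_Rintegral => t _; rewrite scale0r addr0.
have sl r g t : g (upd i x t + r *: ev j) = slice i (x + r *: ev j) g t.
  by rewrite /slice upd_add_j.
apply: (@int_is_derive _ (fun r t => f (upd i x t + r *: ev j) * cos (t * x 0 i + th))
  (fun r t => partial j f (upd i x t + r *: ev j) * cos (t * x 0 i + th))
  (fun t => c *+ 2 / oneDsqr t)).
- move=> r; have := slice_decays i (x + r *: ev j) sf (wbound_leq _ Bf).
  move=> /(_ isT) /(costr_decays (x 0 i) th) /decays_integrable.
  by under [in X in X -> _]eq_fun do rewrite -sl.
- exact: integrable_oneDsqrV.
- move=> r t; have h := is_derive_along (upd i x t) r (fun y => (sf [::]).2 y j).
  have {}h := is_deriveZ (cos (t * x 0 i + th)) h.
  rewrite (_ : (fun r => _) = cos (t * x 0 i + th) \*: (fun r => f (upd i x t + r *: ev j))).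
    by apply: is_derive_eq h _; exact: mulrC.
  by apply/funext => s; exact: mulrC.
- move=> r t; rewrite sl.
  have := slice_decays i (x + r *: ev j) (smooth_act (false, j) sf) (wbound_act _ Bf).
  by move=> /(costr_decays (x 0 i) th) [_]; apply.
Qed.

Definition swap i l := if l.2 == i then (~~ l.1, i) else l.

Lemma act_ptr i th l f : schw f ->
  act l (ptr i th f) = ptr i (if l.2 == i then th + pi / 2 else th) (act (swap i l) f).
Proof.
move=> gf; case: l => [b j]; rewrite /swap /=; have [->|ji] := eqVneq j i.
  case: b; rewrite /act /=; apply/funext => x; first exact: ptr_mul_eq.
  exact/partial_val/ptr_derive_eq.
case: b; rewrite /act /=; apply/funext => x; first exact: ptr_mul_neq.
exact/partial_val/ptr_derive_neq.
Qed.

Lemma ptr_derivable i th j f x : schw f -> derivable (ptr i th f) x (ev j).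
Proof.
move=> gf; have [->|ji] := eqVneq j i.
  by have [] := ptr_derive_eq i th x gf.
by have [] := ptr_derive_neq th x ji gf.
Qed.

(** The partial derivatives are transforms again, hence bounded, and [is_derive_bounded_continuous]
    applies. *)
Lemma ptr_continuous i th f : schw f -> continuous (ptr i th f).
Proof.
move=> gf; have [c Bf] := schw_wbound 3 gf.
apply: (@is_derive_bounded_continuous _ _ _ (fun j => partial j (ptr i th f)) (c *+ 2 * pi)).
  by move=> j x; apply: partial_is_derive; exact: ptr_derivable.
move=> j x; rewrite -[partial j _]/(act (false, j) _) act_ptr//.
by apply: ptr_le; [exact: smooth_act gf.1|exact: wbound_act _ Bf].
Qed.

Lemma ptr_smooth i th f : schw f -> smooth (ptr i th f).
Proof.
(* All phases and all Schwartz functions are taken together, as a partial derivative may change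
   both. *)
move=> gf; pose A := [set h | exists th f, schw f /\ h = ptr i th f].
apply: (@smooth_coind _ _ A); last by exists th, f.
move=> _ [{}th [{}f [{}gf ->]]]; split; first exact: ptr_continuous.
move=> j; split=> [x|]; first exact: ptr_derivable.
rewrite -[partial j _]/(act (false, j) _) act_ptr//.
by eexists; eexists; split; [|reflexivity]; exact: schw_act.
Qed.

Lemma wd_ptr i th w f : schw f ->
  exists th' w', size w' = size w /\ wd w (ptr i th f) = ptr i th' (wd w' f).
Proof.
move=> gf; elim: w => [|l w [th' [w' [sw e]]]]; first by exists th, [::].
have gw : schw (wd w' f) by elim: (w') => [//|k v IH]; exact: schw_act.
eexists; exists (swap i l :: w'); split; first by rewrite /= sw.
by rewrite /= e act_ptr.
Qed.

(** A word keeps its length when it passes through the transform; the two extra letters provide the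
    decay that makes the integral converge. *)
Lemma ptr_wbound i th m c f : schw f -> wbound (m + 2) c f ->
  wbound m (c *+ 2 * pi) (ptr i th f).
Proof.
move=> gf Bf w wm x; have [th' [w' [sw ->]]] := wd_ptr i th w gf.
apply: ptr_le; first exact: smooth_wd gf.1.
by apply: wbound_wd; apply: wbound_leq Bf; rewrite sw addnC leq_add2r.
Qed.

Lemma ptr_schw i th f : schw f -> schw (ptr i th f).
Proof.
move=> gf; apply: wbound_schw; first exact: ptr_smooth.
by move=> m; have [c Bf] := schw_wbound (m + 2) gf; eexists; exact: ptr_wbound Bf.
Qed.

Lemma ptr_lin i th (a b : R) f g : schw f -> schw g ->
  ptr i th (fun x => a * f x + b * g x) = (fun x => a * ptr i th f x + b * ptr i th g x).
Proof.
move=> gf gg; apply/funext => x.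
have [c [df _ _ _ _]] := schw_nice i x gf; have [d [dg _ _ _ _]] := schw_nice i x gg.
by rewrite /ptr -(costrZ _ _ _ df) -(costrZ _ _ _ dg) -(costrD _ _ (decaysZ a df) (decaysZ b dg)).
Qed.

Lemma ptr_ptr i th th' f x : ptr i th (ptr i th' f) x =
  (\int[mu]_s (costr th' (slice i x f) s * cos (s * x 0 i + th)))%R.
Proof.
by apply: eq_Rintegral => s _; rewrite {1}/slice {1}/ptr slice_upd upd_i.
Qed.

Lemma ptr_inversion i f x : schw f ->
  ptr i 0 (ptr i 0 f) x + ptr i (- (pi / 2)) (ptr i (- (pi / 2)) f) x = 2 * pi * f x.
Proof.
move=> gf; have [c nf] := schw_nice i x gf.
have := int_costr_inversion (x 0 i) nf; rewrite /slice upd_id => <-.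
rewrite !ptr_ptr -RintegralD//.
- by apply: eq_Rintegral => s _; rewrite addr0 (mulrC s) [_ * cos _]mulrC [X in _ + X = _]mulrC.
- exact: decays_integrable (costr_decays _ _ (nice_costr _ nf)).
- exact: decays_integrable (costr_decays _ _ (nice_costr _ nf)).
Qed.

Lemma ptr_sin_cos i f x : schw f -> ptr i (- (pi / 2)) (ptr i 0 f) x = 0.
Proof.
move=> gf; have [c nf] := schw_nice i x gf; rewrite ptr_ptr.
apply: (etrans _ (int_costr_sin (x 0 i) nf)).
by apply: eq_Rintegral => s _; rewrite [RHS]mulrC (mulrC (x 0 i)).
Qed.

Lemma ptr_cos_sin i f x : schw f -> ptr i 0 (ptr i (- (pi / 2)) f) x = 0.
Proof.
move=> gf; have [c nf] := schw_nice i x gf; rewrite ptr_ptr.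
apply: (etrans _ (int_costr_cos (x 0 i) nf)).
by apply: eq_Rintegral => s _; rewrite addr0 [RHS]mulrC (mulrC (x 0 i)).
Qed.

End partial_transform.

(** * Complex Fourier transforms in one of several variables *)

Section complex_transform.
Local Open Scope complex_scope.
Context {R : realType}.
Implicit Types (n m : nat) (e : R).

Definition cschw n (xi : 'rV[R]_n -> R[i]) :=
  schw (@complex.Re R \o xi) /\ schw (@complex.Im R \o xi).

Definition cbound n m (c : R) (xi : 'rV[R]_n -> R[i]) :=
  wbound m c (@complex.Re R \o xi) /\ wbound m c (@complex.Im R \o xi).

(* Fourier transform in the [i]-th variable with kernel [exp(e 'i t x_i)], for
   [e = 1] or [e = -1]; recall that [sin t = cos (t - pi / 2)]. *)
Definition cptr n e (i : 'I_n) (xi : 'rV[R]_n -> R[i]) : 'rV[R]_n -> R[i] := fun x =>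
  (ptr i 0 (@complex.Re R \o xi) x - e * ptr i (- (pi / 2)) (@complex.Im R \o xi) x) +i*
  (ptr i 0 (@complex.Im R \o xi) x + e * ptr i (- (pi / 2)) (@complex.Re R \o xi) x).

Definition cptrs n e (s : seq 'I_n) xi := foldr (cptr e) xi s.

Lemma complex_eta (z : R[i]) : z = complex.Re z +i* complex.Im z.
Proof. by case: z. Qed.

Lemma cptr_Re n e (i : 'I_n) xi : @complex.Re R \o cptr e i xi =
  (fun x => 1 * ptr i 0 (@complex.Re R \o xi) x +
            (- e) * ptr i (- (pi / 2)) (@complex.Im R \o xi) x).
Proof. by apply/funext => x; rewrite mul1r mulNr. Qed.

Lemma cptr_Im n e (i : 'I_n) xi : @complex.Im R \o cptr e i xi =
  (fun x => 1 * ptr i 0 (@complex.Im R \o xi) x +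
            e * ptr i (- (pi / 2)) (@complex.Re R \o xi) x).
Proof. by apply/funext => x; rewrite mul1r. Qed.

Lemma cptr_cschw n e (i : 'I_n) xi : cschw xi -> cschw (cptr e i xi).
Proof.
move=> [gr gi]; split; rewrite ?cptr_Re ?cptr_Im.
  exact: schw_lin (ptr_schw _ _ gr) (ptr_schw _ _ gi).
exact: schw_lin (ptr_schw _ _ gi) (ptr_schw _ _ gr).
Qed.

Lemma cptrs_cschw n e (s : seq 'I_n) xi : cschw xi -> cschw (cptrs e s xi).
Proof. by move=> gx; elim: s => [//|i s IH]; exact: cptr_cschw. Qed.

Lemma cptr_bound n e (i : 'I_n) m c xi : `|e| = 1 -> cschw xi ->
  cbound (m + 2) c xi -> cbound m (c *+ 4 * pi) (cptr e i xi).
Proof.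
move=> e1 [gr gi] [Br Bi]; split; rewrite ?cptr_Re ?cptr_Im.
- have := wbound_lin 1 (- e) (ptr_smooth i 0 gr) (ptr_smooth i (- (pi / 2)) gi)
    (ptr_wbound i _ gr Br) (ptr_wbound i _ gi Bi).
  by apply: wbound_le; rewrite normr1 normrN e1; lra.
- have := wbound_lin 1 e (ptr_smooth i 0 gi) (ptr_smooth i (- (pi / 2)) gr)
    (ptr_wbound i _ gi Bi) (ptr_wbound i _ gr Br).
  by apply: wbound_le; rewrite normr1 e1; lra.
Qed.

(** Each partial transform costs two letters and a factor [4 pi]; [p] and [C] are uniform in [xi],
    as continuity requires. *)
Lemma cptrs_bound n e (s : seq 'I_n) m : `|e| = 1 -> exists p C, forall c xi,
  cschw xi -> cbound p c xi -> cbound m (C * c) (cptrs e s xi).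
Proof.
move=> e1; elim: s m => [m|i s IH m]; first by exists m, 1 => c xi _; rewrite mul1r.
have [p [C H]] := IH (m + 2)%N; exists p, (C *+ 4 * pi) => c xi gx Bx /=.
rewrite (_ : C *+ 4 * pi * c = (C * c) *+ 4 * pi); last by ring.
apply: (cptr_bound i e1); first exact: cptrs_cschw.
exact: H.
Qed.

(** If [C] and [S] are the transforms with phases [0] and [- pi / 2], then [cptr e] is [C + e 'i S].
    In the product with [C - e 'i S] the cross terms [C S] and [S C] vanish and [C C + S S] is
    [2 pi]. *)
Lemma cptr_inv n e (i : 'I_n) xi : e ^+ 2 = 1 -> cschw xi ->
  cptr (- e) i (cptr e i xi) = (fun x => (2 * pi)%:C * xi x).
Proof.
move=> e1 [gr gi]; apply/funext => x; rewrite [xi x in RHS]complex_eta /cptr.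
rewrite -/(cptr e i xi) cptr_Re cptr_Im.
have [r0 rs] : schw (ptr i 0 (@complex.Re R \o xi)) /\
    schw (ptr i (- (pi / 2)) (@complex.Re R \o xi)).
  by split; exact: ptr_schw.
have [i0 is_] : schw (ptr i 0 (@complex.Im R \o xi)) /\
    schw (ptr i (- (pi / 2)) (@complex.Im R \o xi)).
  by split; exact: ptr_schw.
rewrite (ptr_lin _ _ _ _ r0 is_) (ptr_lin _ _ _ _ i0 rs).
rewrite (ptr_lin _ _ _ _ r0 is_) (ptr_lin _ _ _ _ i0 rs).
rewrite (ptr_sin_cos i x gr) (ptr_sin_cos i x gi) (ptr_cos_sin i x gr) (ptr_cos_sin i x gi).
have Ir := ptr_inversion i x gr; have Ii := ptr_inversion i x gi.
apply/eqP; rewrite eq_complex /= !mul0r subr0 addr0 -Ir -Ii.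
move: (ptr _ _ _ x) (ptr _ _ _ x) (ptr _ _ _ x) (ptr _ _ _ x) => a b c d.
by apply/andP; split; apply/eqP; ring: e1.
Qed.

End complex_transform.

(** * The Fourier transform as a composition of partial transforms *)
Section slicing.
Context {R : realType} {n : nat}.
Local Open Scope complex_scope.
Implicit Types (f g : 'rV[R]_n.+1 -> R) (i j : 'I_n) (y : 'rV[R]_n) (a t th : R).
Local Notation ev i := (delta_mx 0 i).

(** The splitting of coordinates in the recursion of [iint], whose outer variable is thus the
    coordinate [ord0]. *)
Definition cons_rv a y : 'rV[R]_n.+1 := row_mx a%:M y.

Lemma cons_rv0 a y : cons_rv a y 0 ord0 = a.
Proof.
have -> : (ord0 : 'I_n.+1) = lshift n (ord0 : 'I_1) by exact: val_inj.
by rewrite /cons_rv (@row_mxEl R 1 1 n) mxE eqxx mulr1n.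
Qed.

Lemma cons_rvS a y i : cons_rv a y 0 (lift ord0 i) = y 0 i.
Proof.
have -> : lift ord0 i = rshift 1 i by exact: val_inj.
exact: (@row_mxEr R 1 1 n).
Qed.

Lemma rV_eqS (u v : 'rV[R]_n.+1) : u 0 ord0 = v 0 ord0 ->
  (forall i, u 0 (lift ord0 i) = v 0 (lift ord0 i)) -> u = v.
Proof.
by move=> h0 hS; apply/rowP => j; case: (unliftP ord0 j) => [k ->|->].
Qed.

Lemma cons_rv_line a y i (r : R) :
  cons_rv a (y + r *: ev i) = cons_rv a y + r *: ev (lift ord0 i).
Proof.
apply: rV_eqS => [|k].
  by rewrite cons_rv0 [RHS]mxE cons_rv0 2!mxE (negbTE (neq_lift _ _)) andbF mulr0 addr0.
rewrite cons_rvS mxE [in RHS]mxE cons_rvS; congr (_ + _).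
by rewrite !mxE (inj_eq lift_inj).
Qed.

Lemma upd_cons_rv a y i t : upd (lift ord0 i) (cons_rv a y) t = cons_rv a (upd i y t).
Proof. by rewrite /upd cons_rvS cons_rv_line. Qed.

Lemma upd0_cons_rv (x : 'rV[R]_n.+1) t :
  upd ord0 x t = cons_rv t (\row_i x 0 (lift ord0 i)).
Proof.
apply: rV_eqS => [|i]; first by rewrite upd_i cons_rv0.
by rewrite upd_j// cons_rvS mxE.
Qed.

Lemma ptr_cons_rv i th f a y :
  ptr i th (fun y => f (cons_rv a y)) y = ptr (lift ord0 i) th f (cons_rv a y).
Proof.
rewrite /ptr cons_rvS; congr costr; apply/funext => t.
by rewrite /slice upd_cons_rv.
Qed.

Lemma cons_rv_is_derive f a y i : smooth f ->
  is_derive y (ev i) (fun y => f (cons_rv a y)) (partial (lift ord0 i) f (cons_rv a y)).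
Proof.
move=> sf; rewrite -[X in is_derive X](addr0 y) -[X in _ + X](scale0r (ev i)).
apply/is_derive_line; under eq_fun do rewrite cons_rv_line.
have := is_derive_along (cons_rv a y) 0 (fun z => (sf [::]).2 z (lift ord0 i)).
by rewrite scale0r addr0.
Qed.

Lemma act_cons_rv (l : bool * 'I_n) f a : smooth f ->
  act l (fun y => f (cons_rv a y)) = (fun y => act (l.1, lift ord0 l.2) f (cons_rv a y)).
Proof.
case: l => [[] i] sf; rewrite /act /=; apply/funext => y; first by rewrite cons_rvS.
exact/partial_val/cons_rv_is_derive.
Qed.

Lemma cons_rv_continuous f a : schw f -> continuous (fun y => f (cons_rv a y)).
Proof.
move=> gf; have [c Bf] := schw_wbound 1 gf.
apply: (@is_derive_bounded_continuous _ _ _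
  (fun i y => partial (lift ord0 i) f (cons_rv a y)) c).
  by move=> i y; exact: cons_rv_is_derive gf.1.
by move=> i y; exact: (Bf [:: (false, lift ord0 i)]).
Qed.

Lemma schw_cons_rv f a : schw f -> schw (fun y => f (cons_rv a y)).
Proof.
move=> gf; pose A := [set h | exists f, schw f /\ h = (fun y => f (cons_rv a y))].
have dA i g : schw g -> partial i (fun y => g (cons_rv a y)) =
    (fun y => partial (lift ord0 i) g (cons_rv a y)).
  by move=> gg; apply/funext => y; exact/partial_val/(cons_rv_is_derive a y i gg.1).
split.
  apply: (@smooth_coind _ _ A); last by exists f.
  move=> _ [g [gg ->]]; split; first exact: cons_rv_continuous.
  move=> i; split=> [y|]; first by have [] := cons_rv_is_derive a y i gg.1.
  exists (partial (lift ord0 i) g); split; last exact: dA.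
  exact: (schw_act (false, lift ord0 i) gg).
move=> w; suff -> : wd w (fun y => f (cons_rv a y)) =
    (fun y => wd [seq (l.1, lift ord0 l.2) | l <- w] f (cons_rv a y)).
  by have [c Hc] := gf.2 [seq (l.1, lift ord0 l.2) | l <- w]; exists c => y.
elim: w => [//|l w /= ->]; rewrite act_cons_rv//; exact: smooth_wd gf.1.
Qed.

Lemma cschw_cons_rv (xi : 'rV[R]_n.+1 -> R[i]) a :
  cschw xi -> cschw (fun y => xi (cons_rv a y)).
Proof.
by move=> [gr gi]; split; [exact: (schw_cons_rv a gr)|exact: (schw_cons_rv a gi)].
Qed.

Lemma cptrs_cons_rv e (s : seq 'I_n) (xi : 'rV[R]_n.+1 -> R[i]) a :
  cptrs e s (fun y => xi (cons_rv a y)) =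
  (fun y => cptrs e [seq lift ord0 i | i <- s] xi (cons_rv a y)).
Proof.
elim: s => [//|i s /= ->]; apply/funext => y; rewrite /cptr /=.
by rewrite -!(ptr_cons_rv _ _ _ a y).
Qed.

End slicing.

(** * Linearity of the transforms, and evaluation of the iterated Fourier integral *)

Section fourier_formula.
Context {R : realType}.
Local Open Scope complex_scope.

Lemma Re_lin n (a b : R) (xi zeta : 'rV[R]_n -> R[i]) :
  @complex.Re R \o (fun x => (a +i* b) * xi x + zeta x) =
  (fun x => 1 * (a * (@complex.Re R \o xi) x + (- b) * (@complex.Im R \o xi) x) +
            1 * (@complex.Re R \o zeta) x).
Proof.
by apply/funext => x /=; rewrite !mul1r; case: (xi x) (zeta x) => [u v] [w z] /=; ring.
Qed.

Lemma Im_lin n (a b : R) (xi zeta : 'rV[R]_n -> R[i]) :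
  @complex.Im R \o (fun x => (a +i* b) * xi x + zeta x) =
  (fun x => 1 * (a * (@complex.Im R \o xi) x + b * (@complex.Re R \o xi) x) +
            1 * (@complex.Im R \o zeta) x).
Proof.
by apply/funext => x /=; rewrite !mul1r; case: (xi x) (zeta x) => [u v] [w z] /=; ring.
Qed.

Lemma cschw_lin n (c : R[i]) (xi zeta : 'rV[R]_n -> R[i]) :
  cschw xi -> cschw zeta -> cschw (fun x => c * xi x + zeta x).
Proof.
move=> [xr xi'] [zr zi]; case: c => a b; split; rewrite ?Re_lin ?Im_lin.
  exact: schw_lin (schw_lin _ _ xr xi') zr.
exact: schw_lin (schw_lin _ _ xi' xr) zi.
Qed.

Lemma cptr_lin n e (i : 'I_n) (c : R[i]) xi zeta : cschw xi -> cschw zeta ->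
  cptr e i (fun x => c * xi x + zeta x) = (fun x => c * cptr e i xi x + cptr e i zeta x).
Proof.
move=> [xr xi'] [zr zi]; case: c => a b; apply/funext => x.
rewrite /cptr Re_lin Im_lin.
have gr := schw_lin a (- b) xr xi'; have gi := schw_lin a b xi' xr.
rewrite !(ptr_lin _ _ _ _ gr zr) !(ptr_lin _ _ _ _ gi zi).
rewrite !(ptr_lin _ _ _ _ xr xi') !(ptr_lin _ _ _ _ xi' xr).
apply/eqP; rewrite eq_complex /=; apply/andP; split; apply/eqP; ring.
Qed.

Lemma cptrs_lin n e (s : seq 'I_n) (c : R[i]) xi zeta : cschw xi -> cschw zeta ->
  cptrs e s (fun x => c * xi x + zeta x) =
  (fun x => c * cptrs e s xi x + cptrs e s zeta x).
Proof.
move=> gx gz; elim: s => [//|i s /= ->].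
by rewrite cptr_lin//; exact: cptrs_cschw.
Qed.

Lemma schw0 n : schw (fun _ : 'rV[R]_n => 0 : R).
Proof.
split; first exact: smooth0.
have w0 w : wd w (fun _ : 'rV[R]_n => 0 : R) = (fun=> 0).
  elim: w => [//|[[] i] w /= ->]; rewrite /act /=; apply/funext => x.
    by rewrite mulr0.
  by rewrite /partial derive_cst.
by move=> w; exists 0 => x; rewrite w0 normr0.
Qed.

Lemma cschw0 n : cschw (fun _ : 'rV[R]_n => 0 : R[i]).
Proof. by split; exact: schw0. Qed.

Lemma cptrsZ n e (s : seq 'I_n) (c : R[i]) xi : cschw xi ->
  cptrs e s (fun x => c * xi x) = (fun x => c * cptrs e s xi x).
Proof.
move=> gx; have z0 : cptrs e s (fun=> 0) = (fun=> 0).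
  apply/funext => x; have := cptrs_lin e s (-1) (@cschw0 n) (@cschw0 n).
  rewrite (_ : (fun x => _ + 0) = (fun=> 0)); last by apply/funext=> y; rewrite mulr0 addr0.
  by move=> /(congr1 (fun f => f x)) ->; rewrite mulN1r addNr.
have := cptrs_lin e s c gx (@cschw0 n); rewrite z0.
by under eq_fun do rewrite addr0; move=> ->; apply/funext => x; rewrite addr0.
Qed.

Lemma cexp_i (t : R) : cexp ('i * t%:C) = cos t +i* sin t.
Proof.
rewrite /cexp /= !(mul0r, mul1r, mulr0, subr0, add0r, addr0, sub0r, oppr0) expR0.
by apply/eqP; rewrite eq_complex /= !(mul0r, mul1r, subr0, addr0) !eqxx.
Qed.

Lemma cexpD (s t : R) :
  cexp ('i * (s + t)%:C) = cexp ('i * s%:C) * cexp ('i * t%:C) :> R[i].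
Proof.
rewrite !cexp_i cosD sinD; apply/eqP; rewrite eq_complex /=.
by apply/andP; split; apply/eqP; ring.
Qed.

Lemma dot_cons_rv n a (y : 'rV[R]_n) (x : 'rV[R]_n.+1) :
  dot (cons_rv a y) x = a * x 0 ord0 + dot y (\row_i x 0 (lift ord0 i)).
Proof.
rewrite /dot big_ord_recl cons_rv0; congr (_ + _); apply: eq_bigr => i _.
by rewrite cons_rvS mxE.
Qed.

Lemma cptr_lead n (xi : 'rV[R]_n.+1 -> R[i]) (x : 'rV[R]_n.+1) : cschw xi ->
  let Z t := cexp ('i * (t * x 0 ord0)%:C) * xi (upd ord0 x t) in
  cptr 1 ord0 xi x = (\int[lebesgue_measure]_t complex.Re (Z t))%R +i*
                     (\int[lebesgue_measure]_t complex.Im (Z t))%R.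
Proof.
move=> [gr gi] /=; have [c [dr _ _ _ _]] := schw_nice ord0 x gr.
have [d [di _ _ _ _]] := schw_nice ord0 x gi.
have I C f th : decays C f -> _ := fun df => decays_integrable (costr_decays (x 0 ord0) th df).
rewrite /cptr !mul1r /ptr /costr -RintegralB//; try exact: I dr; try exact: I di.
rewrite -RintegralD//; try exact: I dr; try exact: I di.
by congr (_ +i* _); apply: eq_Rintegral => t _; rewrite cexp_i /slice /= addr0 cosBpihalf;
  case: (xi _) => u v /=; ring.
Qed.

(** Induction along the recursion of [iint]. For a fixed first variable the inner integral is a
    transform in the other variables, and the exponential in the first variable, constant there,
    passes through it by linearity; the outer integral is then [cptr_lead]. *)
Lemma cint_fourier n (xi : 'rV[R]_n -> R[i]) (x : 'rV[R]_n) : cschw xi ->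
  cint (fun y => xi y * cexp ('i * (dot y x)%:C)) = cptrs 1 (enum 'I_n) xi x.
Proof.
elim: n xi x => [|n IH] xi x gx.
  rewrite (_ : enum 'I_0 = [::]); last by apply/size0nil; rewrite size_enum_ord.
  have e y : cexp ('i * (dot y x)%:C) = 1 :> R[i].
    by rewrite /dot big_ord0 cexp_i cos0 sin0.
  by under eq_fun do rewrite e mulr1; rewrite /cint /= -complex_eta (thinmx0 x).
rewrite enum_ordSl /= cptr_lead; last exact: cptrs_cschw.
set Z := cptrs 1 _ _.
have H t : cint (fun y => xi (cons_rv t y) * cexp ('i * (dot (cons_rv t y) x)%:C)) =
    cexp ('i * (t * x 0 ord0)%:C) * Z (upd ord0 x t).
  have gc := cschw_cons_rv t gx.
  under eq_fun do rewrite dot_cons_rv cexpD mulrCA mulrA.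
  rewrite (IH (fun y => cexp ('i * (t * x 0 ord0)%:C) * xi (cons_rv t y))).
    by rewrite cptrsZ// cptrs_cons_rv upd0_cons_rv.
  have := cschw_lin (cexp ('i * (t * x 0 ord0)%:C)) gc (@cschw0 n).
  by under eq_fun do rewrite addr0.
rewrite /cint /=; congr (_ +i* _); by apply: eq_Rintegral => t _; rewrite -H.
Qed.

End fourier_formula.

(** * The Fourier transform on S, D and D_a *)
Section schwartz_space.
Context {R : realType} {n : nat}.
Local Open Scope complex_scope.
Implicit Types (xi zeta : 'rV[R]_n -> R[i]).

(** Reversing the list makes the inverse of the outermost partial transform act first, so the pairs
    cancel one variable at a time, each with a factor [2 pi]. *)
Lemma cptrs_inv e (s : seq 'I_n) xi : e ^+ 2 = 1 -> cschw xi ->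
  cptrs (- e) (rev s) (cptrs e s xi) = (fun x => ((2 * pi) ^+ size s)%:C * xi x).
Proof.
move=> e1 gx; elim: s => [|i s IH] /=; first by apply/funext => x; rewrite expr0 mul1r.
rewrite rev_cons /cptrs foldr_rcons -!/(cptrs _ _ _) cptr_inv//; last exact: cptrs_cschw.
rewrite cptrsZ; last exact: cptrs_cschw.
by rewrite IH; apply/funext => x; rewrite mulrA -rmorphM -exprS.
Qed.

Lemma twopiX_neq0 (k : nat) : ((2 * pi) ^+ k)%:C != 0 :> R[i].
Proof.
rewrite (inj_eq (@complexI R)) expf_neq0// mulf_neq0 ?pnatr_eq0//.
by rewrite gt_eqF// pi_gt0.
Qed.

Lemma modulus_Re_le (z : R[i]) : `|complex.Re z| <= modulus z.
Proof.
case: z => a b /=; rewrite /modulus /= -sqrtr_sqr ler_wsqrtr//.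
by rewrite lerDl sqr_ge0.
Qed.

Lemma modulus_Im_le (z : R[i]) : `|complex.Im z| <= modulus z.
Proof.
case: z => a b /=; rewrite /modulus /= -sqrtr_sqr ler_wsqrtr//.
by rewrite lerDr sqr_ge0.
Qed.

(** Words of length [p + p] occur since [k] and [q] may both have degree [p]; real and imaginary
    parts contribute one [c] each. *)
Lemma S_norm_cbound p c xi : cbound (p + p) c xi -> (S_norm p xi <= (c + c)%:E)%E.
Proof.
move=> [Br Bi]; apply: ge_ereal_sup => _ [x [k [q [kp qp ->]]]]; rewrite lee_fin.
rewrite (le_trans (modulus_le _))//= !mul0r subr0 addr0.
apply: lerD; first exact: (wbound_mbound Br).
exact: (wbound_mbound Bi).
Qed.

Lemma cbound_S_norm m : exists2 A : R, 0 <= A & forall xi c, csmooth xi -> 0 <= c ->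
  (S_norm m xi <= c%:E)%E -> cbound m (A * c) xi.
Proof.
have [A A0 H] := @mbound_wbound R n m; exists A => // xi c [sr si] c0 N.
have M k q x : (mdeg k <= m)%N -> (mdeg q <= m)%N ->
    modulus ((monom k x)%:C * mderiv q xi x) <= c.
  move=> km qm; rewrite -lee_fin (le_trans _ N)//.
  by apply: ereal_sup_ubound; exists x, k, q.
split; apply: H => // k q km qm x; apply: le_trans (M k q x km qm).
  by rewrite (le_trans _ (modulus_Re_le _))//= mul0r subr0.
by rewrite (le_trans _ (modulus_Im_le _))//= mul0r addr0.
Qed.

Lemma S_predP xi : reflect (cschw xi) (xi \in S_pred).
Proof.
apply: (iffP (asboolP _)) => [[sx Nx]|[gr gi]].
  have B m : exists c, cbound m c xi.
    have [A A0 H] := cbound_S_norm m.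
    have [c c0 Nc] : exists2 c : R, 0 <= c & (S_norm m xi <= c%:E)%E.
      case: (S_norm m xi) (Nx m) => [r _|//|_]; last by exists 0; rewrite ?leNye.
      by exists `|r|; rewrite ?lee_fin ?ler_norm.
    by exists (A * c); exact: H.
  by split; apply: wbound_schw => [|m]; [exact: sx.1|have [c []] := B m; exists c|
    exact: sx.2|have [c []] := B m; exists c].
split; first by split; [exact: gr.1|exact: gi.1].
move=> p; have [c Bc] := schw_wbound (p + p) gr; have [d Bd] := schw_wbound (p + p) gi.
have c0 := wbound_ge0 Bc; have d0 := wbound_ge0 Bd.
apply: le_lt_trans (ltry ((c + d) + (c + d))); apply: S_norm_cbound; split.
  by apply: wbound_le Bc; rewrite lerDl.
by apply: wbound_le Bd; rewrite lerDr.
Qed.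

Lemma S_cschw (xi : @schwartz R n) : cschw (S_fun xi).
Proof. by apply/S_predP; case: xi. Qed.

Lemma schwartz_nbhsP (xi : @schwartz R n) (A : set (@schwartz R n)) : nbhs xi A <->
  exists p (e : R), 0 < e /\ forall u : @schwartz R n, (S_norm p u < e%:E)%E -> A (xi + u).
Proof.
split=> [[U [p [e [e0 ->]]] H]|[p [e [e0 H]]]]; first by exists p, e.
by exists [set x : @schwartz R n | (S_norm p x < e%:E)%E] => //; exists p, e.
Qed.

Lemma schwartz_continuous (T : @schwartz R n -> @schwartz R n) :
  (forall xi zeta : @schwartz R n, T (xi + zeta) = T xi + T zeta) ->
  (forall m, exists p C, forall c (xi : @schwartz R n),
     cbound p c (S_fun xi) -> cbound m (C * c) (S_fun (T xi))) ->
  continuous T.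
Proof.
move=> TD TB xi A /schwartz_nbhsP[p [e [e0 H]]]; apply/schwartz_nbhsP.
have [q [C HC]] := TB (p + p)%N; have [B B0 HB] := cbound_S_norm q.
(* The seminorm of the image is at most [2 C B (e / K)]; the summand [1] makes [K] positive and the
   final inequality strict. *)
pose K := `|C| * B + `|C| * B + 1.
have K0 : 0 < K by rewrite ltr_wpDl// addr_ge0// mulr_ge0.
exists q, (e / K); split=> [|u uq]; first by rewrite divr_gt0.
have d0 : 0 < e / K by rewrite divr_gt0.
rewrite /= TD; apply: H.
have := S_norm_cbound (HC _ _ (HB _ _ (S_csmooth u) (ltW d0) (ltW uq))).
move=> /le_lt_trans; apply; rewrite lte_fin.
have eK : K * (e / K) = e by rewrite mulrC divfK// gt_eqF.
rewrite -[ltRHS]eK /K !mulrDl mul1r ltr_pwDr// lerD// -mulrA ler_wpM2r ?ler_norm//.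
  by rewrite mulr_ge0// ltW.
by rewrite mulr_ge0// ltW.
Qed.

Definition S_fourier (xi : @schwartz R n) : @schwartz R n :=
  MkSchwartz (introT (S_predP _) (cptrs_cschw 1 (enum 'I_n) (S_cschw xi))).

Lemma cschwZ (c : R[i]) xi : cschw xi -> cschw (fun x => c * xi x).
Proof.
move=> gx; have := cschw_lin c gx (@cschw0 R n).
by under eq_fun do rewrite addr0.
Qed.

Definition S_fourier_inv (xi : @schwartz R n) : @schwartz R n :=
  MkSchwartz (introT (S_predP _) (cschwZ ((2 * pi) ^+ n)%:C^-1
    (cptrs_cschw (-1) (rev (enum 'I_n)) (S_cschw xi)))).

Lemma S_ext (xi zeta : @schwartz R n) : S_fun xi =1 S_fun zeta -> xi = zeta.
Proof. by move=> e; apply: val_inj; apply/funext. Qed.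

Lemma S_fourierK : cancel S_fourier S_fourier_inv.
Proof.
move=> xi; apply: S_ext => x /=; rewrite cptrs_inv ?expr1n//; last exact: S_cschw.
by rewrite size_enum_ord mulrA mulVf ?mul1r// twopiX_neq0.
Qed.

Lemma S_fourier_invK : cancel S_fourier_inv S_fourier.
Proof.
move=> xi; apply: S_ext => x /=; rewrite cptrsZ; last exact: cptrs_cschw (S_cschw _).
have := @cptrs_inv (-1) (rev (enum 'I_n)) xi; rewrite opprK revK size_rev size_enum_ord.
rewrite sqrrN expr1n => ->//; last exact: S_cschw.
by rewrite mulrA mulVf ?mul1r// twopiX_neq0.
Qed.

Lemma S_fourier_linear : linear S_fourier.
Proof.
move=> c xi zeta; apply: S_ext => x.
exact: (congr1 (fun f => f x) (cptrs_lin 1 (enum 'I_n) c (S_cschw xi) (S_cschw zeta))).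
Qed.

Lemma cboundZ m (k : R) c xi : cschw xi -> cbound m c xi ->
  cbound m (`|k| * c) (fun x => k%:C * xi x).
Proof.
move=> [gr gi] [Br Bi]; split.
- rewrite (_ : _ \o _ = (fun x => k * (@complex.Re R \o xi) x + 0 * (@complex.Im R \o xi) x)).
    by have := wbound_lin k 0 gr.1 gi.1 Br Bi; rewrite normr0 mul0r addr0.
  by apply/funext => x /=; case: (xi x) => u v /=; rewrite !mul0r ?subr0 ?addr0.
- rewrite (_ : _ \o _ = (fun x => k * (@complex.Im R \o xi) x + 0 * (@complex.Re R \o xi) x)).
    by have := wbound_lin k 0 gi.1 gr.1 Bi Br; rewrite normr0 mul0r addr0.
  by apply/funext => x /=; case: (xi x) => u v /=; rewrite !mul0r ?subr0 ?addr0.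
Qed.

Lemma S_fourier_continuous : continuous S_fourier.
Proof.
apply: schwartz_continuous => [xi zeta|m].
  by have := S_fourier_linear 1 xi zeta; rewrite !scale1r.
have [p [C H]] := @cptrs_bound R n 1 (enum 'I_n) m (normr1 _).
by exists p, C => c xi; exact: H (S_cschw _).
Qed.

Lemma S_fourier_inv_continuous : continuous S_fourier_inv.
Proof.
apply: schwartz_continuous => [xi zeta|m].
  apply: (can_inj S_fourierK); rewrite S_fourier_invK.
  have := S_fourier_linear 1 (S_fourier_inv xi) (S_fourier_inv zeta).
  by rewrite !scale1r !S_fourier_invK.
have [p [C H]] := @cptrs_bound R n (-1) (rev (enum 'I_n)) m (normrN1 _).
exists p, (`|((2 * pi) ^+ n)^-1| * C) => c xi Bx; rewrite -mulrA.
have := cboundZ ((2 * pi) ^+ n)^-1 (cptrs_cschw _ _ (S_cschw xi)) (H _ _ (S_cschw xi) Bx).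
by rewrite fmorphV.
Qed.

Lemma fourier_S_fourier (xi : @schwartz R n) : fourier_S xi = S_fun (S_fourier xi).
Proof. by apply/funext => x; rewrite /fourier_S /fourier cint_fourier//; exact: S_cschw. Qed.

End schwartz_space.

(** * Compactly supported functions: membership in S and injectivity of F *)

Section compact_support.
Context {R : realType} {n : nat}.
Local Open Scope complex_scope.
Implicit Types (f : 'rV[R]_n -> R) (xi : 'rV[R]_n -> R[i]).

Lemma enorm_continuous : continuous (@enorm R n).
Proof.
apply: (comp_continuous _ (@sqrt_continuous R)).
apply: (continuous_big (op := +%R) (P := xpredT)) => [|i _].
  by move=> x; exact: add_continuous.
exact: (comp_continuous (@coord_continuous R 1 n 0 i) (@exprn_continuous R 2)).
Qed.

(** The set [a < enorm x] is open and [f] is zero on it, so every word vanishes there; elsewhere a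
    word is bounded by continuity on a compact ball of the sup norm, which is at most [enorm]. *)
Lemma schw_compact (a : R) f : smooth f -> (forall x, a < enorm x -> f x = 0) -> schw f.
Proof.
move=> sf f0; split=> // w.
have w0 x : a < enorm x -> wd w f x = 0.
  elim: w x => [//|[[] i] w IH] x ax; rewrite /= /act /=; first by rewrite IH// mulr0.
  rewrite /partial (@near_eq_derive _ _ _ (wd w f) (cst 0)) ?derive_cst//.
  have : \forall y \near x, a < enorm y.
    exact: (cvgr_gt (enorm x) (@enorm_continuous x)).
  by apply: filterS => y; exact: IH.
pose K := [set x : 'rV[R]_n | `|x| <= a].
have cK : compact K.
  apply: bounded_closed_compact.
    exists a; split; first exact: num_real.
    by move=> M aM x /= xa; rewrite (le_trans xa)// ltW.
  have -> : K = Num.norm @^-1` [set y | y <= a] by [].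
  by apply: preimage_closed => [x _|]; [exact: norm_continuous|exact: closed_le].
have [M [_ fM]] : bounded_set (wd w f @` K).
  apply/compact_bounded/continuous_compact => //; apply: continuous_subspaceT.
  exact: (smooth_wd w sf [::]).1.
exists (`|M| + 1) => x; have [ax|xa] := ltP a (enorm x).
  by rewrite w0// normr0 addr_ge0.
apply: (fM (`|M| + 1)); first by rewrite (le_lt_trans (ler_norm _))// ltrDl.
by exists x => //; rewrite /K/= (le_trans (normr_le_enorm x)).
Qed.

Lemma D_cschw xi : xi \in D_pred -> cschw xi.
Proof.
move=> /asboolP[m _ /asboolP[[sr si] x0]]; split.
  by apply: (schw_compact (a := m%:R)) => // x /x0 /= ->.
by apply: (schw_compact (a := m%:R)) => // x /x0 /= ->.
Qed.

Lemma fourier_laplace_real xi (sigma : 'rV[R]_n) :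
  fourier_laplace xi (map_mx (real_complex R) sigma) = fourier xi sigma.
Proof.
rewrite /fourier_laplace /fourier /=; congr cint; apply/funext => x.
have -> : map_mx (@complex.Re R) (map_mx (real_complex R) sigma) = sigma.
  by apply/rowP => i; rewrite !mxE.
have -> : map_mx (@complex.Im R) (map_mx (real_complex R) sigma) = 0.
  by apply/rowP => i; rewrite !mxE.
have -> : dot x 0 = 0 by rewrite /dot big1// => i _; rewrite mxE mulr0.
by rewrite subr0.
Qed.

Lemma fourier_laplace_inj xi zeta : xi \in D_pred -> zeta \in D_pred ->
  fourier_laplace xi = fourier_laplace zeta -> xi = zeta.
Proof.
move=> /D_cschw gx /D_cschw gz e.
have {}e : cptrs 1 (enum 'I_n) xi = cptrs 1 (enum 'I_n) zeta.
  apply/funext => x; rewrite -!cint_fourier// -!/(fourier _ x) -!fourier_laplace_real.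
  by rewrite e.
have := cptrs_inv (enum 'I_n) (expr1n _ 2) gx; rewrite e cptrs_inv ?expr1n// => h.
apply/funext => x; have := congr1 (fun f : 'rV[R]_n -> R[i] => f x) (esym h).
exact: (mulfI (@twopiX_neq0 R _)).
Qed.

End compact_support.

(** * Transport of demi-distributions along a linear homeomorphism *)

Section transport.
Context {R : realType} {E FE : topologicalLmodType R[i]} {W : Type}.
Local Open Scope complex_scope.

(** [Phi] is [F] with values in the topological space [FE]; the last hypothesis covers both a
    transported range and S itself. The factor [(2 pi)^n] commutes with [r] and [s], so the same
    scalars serve on both sides. *)
Lemma fourier_demi_transport (n : nat) (F : E -> W) (v : FE -> W)
    (Phi : E -> FE) (Psi : FE -> E) (gamma : R[i] -> R[i]) (U : set E) :
  linear Phi -> cancel Phi Psi -> cancel Psi Phi -> continuous Phi -> continuous Psi ->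
  (forall xi z, F xi = v z <-> z = Phi xi) ->
  [set fourier_demi n F v f | f in demi gamma U] = demi gamma (fourier_set F v U).
Proof.
move=> lPhi PhiK PsiK cPhi cPsi FP.
pose k : R[i] := ((2 * pi) ^+ n)%:C; have k0 : k != 0 by exact: twopiX_neq0.
have lP c x y : Phi (c *: x + y) = c *: Phi x + Phi y by exact: lPhi.
have lPsi c x y : Psi (c *: x + y) = c *: Psi x + Psi y.
  by apply: (can_inj PhiK); rewrite PsiK lP !PsiK.
have Phi0 : Phi 0 = 0.
  by have := lP (-1) 0 0; rewrite scaler0 addr0 scaleN1r addNr.
have Psi0 : Psi 0 = 0 by rewrite -Phi0 PhiK.
have FV z : fourier_inv F v z = Psi z.
  rewrite /fourier_inv; apply: xget_unique => /=; first by apply/FP; rewrite PsiK.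
  by move=> y /FP ->; rewrite PhiK.
have FD f : fourier_demi n F v f = (fun z => k * f (Psi z)).
  by apply/funext => z; rewrite /fourier_demi FV.
have cM (T : topologicalType) (c : R[i]) (h : T -> R[i]^o) :
    continuous h -> continuous (fun x => c * h x : R[i]^o).
  by move=> ch x; apply: cvgMl_tmp; exact: ch.
apply/seteqP; split=> [_ [f [cf f0 Hf] <-]|g [cg g0 Hg]].
  rewrite FD; split.
  - apply: cM; exact: comp_continuous cPsi cf.
  - by rewrite Psi0 f0 mulr0.
  - move=> x u t [xi Uxi /FP ->] t1; have [r [s [rt st e]]] := Hf (Psi x) xi t Uxi t1.
    exists r, s; split=> //; rewrite addrC lPsi PhiK [_ + Psi x]addrC e.
    by rewrite mulrDr mulrCA [k * (s * _)]mulrCA.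
exists (fun xi => k^-1 * g (Phi xi)).
  split.
  - apply: cM; exact: comp_continuous cPhi cg.
  - by rewrite Phi0 g0 mulr0.
  - move=> x u t Uu t1.
    have FU : fourier_set F v U (Phi u) by exists u => //; exact/FP.
    have [r [s [rt st e]]] := Hg (Phi x) (Phi u) t FU t1.
    exists r, s; split=> //; rewrite addrC lP [_ + Phi x]addrC e.
    by rewrite mulrDr mulrCA [k^-1 * (s * _)]mulrCA.
by rewrite FD; apply/funext => z; rewrite PsiK mulrA mulfV// mul1r.
Qed.

End transport.

(** Translation carries continuity from [0] to every point; this fits [lrange], whose topology is
    given by neighbourhoods of [0]. *)
Lemma additive_continuous0 (R : realType) (X Y : topologicalLmodType R[i]) (T : X -> Y) :
  (forall x y, T (x + y) = T x + T y) ->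
  (forall A, nbhs (0 : Y) A -> nbhs (0 : X) (T @^-1` A)) -> continuous T.
Proof.
move=> TD T0 x A; have T00 : T 0 = 0.
  by have := TD 0 0; rewrite addr0 => /eqP; rewrite -subr_eq subrr eq_sym => /eqP.
have nbhs_shift (Z : topologicalLmodType R[i]) (y z : Z) (B : set Z) :
    nbhs (y + z) B -> nbhs z [set w | B (y + w)].
  move=> yB; have /(_ B) := @add_continuous Z (y, z).
  move=> /(_ yB) [[P Q] /= [Py Qz] PQ]; apply: filterS Qz => w Qw.
  by apply: (PQ (y, w)); split => //=; exact: nbhs_singleton Py.
move=> TA; have : nbhs (0 : Y) [set w | A (T x + w)] by apply: nbhs_shift; rewrite addr0.
move=> /T0 H; have /nbhs_shift : nbhs (- x + x) (T @^-1` [set w | A (T x + w)]).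
  by rewrite addNr.
by apply: filterS => y /=; rewrite -TD addrA subrr add0r.
Qed.

(** * The range of an injective linear map with the transported topology *)

Section range_transport.
Context {R : realType} {E : topologicalLmodType R[i]} {W : lmodType R[i]}.
Context (L : {linear E -> W}) (L_inj : injective L).

Lemma lrange_lift_proof x : L x \in lrange_pred L.
Proof. by apply/asboolP; exists x. Qed.

Definition lrange_lift x : lrange L := MkLrange (lrange_lift_proof x).

Definition lrange_inv (w : lrange L) : E := xget 0 [set x | L x = lrange_val w].

Lemma lrange_liftK : cancel lrange_lift lrange_inv.
Proof. by move=> x; apply: xget_unique => // y /L_inj. Qed.

Lemma lrange_invK : cancel lrange_inv lrange_lift.
Proof.
move=> w; apply: val_inj => /=; rewrite /lrange_inv; case: xgetP => [x _ //|].
by case: w => w /= /asboolP[x xw] /(_ x).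
Qed.

Lemma lrange_lift_linear : linear lrange_lift.
Proof. by move=> c x y; apply: val_inj; rewrite /= linearP. Qed.

Lemma lrange_demi (n : nat) (gamma : R[i] -> R[i]) (U : set E) :
  [set fourier_demi n L (@lrange_val _ _ _ L) f | f in demi gamma U] =
  demi gamma (fourier_set L (@lrange_val _ _ _ L) U).
Proof.
have lD x y : lrange_lift (x + y) = lrange_lift x + lrange_lift y.
  by have := lrange_lift_linear 1 x y; rewrite !scale1r.
apply: fourier_demi_transport lrange_lift_linear lrange_liftK lrange_invK _ _ _.
- apply: additive_continuous0 lD _ => A [V [B [nB bB] ->] H].
  by apply: filterS nB => x Bx /=; rewrite -[lrange_lift x]add0r; apply: H; exists x.
- apply: additive_continuous0 => [v w|A nA].
    by apply: (can_inj lrange_liftK); rewrite lD !lrange_invK.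
  (* The basic neighbourhoods of [lrange] are images of balanced sets, hence the passage to a
     balanced [B]. *)
  have [B [nB bB] BA] := nbhs0_balanced nA.
  exists [set w : lrange L | exists2 x, B x & L x = lrange_val w]; first by exists B.
  move=> w [x Bx xw]; rewrite /= add0r; apply: BA.
  by rewrite (_ : w = lrange_lift x) ?lrange_liftK//; exact: val_inj.
- move=> xi z; split=> [e|->//]; exact: val_inj.
Qed.

End range_transport.

Unset Implicit Arguments.
Theorem theorem3p1 (R : realType) (n : nat) (n_gt0 : (0 < n)%N)
    (gamma : R[i] -> R[i]) (gammaC0 : C0 gamma) :
  [/\ forall a : R, 0 < a ->
        forall U : set (@Da R n a), nbhs (0 : @Da R n a) U ->
          [set fourier_demi n (@fourier_Da R n a) (@FDa_fun R n a) f
             | f in demi gamma U]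
          = demi gamma (fourier_set (@fourier_Da R n a) (@FDa_fun R n a) U),
      forall U : set (@Dtest R n), nbhs (0 : @Dtest R n) U ->
        [set fourier_demi n (@fourier_D R n) (@FD_fun R n) f
           | f in demi gamma U]
        = demi gamma (fourier_set (@fourier_D R n) (@FD_fun R n) U)
    & forall U : set (@schwartz R n), nbhs (0 : @schwartz R n) U ->
        [set fourier_demi n (@fourier_S R n) (@S_fun R n) f
           | f in demi gamma U]
        = demi gamma (fourier_set (@fourier_S R n) (@S_fun R n) U)].
Proof.
split=> [a _ U _|U _|U _].
- apply: (@lrange_demi _ _ _ (@fourier_Da R n a)) => xi zeta e; apply: val_inj.
  exact: fourier_laplace_inj (Da_in_D_pred _) (Da_in_D_pred _) e.
- apply: (@lrange_demi _ _ _ (@fourier_D R n)) => xi zeta e; apply: val_inj.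
  by apply: fourier_laplace_inj e; [case: xi|case: zeta].
(* Here [F(S)] is S with its own topology, and the homeomorphism is [S_fourier]. *)
- apply: (@fourier_demi_transport R (@schwartz R n) (@schwartz R n) _ n
    (@fourier_S R n) (@S_fun R n) _ _ gamma U (@S_fourier_linear R n) (@S_fourierK R n) (@S_fourier_invK R n)
    (@S_fourier_continuous R n) (@S_fourier_inv_continuous R n)).
  move=> xi z; rewrite fourier_S_fourier; split=> [e|->//].
  by apply: val_inj; exact: (esym e).
Qed.
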